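(* Let $K$ be a quadratic field, let $k\geqslant 2$ be an integer, and let $V'_k\subset\mathbb{Z}^2$ be the embedded set of $k$-free integers of $K$. Then the topological entropy of the induced $k$-free shift $(\mathbb{X}_{\mathcal{B}},\mathbb{Z}^2)$ agrees with the patch counting entropy of $V'_k$ and is given by $$\log(2)\,\mathrm{dens}(V'_k)=\frac{\log(2)}{\zeta_K(k)},$$ where $\zeta_K$ is the Dedekind zeta function of $K$.
   Context: Write $K=\mathbb{Q}(\sqrt{d})$ with $d\in\mathbb{Z}\setminus\{0,1\}$ square-free, with ring of integers $\mathcal{O}=\mathbb{Z}\oplus\mathbb{Z}\delta$, where $\delta=\sqrt{d}$ if $d\equiv 2,3\bmod 4$ and $\delta=\frac{1+\sqrt{d}}{2}$ if $d\equiv 1\bmod 4$. An element $0\neq x\in\mathcal{O}$ is $k$-free if $v_{\mathfrak{p}}(x)<k$ for all prime ideals $\mathfrak{p}$ of $\mathcal{O}$, where $v_{\mathfrak{p}}(x)$ is the exponent of $\mathfrak{p}$ in the factorisation of $(x)$. Set $V'_k=\{(m_1,m_2)\in\mathbb{Z}^2 : m_1+m_2\delta\text{ is }k\text{-free}\}$. Subsets of $\mathbb{Z}^2$ are identified with their characteristic functions in $\{0,1\}^{\mathbb{Z}^2}$ (product topology), and $\mathbb{X}_{\mathcal{B}}=\overline{\{t+V'_k : t\in\mathbb{Z}^2\}}$ with the $\mathbb{Z}^2$-translation action. $\mathrm{dens}(V'_k)=\lim_{r\to\infty}\mathrm{card}(V'_k\cap B_r(0))/(\pi r^2)$ is the tied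 density, with $B_r(0)\subset\mathbb{R}^2$ the disk of radius $r$ centred at $0$. The patch counting entropy of $V'_k$ is $\lim_{r\to\infty}\frac{1}{\pi r^2}\log N(r)$, where $N(r)$ is the number of distinct sets of the form $(V'_k-t)\cap B_r(0)$ with $t\in\mathbb{Z}^2$. Topological entropy is that of the $\mathbb{Z}^2$-action, normalised per lattice point, with the natural logarithm. *)

(* Defs.v *)
From HB Require Import structures.
From mathcomp Require Import all_boot all_order all_algebra all_field.
From mathcomp Require Import finmap ring zify.
From mathcomp Require Import all_classical all_reals all_analysis.

Set Implicit Arguments.
Unset Strict Implicit.
Unset Printing Implicit Defensive.

Import Order.TTheory GRing.Theory Num.Theory.
Import numFieldNormedType.Exports.

Local Open Scope classical_set_scope.
Local Open Scope ring_scope.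

Section Ideals.
Variable A : comNzRingType.
Implicit Types (I J p : set A) (x y : A) (s : seq (set A)).

Definition is_ideal I : Prop :=
  [/\ I 0, forall x y, I x -> I y -> I (x + y) & forall a x, I x -> I (a * x)].

Definition is_prime_ideal p : Prop :=
  [/\ is_ideal p, ~ p 1 & forall x y, p (x * y) -> p x \/ p y].

Definition principal x : set A := smallest is_ideal [set x].

Definition ideal_mul I J : set A :=
  smallest is_ideal [set x * y | x in I & y in J].

Definition ideal_prod s : set A := foldr ideal_mul setT s.

(* In a Dedekind domain [factorisation I] is, up to order, the factorisation
   of the nonzero ideal [I]; the default value [::] is never reached there. *)
Definition factorisation I : seq (set A) :=
  xget [::] [set s : seq (set A) | (forall p, p \in s -> is_prime_ideal p) /\
                     ideal_prod s = I].

Definition valuation p x : nat := count_mem p (factorisation (principal x)).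

Definition kfree (k : nat) x : Prop :=
  x != 0 /\ forall p, is_prime_ideal p -> (valuation p x < k)%N.

(* The cardinality of the set of cosets [x + I]. [fset_set] of an infinite
   set is empty, but nonzero ideals of a ring of integers have finite index. *)
Definition ideal_norm I : nat :=
  #|` fset_set [set [set x + y | y in I] | x in [set: A]]|.

End Ideals.

(* The Dirichlet series of the Dedekind zeta function; for [A] the ring of
   integers of a number field it is finite for real [s > 1]. *)
Definition dedekind_zeta (R : realType) (A : comNzRingType) (s : R) : \bar R :=
  \esum_(I in [set I : set A | is_ideal I /\ I <> [set 0]])
    ((ideal_norm I)%:R `^ (- s))%:E.

Definition squarefree (d : int) : Prop :=
  forall a : int, (a ^+ 2 %| d)%Z -> a \is a GRing.unit.

Section QuadraticIntegers.
Variable d : int.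

Definition sqrtd : algC := sqrtC d%:~R.

Definition quad_field : set algC :=
  [set z | exists a b : rat, z = ratr a + ratr b * sqrtd].

Definition quad_int : {pred algC} :=
  [pred z | `[< quad_field z >] && (z \in Aint)].

Lemma sqrtd2 : sqrtd ^+ 2 = d%:~R.
Proof. exact: sqrtCK. Qed.

Lemma quad_int_subring : subring_closed quad_int.
Proof.
split.
- rewrite inE Aint1 andbT; apply/asboolP; exists 1, 0.
  by rewrite rmorph1 rmorph0 mul0r addr0.
- move=> x y; rewrite !inE => /andP[/asboolP[a [b ->]] xA].
  move=> /andP[/asboolP[a' [b' ->]] yA].
  rewrite rpredB// andbT; apply/asboolP; exists (a - a'), (b - b').
  by rewrite !rmorphB /=; ring.
- move=> x y; rewrite !inE => /andP[/asboolP[a [b ->]] xA].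
  move=> /andP[/asboolP[a' [b' ->]] yA].
  rewrite rpredM// andbT; apply/asboolP.
  exists (a * a' + b * b' * d%:~R), (a * b' + b * a').
  rewrite !rmorphD !rmorphM /= ratr_int -sqrtd2; ring.
Qed.

HB.instance Definition _ :=
  GRing.isSubringClosed.Build algC quad_int quad_int_subring.

Record ringint := RingInt { ringint_val :> algC; _ : ringint_val \in quad_int }.

HB.instance Definition _ := [isSub for ringint_val].
HB.instance Definition _ := [Choice of ringint by <:].
HB.instance Definition _ := [SubChoice_isSubComNzRing of ringint by <:].

Definition deltaC : algC :=
  if (d %% 4)%Z == 1 then (1 + sqrtd) / 2 else sqrtd.

Lemma deltaC_quad_int : deltaC \in quad_int.
Proof.
have sA : sqrtd \in Aint.
  apply: (@root_monic_Aint ('X^2 - (d%:~R)%:P)).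
  - by rewrite rootE !hornerE sqrtd2 subrr.
  - by apply: monicXnsubC.
  - by rewrite polyOverXnsubC intr_int.
rewrite inE; apply/andP; split.
  apply/asboolP; rewrite /deltaC; case: ifP => _; last first.
    by exists 0, 1; rewrite rmorph0 rmorph1 add0r mul1r.
  by exists (1 / 2), (1 / 2); rewrite !fmorph_div rmorph1 rmorph_nat; field.
rewrite /deltaC; case: ((d %% 4)%Z =P 1) => [d4|_]; last exact: sA.
pose e : int := (d %/ 4)%Z.
have dE : d = e * 4 + 1 by rewrite -[X in _ + X]d4 -divz_eq.
have dC : d%:~R = e%:~R * 4 + 1 :> algC by rewrite {1}dE rmorphD rmorphM.
apply: (@root_monic_Aint ('X^2 - ('X + (e%:~R)%:P))).
- rewrite rootE !hornerE; apply/eqP.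
  have -> : e%:~R = (sqrtd ^+ 2 - 1) / 4 by rewrite sqrtd2 dC; field.
  by field.
- rewrite monicE lead_coefDl ?lead_coefXn // size_polyN size_XaddC size_polyXn //.
- apply/polyOverP => i; rewrite !coefE.
  by rewrite rpredB ?rpredD ?natr_int //; case: ifP => _; rewrite ?intr_int ?rpred0.
Qed.

Definition delta : ringint := RingInt deltaC_quad_int.

Definition kfree_set (k : nat) : set (int * int) :=
  [set m | kfree k (m.1%:~R + m.2%:~R * delta)].

End QuadraticIntegers.

Section RingOfIntegers.
Variable d : int.
Hypotheses (d1 : d != 1) (dsf : squarefree d).
Local Notation s := (sqrtd d).

Let ratrD (a b : rat) : ratr (a + b) = ratr a + ratr b :> algC.
Proof. exact: rmorphD. Qed.
Let ratrB (a b : rat) : ratr (a - b) = ratr a - ratr b :> algC.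
Proof. exact: rmorphB. Qed.
Let ratrM (a b : rat) : ratr (a * b) = ratr a * ratr b :> algC.
Proof. exact: rmorphM. Qed.

Lemma sqrtd_irrational : s \notin Crat.
Proof.
apply/negP => sQ.
have sA : s \in Aint.
  apply: (@root_monic_Aint ('X^2 - (d%:~R)%:P)).
  - by rewrite rootE !hornerE sqrtd2 subrr.
  - by apply: monicXnsubC.
  - by rewrite polyOverXnsubC intr_int.
have /intrP[m sm] := Cint_rat_Aint sQ sA.
have dm : d = m ^+ 2.
  by apply: (@intr_inj algC); rewrite ?rmorphXn /= -sm sqrtd2.
have mu : m \is a GRing.unit by apply: dsf; rewrite dm.
by case/negP: d1; rewrite dm; case/orP: mu => /eqP ->.
Qed.

Lemma sqrtd_indep (a b : rat) : ratr a + ratr b * s = 0 -> a = 0 /\ b = 0.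
Proof.
have [-> /eqP|b0 /eqP] := eqVneq b 0.
  by rewrite rmorph0 mul0r addr0 fmorph_eq0 => /eqP.
rewrite addr_eq0 => /eqP ab; case/negP: sqrtd_irrational.
apply/CratP; exists (- a / b); rewrite fmorph_div rmorphN /= ab opprK mulrC.
by rewrite mulKf ?fmorph_eq0.
Qed.

Lemma quad_conj_Aint (a b : rat) :
  ratr a + ratr b * s \in Aint -> ratr a - ratr b * s \in Aint.
Proof.
set x := _ + _; set y := _ - _ => xA.
have pxy (p : {poly rat}) : exists u v : rat,
    (map_poly ratr p).[x] = ratr u + ratr v * s /\
    (map_poly ratr p).[y] = ratr u - ratr v * s.
  elim/poly_ind: p => [|p c [u [v [px py]]]].
    by exists 0, 0; rewrite rmorph0 !horner0 rmorph0 mul0r subr0 addr0.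
  have pz z : (map_poly ratr (p * 'X + c%:P)).[z] =
      (map_poly ratr p).[z] * z + ratr c :> algC.
    by rewrite rmorphD rmorphM /= map_polyX map_polyC !hornerE.
  have dE : ratr d%:~R = s ^+ 2 by rewrite ratr_int sqrtd2.
  exists (u * a + v * b * d%:~R + c), (u * b + v * a).
  by rewrite !pz px py !(ratrD, ratrM) dE /x /y; split; ring.
have [p [pE _] _] := minCpolyP x.
apply: (@root_monic_Aint (minCpoly x)) => //; last exact: minCpoly_monic.
have [u [v [px py]]] := pxy p.
have := root_minCpoly x; rewrite pE !rootE px py => /eqP/sqrtd_indep[-> ->].
by rewrite rmorph0 mul0r subr0.
Qed.

Lemma int_of_Aint (a : rat) : ratr a \in Aint -> exists m : int, a = m%:~R.
Proof.
move=> aA; have /intrP[m am] := Cint_rat_Aint (Crat_rat a) aA.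
by exists m; apply: (fmorph_inj (ratr : {rmorphism rat -> algC})); rewrite /= am ratr_int.
Qed.

Lemma int_of_sqrM (c : rat) (m : int) : c ^+ 2 * d%:~R = m%:~R ->
  exists n : int, c = n%:~R.
Proof.
move=> cm; have v0 : (denq c)%:~R != 0 :> rat by rewrite intr_eq0 denq_neq0.
have E : numq c ^+ 2 * d = m * denq c ^+ 2.
  apply: (@intr_inj rat); rewrite !rmorphM ?rmorphXn /= -cm.
  by rewrite -[X in X ^+ 2 * _ * _]divq_num_den; field.
have /dsf : (denq c ^+ 2 %| d)%Z.
  rewrite -(@Gauss_dvdzr (denq c ^+ 2) (numq c ^+ 2)) ?E; first by rewrite dvdz_mull.
  by apply: coprimezXl; apply: coprimezXr; rewrite coprimez_sym; exact: coprime_num_den.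
move=> vu; exists (numq c); rewrite -[LHS]divq_num_den.
have := denq_gt0 c; case/orP: vu => /eqP -> // _; by rewrite divr1.
Qed.

Lemma parity (T B N : int) : T ^+ 2 - d * B ^+ 2 = 4 * N -> (d %% 4)%Z != 0 ->
  if (d %% 4)%Z == 1 then (T %% 2)%Z = (B %% 2)%Z
  else (T %% 2)%Z = 0 /\ (B %% 2)%Z = 0.
Proof.
have := divz_eq T 2; have := divz_eq B 2; have := divz_eq d 4.
have := ltz_pmod T (isT : 0 < 2 :> int); have := modz_ge0 T (isT : 2 != 0 :> int).
have := ltz_pmod B (isT : 0 < 2 :> int); have := modz_ge0 B (isT : 2 != 0 :> int).
have := ltz_pmod d (isT : 0 < 4 :> int); have := modz_ge0 d (isT : 4 != 0 :> int).
move: (T %/ 2)%Z (T %% 2)%Z (B %/ 2)%Z (B %% 2)%Z (d %/ 4)%Z (d %% 4)%Z.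
move=> t i b j e f f0 f4 j0 j2 i0 i2 -> -> -> E fn0.
have : f = 1 \/ f = 2 \/ f = 3 by lia.
have : i = 0 \/ i = 1 by lia.
have : j = 0 \/ j = 1 by lia.
move: E; rewrite !expr2 => E.
by case=> ?; case=> ?; (case=> [?|[?|?]]); subst; rewrite /= //; lia.
Qed.

(* The ring of integers of Q(sqrt d) is Z (+) Z delta. *)
Lemma ringint_basis (x : ringint d) :
  exists! m : int * int, x = m.1%:~R + m.2%:~R * delta d.
Proof.
have valE (m : int * int) : ringint_val (m.1%:~R + m.2%:~R * delta d)
    = m.1%:~R + m.2%:~R * deltaC d.
  by rewrite -[LHS]/(\val (m.1%:~R + m.2%:~R * delta d)) rmorphD rmorphM !rmorph_int.
have [e [ed dE]] : exists e : bool, ((d %% 4)%Z == 1) = e /\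
    deltaC d = (e%:R + s) / (1 + e%:R).
  by exists ((d %% 4)%Z == 1); rewrite /deltaC; case: ifP;
    rewrite // add0r addr0 divr1.
have uniq_m (m m' : int * int) : m.1%:~R + m.2%:~R * deltaC d =
    m'.1%:~R + m'.2%:~R * deltaC d -> m = m'.
  move=> mm; have mu : (1 + e%:R) != 0 :> algC by case: (e).
  pose f : rat := (1 + e%:R)^-1.
  have fE : ratr f = (1 + e%:R)^-1 :> algC.
    by rewrite fmorphV rmorphD rmorph1 rmorph_nat.
  have f0 : f != 0 by rewrite invr_eq0; case: (e).
  have [] := @sqrtd_indep ((m.1 - m'.1)%:~R + (m.2 - m'.2)%:~R * e%:R * f)
    ((m.2 - m'.2)%:~R * f).
    rewrite ratrD !ratrM fE !ratr_int rmorph_nat !intrB; move: mm.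
    by rewrite dE => /eqP; rewrite -subr_eq0 => /eqP <-; field.
  move=> + /eqP; rewrite mulf_eq0 (negPf f0) orbF intr_eq0 => + /eqP m2.
  rewrite m2 mul0r mul0r addr0 => /eqP; rewrite intr_eq0 => /eqP m1.
  by case: m m' {mm} m1 m2 => [? ?] [? ?] /= /subr0_eq -> /subr0_eq ->.
suff [m xm] : exists m : int * int,
    ringint_val x = m.1%:~R + m.2%:~R * deltaC d.
  exists m; split; first by apply: val_inj; rewrite -[RHS]/(ringint_val _) valE -xm.
  by move=> m' xm'; apply: uniq_m; rewrite -xm -valE -xm'.
case: x => z /=; rewrite inE => /andP[/asboolP[a [b ->]] zA].
have yA := quad_conj_Aint zA.
have [T TE] : exists T : int, 2 * a = T%:~R.
  apply: int_of_Aint; rewrite ratrM rmorph_nat.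
  suff -> : 2 * ratr a = (ratr a + ratr b * s) + (ratr a - ratr b * s).
    exact: rpredD.
  ring.
have [N NE] : exists N : int, a ^+ 2 - b ^+ 2 * d%:~R = N%:~R.
  apply: int_of_Aint; suff -> : ratr (a ^+ 2 - b ^+ 2 * d%:~R) =
    (ratr a + ratr b * s) * (ratr a - ratr b * s) by exact: rpredM.
  by rewrite ratrB !expr2 !ratrM ratr_int -sqrtd2; ring.
have [B BE] : exists B : int, 2 * b = B%:~R.
  apply: (@int_of_sqrM _ (T ^+ 2 - 4 * N)).
  by rewrite rmorphB ?rmorphXn rmorphM /= -TE -NE; ring.
have E : T ^+ 2 - d * B ^+ 2 = 4 * N.
  apply: (@intr_inj rat).
  by rewrite rmorphB !rmorphM ?rmorphXn /= -TE -NE -BE; ring.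
have aE : ratr a = T%:~R / 2 :> algC.
  have := congr1 (@ratr algC) TE; rewrite ratrM rmorph_nat ratr_int => <-.
  by field.
have bE : ratr b = B%:~R / 2 :> algC.
  have := congr1 (@ratr algC) BE; rewrite ratrM rmorph_nat ratr_int => <-.
  by field.
have d4 : (d %% 4)%Z != 0.
  by apply/eqP => /dvdz_mod0P; rewrite -[4]/(2 ^+ 2 : int) => /dsf.

have := parity E d4.
rewrite aE bE ed; case: e ed dE => ed dE par.
  have [n nE] : exists n, T = 2 * n + B by exists ((T - B) %/ 2)%Z; lia.
  exists (n, B); rewrite dE nE !(intrD, intrM) (_ : true%:R = 1) //=.
  by field.
have [n [-> ->]] : exists n : int * int, T = 2 * n.1 /\ B = 2 * n.2.
  by exists ((T %/ 2)%Z, (B %/ 2)%Z) => /=; lia.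
by exists n; rewrite dE !intrM (_ : false%:R = 0) //; field.
Qed.
End RingOfIntegers.

Section LatticeSets.
Variable R : realType.
Implicit Types (V : set (int * int)) (r : R).

Definition disk r : set (int * int) :=
  [set m | m.1%:~R ^+ 2 + m.2%:~R ^+ 2 < r ^+ 2].

Definition tied_density V (D : R) : Prop :=
  (#|` fset_set (V `&` disk r)|%:R / (pi * r ^+ 2)) @[r --> +oo] --> D.

Definition patch_number V r : nat :=
  #|` fset_set [set [set v - t | v in V] `&` disk r | t in [set: int * int]]|.

Definition patch_counting_entropy V (h : R) : Prop :=
  (ln (patch_number V r)%:R / (pi * r ^+ 2)) @[r --> +oo] --> h.

End LatticeSets.

Section TopologicalEntropy.
Variables (R : realType) (T : topologicalType).
Variables (act : int * int -> T -> T) (X : set T).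
Implicit Types (U : set (set T)) (n : nat).

(* Relatively open covers of [X], given by open sets of the ambient space. *)
Definition open_cover U : Prop :=
  (forall A, U A -> open A) /\ X `<=` \bigcup_(A in U) A.

Definition square n : set (int * int) :=
  [set t | [/\ 0 <= t.1, t.1 < n%:Z, 0 <= t.2 & t.2 < n%:Z]].

(* The common refinement of the covers [act t @^-1` U], t in [square n]. *)
Definition iterated_join U n : set (set T) :=
  [set \bigcap_(t in square n) (act t @^-1` phi t)
     | phi in [set phi : int * int -> set T | forall t, U (phi t)]].

(* The minimal cardinality of a finite subcover of [X]. *)
Definition subcover_number U : R :=
  inf [set (size s)%:R
         | s in [set s : seq (set T) | (forall A, A \in s -> U A) /\
                                       X `<=` \bigcup_(A in [set` s]) A]].

(* The Adler-Konheim-McAndrew entropy of the Z^2-action [act] on [X]. For a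
   compact invariant [X] the upper limit is a limit, by subadditivity. *)
Definition cover_entropy U : \bar R :=
  limn_esup (fun n => (ln (subcover_number (iterated_join U n)) / n%:R ^+ 2)%:E).

Definition topological_entropy : \bar R :=
  ereal_sup [set cover_entropy U | U in [set U | open_cover U]].

End TopologicalEntropy.

Notation full_shift := {ptws int * int -> bool}.

Definition translate (t : int * int) (f : full_shift) : full_shift :=
  fun m => f (m - t).

Definition char_fun (V : set (int * int)) : full_shift := fun m => `[< V m >].

Definition shift_space (V : set (int * int)) : set full_shift :=
  closure [set char_fun [set t + v | v in V] | t in [set: int * int]].

(* Main.v *)
Require Import Defs.
From HB Require Import structures.
From mathcomp Require Import all_boot all_order all_algebra all_field.
From mathcomp Require Import finmap ring lra zify.
From mathcomp Require Import all_classical all_reals all_analysis.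

Set Implicit Arguments.
Unset Strict Implicit.
Unset Printing Implicit Defensive.

Import Order.TTheory GRing.Theory Num.Theory.
Import numFieldNormedType.Exports.

Local Open Scope classical_set_scope.
Local Open Scope ring_scope.

(* For a finite set F of prime ideals p, the x in O outside all p^k form a
   periodic set, of density prod_(p in F) (1 - N(p)^-k) by inclusion-exclusion.
   As F grows these products tend to 1 / zeta_K(k). The points removed by the
   remaining primes have small upper density: p^k has at most O(1 + M^2 / N(p)^k)
   points in a box of side M, because N(p)^k divides the norm of its elements.
   This gives the density D of V, and tiling by the periods gives at most
   2^((D + o(1)) #E) patterns of V in a large disk or square E. Conversely the
   Chinese remainder theorem and the same sieve show that every subset of V inside
   E is a pattern of V, whence at least 2^((D - o(1)) #E) patterns. The topological
   entropy is the growth rate of the number of patterns in squares, by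
   compactness (a Lebesgue number for open covers) for the upper bound and by the
   cover into the two cylinders at the origin for the lower bound. *)

(** * Products of ideals *)

(** The density is only a tied one: V has holes of every size (realise the empty subset in a large
    window), so no positive lower count holds in windows placed arbitrarily. Upper counts therefore
    go through the periodic superset, whose counts are uniform in the translate, while lower counts
    are made only in windows of side M at distance O(M) from the origin. [approximable] records this
    split; together with [hereditary] it is all that the density and entropy arguments know about V.
    The delicate point of the sieve is that the number of relevant primes grows with the box and
    each brings a bounded error of its own. Such a prime has weight at least a constant over M^2, so
    counting these primes is again a matter of the tail of the zeta series. The arithmetic of ideals
    is read off explicit lattices: a Hermite normal form gives the index, and the identity I conj(I)
    = (N(I)) gives cancellation, divisibility and multiplicativity of the norm. *)

Section IdealProducts.
Variable A : comNzRingType.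
Implicit Types (I J K p : set A) (x y : A) (s : seq (set A)).

Lemma is_ideal_smallest (G : set A) : is_ideal (smallest (@is_ideal A) G).
Proof.
split=> [|x y hx hy|a x hx] M [MI GM]; first by case: MI.
- by case: (MI) => _ h _; apply: h; [apply: hx|apply: hy].
- by case: (MI) => _ _; apply; apply: hx.
Qed.

Lemma is_ideal_setT : is_ideal [set: A]. Proof. by []. Qed.

Lemma is_ideal_mul I J : is_ideal (ideal_mul I J).
Proof. exact: is_ideal_smallest. Qed.

Lemma is_ideal_principal x : is_ideal (principal x).
Proof. exact: is_ideal_smallest. Qed.

Lemma ideal_opp I x : is_ideal I -> I x -> I (- x).
Proof. by case=> _ _ h Ix; rewrite -mulN1r; exact: h. Qed.

Lemma ideal_sub I x y : is_ideal I -> I x -> I y -> I (x - y).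
Proof. by move=> iI Ix Iy; case: (iI) => _ h _; apply: h => //; exact: ideal_opp. Qed.

Lemma ideal1 I : is_ideal I -> I 1 -> I = setT.
Proof.
by case=> _ _ h I1; apply/seteqP; split=> // x _; rewrite -[x]mulr1; exact: h.
Qed.

Lemma mem_ideal_mul I J x y : I x -> J y -> ideal_mul I J (x * y).
Proof. by move=> Ix Jy; apply: sub_gen_smallest; exists x => //; exists y. Qed.

Lemma ideal_mul_subset I J K : is_ideal K ->
  (forall x y, I x -> J y -> K (x * y)) -> ideal_mul I J `<=` K.
Proof.
by move=> iK h; apply: smallest_sub => // _ [x Ix [y Jy <-]]; exact: h.
Qed.

Lemma ideal_mulSS I I' J J' : I `<=` I' -> J `<=` J' ->
  ideal_mul I J `<=` ideal_mul I' J'.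
Proof.
move=> sI sJ; apply: ideal_mul_subset; first exact: is_ideal_mul.
by move=> x y /sI ? /sJ ?; exact: mem_ideal_mul.
Qed.

Lemma ideal_mulC I J : ideal_mul I J = ideal_mul J I.
Proof.
by apply/seteqP; split; apply: ideal_mul_subset; (try exact: is_ideal_mul) =>
  x y ? ?; rewrite mulrC; exact: mem_ideal_mul.
Qed.

(** The colon ideal (K : y): it reduces a containment in a product ideal to generators in one
    variable at a time. *)
Lemma is_ideal_colon K y : is_ideal K -> is_ideal [set x | K (x * y)].
Proof.
move=> [K0 KD KM]; split=> /= [|u v ? ?|a u ?]; rewrite ?mul0r// ?mulrDl.
  exact: KD.
by rewrite -mulrA; exact: KM.
Qed.

Lemma ideal_mulA I J K : ideal_mul I (ideal_mul J K) = ideal_mul (ideal_mul I J) K.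
Proof.
suff h (X Y Z : set A) :
    ideal_mul (ideal_mul X Y) Z `<=` ideal_mul X (ideal_mul Y Z).
  apply/seteqP; split; last exact: h.
  rewrite ideal_mulC [ideal_mul J K]ideal_mulC (ideal_mulC I J).
  by rewrite [X in _ `<=` X]ideal_mulC; exact: h.
apply: ideal_mul_subset; first exact: is_ideal_mul.
move=> x z + Zz; move: x; apply: ideal_mul_subset.
  by apply: is_ideal_colon; exact: is_ideal_mul.
move=> x y Xx Yy /=; rewrite -mulrA.
by apply: mem_ideal_mul => //; exact: mem_ideal_mul.
Qed.

Lemma ideal_mul_subr I J : is_ideal J -> ideal_mul I J `<=` J.
Proof. by move=> iJ; apply: ideal_mul_subset => // x y _; case: iJ => _ _; apply. Qed.

Lemma ideal_mul_subl I J : is_ideal I -> ideal_mul I J `<=` I.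
Proof. by rewrite ideal_mulC; exact: ideal_mul_subr. Qed.

Lemma ideal_mulT I : is_ideal I -> ideal_mul I setT = I.
Proof.
move=> iI; apply/seteqP; split; first exact: ideal_mul_subl.
by move=> x Ix; rewrite -[x]mulr1; exact: mem_ideal_mul.
Qed.

Lemma ideal_mulTl I : is_ideal I -> ideal_mul setT I = I.
Proof. by rewrite ideal_mulC; exact: ideal_mulT. Qed.

Lemma principalP x y : principal x y <-> exists a, y = a * x.
Proof.
split.
  apply: (@smallest_sub _ _ _ [set z | exists a, z = a * x]); last first.
    by move=> _ ->; exists 1; rewrite mul1r.
  split=> /= [|u v [a ->] [b ->]|c u [a ->]].
  - by exists 0; rewrite mul0r.
  - by exists (a + b); rewrite mulrDl.
  - by exists (c * a); rewrite mulrA.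
case=> a ->; case: (is_ideal_principal x) => _ _; apply.
exact: sub_gen_smallest.
Qed.

Lemma mem_principal x : principal x x.
Proof. by apply/principalP; exists 1; rewrite mul1r. Qed.

Lemma principal_subset x I : is_ideal I -> (principal x `<=` I) <-> I x.
Proof.
move=> iI; split=> [h|Ix y]; first by apply: h; exact: mem_principal.
by move=> /principalP[a ->]; case: iI => _ _; apply.
Qed.

Lemma principal_mul x y : ideal_mul (principal x) (principal y) = principal (x * y).
Proof.
apply/seteqP; split.
  apply: ideal_mul_subset; first exact: is_ideal_principal.
  move=> _ _ /principalP[a ->] /principalP[b ->].
  by apply/principalP; exists (a * b); ring.
move=> _ /principalP[a ->]; rewrite mulrA.
apply: mem_ideal_mul; last exact: mem_principal.
by apply/principalP; exists a.
Qed.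

Lemma is_ideal_prod s : (forall I, I \in s -> is_ideal I) -> is_ideal (ideal_prod s).
Proof. by case: s => [_|I s _] /=; [exact: is_ideal_setT|exact: is_ideal_mul]. Qed.

Lemma ideal_prod_cat s1 s2 :
  ideal_prod (s1 ++ s2) = ideal_mul (ideal_prod s1) (ideal_prod s2).
Proof.
elim: s1 => [|I s1 IH] /=; last by rewrite IH ideal_mulA.
by rewrite ideal_mulTl//; case: s2 => [|I s2] /=; [|exact: is_ideal_mul].
Qed.

Lemma ideal_prod_perm s1 s2 : perm_eq s1 s2 -> ideal_prod s1 = ideal_prod s2.
Proof.
elim: s1 s2 => [|I s1 IH] s2 Is; first by move: Is; rewrite perm_sym => /perm_nilP->.
have Is2 : I \in s2 by rewrite -(perm_mem Is) mem_head.
move: Is; case/splitPr: s2 / Is2 => s2 s3 Is.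
have {}Is : perm_eq s1 (s2 ++ s3).
  by rewrite -(perm_cons I) (perm_trans Is) // -[I :: s3]cat1s perm_catCA.
rewrite /= (IH _ Is) !ideal_prod_cat /= !ideal_mulA.
by rewrite [ideal_mul I _]ideal_mulC.
Qed.

Definition ideal_exp I n : set A := ideal_prod (nseq n I).

Lemma ideal_expS I n : ideal_exp I n.+1 = ideal_mul I (ideal_exp I n).
Proof. by []. Qed.

Lemma is_ideal_exp I n : is_ideal (ideal_exp I n).
Proof. by case: n => [|n]; [exact: is_ideal_setT|exact: is_ideal_mul]. Qed.

Lemma ideal_exp_subset I n : is_ideal I -> (0 < n)%N -> ideal_exp I n `<=` I.
Proof. by case: n => // n iI _; exact: ideal_mul_subl. Qed.

Lemma mem_ideal_exp I n x : I x -> ideal_exp I n (x ^+ n).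
Proof.
by move=> Ix; elim: n => [|n IH] //; rewrite exprS; exact: mem_ideal_mul.
Qed.

Lemma prime_mul_subset p I J : is_prime_ideal p -> is_ideal I -> is_ideal J ->
  ideal_mul I J `<=` p -> I `<=` p \/ J `<=` p.
Proof.
move=> [_ _ pp] iI iJ h; have [?|/existsNP[x /not_implyP[Ix px]]] := pselect (I `<=` p).
  by left.
right=> y Jy; case: (pp x y) => //; apply: h; exact: mem_ideal_mul.
Qed.

Lemma prime_prod_subset p s : is_prime_ideal p -> (forall I, I \in s -> is_ideal I) ->
  ideal_prod s `<=` p -> exists2 I, I \in s & I `<=` p.
Proof.
move=> pp; elim: s => [|I s IH] hs /=.
  by case: pp => _ p1 _ /(_ 1) h; case: p1; exact: h.
have hI : is_ideal I by apply: hs; rewrite mem_head.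
have hs' J : J \in s -> is_ideal J by move=> Js; apply: hs; rewrite inE Js orbT.
case/(prime_mul_subset pp hI (is_ideal_prod hs')) => [|/IH[//|J Js Jp]].
  by exists I; rewrite ?mem_head.
by exists J; rewrite // inE Js orbT.
Qed.

(* If I + p is the whole ring then so is I + p^n. *)
Lemma comaximal_exp_capE I p n : is_ideal I -> is_ideal p ->
  (exists2 x, I x & p (1 - x)) -> I `&` ideal_exp p n = ideal_mul I (ideal_exp p n).
Proof.
move=> iI ip [x Ix px]; apply/seteqP; split; last first.
  by move=> z h; split; [exact: ideal_mul_subl h|exact: ideal_mul_subr (is_ideal_exp _ _) _ h].
have [y Iy py] : exists2 y, I y & ideal_exp p n (1 - y).
  exists (1 - (1 - x) ^+ n); last by rewrite opprB addrC subrK; exact: mem_ideal_exp.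
  elim: n => [|n IH]; first by rewrite expr0 subrr; case: iI.
  rewrite exprS (_ : _ - _ = (1 - (1 - x) ^+ n) + (1 - x) ^+ n * x); last by ring.
  by case: iI => _ ID IM; apply: ID => //; exact: IM.
move=> z [Iz pz]; have -> : z = y * z + z * (1 - y) by ring.
case: (is_ideal_mul I (ideal_exp p n)) => _ h _; apply: h; exact: mem_ideal_mul.
Qed.

End IdealProducts.

(** * Subgroups of Z, residue classes and counting in boxes *)

Lemma int_subgroup (P : set int) (x0 : int) :
  P 0 -> (forall x y, P x -> P y -> P (x - y)) -> P x0 -> x0 != 0 ->
  exists2 c : int, 0 < c & forall x, P x <-> (c %| x)%Z.
Proof.
move=> P0 PB Px0 x0_neq0.
have PN x : P x -> P (- x) by move=> ?; rewrite -sub0r; exact: PB.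
have PD x y : P x -> P y -> P (x + y) by move=> ? ?; rewrite -[y]opprK; apply/PB/PN.
have exn : exists n : nat, (0 < n)%N && `[< P n%:Z >].
  exists `|x0|%N; rewrite absz_gt0 x0_neq0; apply/asboolP.
  by rewrite abszE; case: (ger0P x0) => _ //; exact: PN.
have [n /andP[n_gt0 /asboolP Pn] n_min] := ex_minnP exn.
have Pmul (z : int) : P (z * n%:Z).
  have Pnat (m : nat) : P (m%:Z * n%:Z).
    by elim: m => [|m IH]; rewrite ?mul0r// -addn1 PoszD mulrDl mul1r; exact: PD.
  by case: z => m //; rewrite NegzE mulNr; exact/PN/Pnat.
exists n%:Z => // x; split=> [Px|/dvdzP[q ->]]; last exact: Pmul.
apply/dvdz_mod0P.
have xE := divz_eq x n%:Z.
have n_neq0 : n%:Z != 0 by rewrite eqz_nat -lt0n.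
have r_ge0 := modz_ge0 x n_neq0; have r_lt := ltz_pmod x (n_gt0 : 0 < n%:Z).
have Pr : P (x %% n)%Z.
  by rewrite (_ : (x %% n)%Z = x - (x %/ n)%Z * n%:Z); [exact: PB|lia].
case: (x %% n)%Z r_ge0 r_lt Pr => // -[//|m] _ m_lt Pm.
by have := n_min m.+1; rewrite (asboolT Pm) => /(_ isT); lia.
Qed.

Definition count_box (M : nat) (P : set (int * int)) : nat :=
  (\sum_(i < M) \sum_(j < M) `[< P (i%:Z, j%:Z) >])%N.

Lemma count_residue (n q : nat) (s : int) : (0 < n)%N ->
  (\sum_(i < n * q) nat_of_bool (n%:Z %| (i%:Z - s)%R)%Z)%N = q.
Proof.
move=> n_gt0; elim: q => [|q IH]; first by rewrite muln0 big_ord0.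
rewrite mulnS addnC big_split_ord /= IH -[RHS]addn1; congr addn.
have n_neq0 : n%:Z != 0 by rewrite eqz_nat -lt0n.
have r_ge0 := modz_ge0 s n_neq0; have r_lt := ltz_pmod s (n_gt0 : 0 < n%:Z).
have sE := divz_eq s n%:Z.
have rn : (`|(s %% n)%Z| < n)%N by lia.
have dvdE (j : 'I_n) : (n%:Z %| (n * q + j)%N%:Z - s)%Z = (j == Ordinal rn).
  apply/idP/eqP => [/dvdzP[e eE]|->]; last first.
    by apply/dvdzP; exists (q%:Z - (s %/ n)%Z); rewrite /=; lia.
  apply: val_inj => /=; have j_lt := ltn_ord j.
  have : (e - q%:Z + (s %/ n)%Z) * n%:Z = j%:Z - (s %% n)%Z by lia.
  set t := e - _ + _ => tE.
  have t0 : t = 0.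
    by move: (s %% n)%Z r_ge0 r_lt tE => r ? ? ?; nia.
  by move: tE; rewrite t0 mul0r; lia.
rewrite (eq_bigr (fun j => (j == Ordinal rn) : nat)); last by move=> j _; rewrite dvdE.
by rewrite (bigD1 (Ordinal rn)) //= eqxx big1 // => j /negPf ->.
Qed.

Lemma card_fset_set_image (T : finType) (U : choiceType) (f : T -> U) :
  injective f -> #|` fset_set (f @` [set: T])| = #|T|.
Proof.
move=> f_inj; have -> : f @` [set: T] = [set` [fset x in map f (enum T)]%fset].
  apply/seteqP; split=> [_ [x _ <-]|y] /=.
    by rewrite inE; apply: map_f; rewrite mem_enum.
  by rewrite inE => /mapP[x _ ->]; exists x.
rewrite set_fsetK card_fseq undup_id ?size_map; first by rewrite cardT enumT.
by rewrite (map_inj_uniq f_inj) enum_uniq.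
Qed.

(** * Ideals of the ring of integers of a quadratic field *)

Section QuadraticArithmetic.
Variable d : int.
Hypotheses (d_neq1 : d != 1) (d_sqfree : squarefree d).
Local Notation O := (ringint d).
Local Notation delta := (delta d).

(** Trace T and norm n0 make [delta] a root of X^2 - T X + n0. When d = 1 mod 4 the quotient d %/ 4
    is (d - 1) / 4. *)
Definition tr_delta : int := if (d %% 4)%Z == 1 then 1 else 0.
Definition nm_delta : int := if (d %% 4)%Z == 1 then - (d %/ 4)%Z else - d.
Local Notation T := tr_delta.
Local Notation n0 := nm_delta.

Definition elt (m : int * int) : O := m.1%:~R + m.2%:~R * delta.

Lemma delta_sqr : delta ^+ 2 = T%:~R * delta - n0%:~R.
Proof.
apply: val_inj; rewrite rmorphB rmorphXn rmorphM !rmorph_int /=.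
rewrite /T /n0 /deltaC; case: ifP => [/eqP d4|_].
  have dC : d%:~R = (d %/ 4)%Z%:~R * 4 + 1 :> algC.
    by rewrite {1}(divz_eq d 4) d4 rmorphD rmorphM.
  have -> : ((1 + sqrtd d) / 2) ^+ 2 =
      (1 + 2 * sqrtd d + sqrtd d ^+ 2) / 4 by field.
  by rewrite sqrtd2 dC rmorphN /=; field.
by rewrite sqrtd2 rmorphN /= mul0r sub0r opprK.
Qed.

Lemma elt_bij : bijective elt.
Proof.
have /all_sig[f fE] (x : O) : {m : int * int | x = elt m}.
  by apply: cid; have [m [-> _]] := ringint_basis d_neq1 d_sqfree x; exists m.
exists f => [m|x]; last by rewrite -fE.
have [m' [_ h]] := ringint_basis d_neq1 d_sqfree (elt m).
by have {2}<- := h m erefl; rewrite -(h _ (fE _)).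
Qed.

Lemma elt_inj : injective elt. Proof. exact: bij_inj elt_bij. Qed.

Lemma eltP (x : O) : exists m, x = elt m.
Proof. by case: elt_bij => g _ gK; exists (g x); rewrite gK. Qed.

Lemma eltD m m' : elt m + elt m' = elt (m.1 + m'.1, m.2 + m'.2).
Proof. by rewrite /elt !rmorphD /=; ring. Qed.

Lemma eltN m : - elt m = elt (- m.1, - m.2).
Proof. by rewrite /elt !rmorphN /=; ring. Qed.

Lemma eltB m m' : elt m - elt m' = elt (m.1 - m'.1, m.2 - m'.2).
Proof. by rewrite eltN eltD. Qed.

Lemma eltM m m' : elt m * elt m' =
  elt (m.1 * m'.1 - n0 * (m.2 * m'.2), m.1 * m'.2 + m.2 * m'.1 + T * (m.2 * m'.2)).
Proof.
rewrite /elt /= !(rmorphD, rmorphB, rmorphM) /=.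
transitivity (m.1%:~R * m'.1%:~R + (m.1%:~R * m'.2%:~R + m.2%:~R * m'.1%:~R) * delta
  + m.2%:~R * m'.2%:~R * delta ^+ 2); first by ring.
by rewrite delta_sqr; ring.
Qed.

Lemma elt_int (n : int) : n%:~R = elt (n, 0).
Proof. by rewrite /elt /= mul0r addr0. Qed.

Lemma elt0 : elt (0, 0) = 0. Proof. by rewrite -elt_int. Qed.

Lemma elt_scale (n : int) m : n%:~R * elt m = elt (n * m.1, n * m.2).
Proof. by rewrite elt_int eltM /=; congr elt; congr pair; ring. Qed.

Lemma intO_inj (n m : int) : n%:~R = m%:~R :> O -> n = m.
Proof. by rewrite !elt_int => /elt_inj[]. Qed.

(* [xget] reads off the coordinates of [x]; its default is never reached. *)
Definition conjO (x : O) : O :=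
  let m := xget (0, 0) [set m | x = elt m] in elt (m.1 + T * m.2, - m.2).

Lemma conj_elt m : conjO (elt m) = elt (m.1 + T * m.2, - m.2).
Proof.
by rewrite /conjO; case: xgetP => [m' _ /elt_inj <-//|/(_ m) []].
Qed.

Lemma conjD x y : conjO (x + y) = conjO x + conjO y.
Proof.
have [m ->] := eltP x; have [m' ->] := eltP y.
by rewrite eltD !conj_elt eltD /=; congr elt; congr pair; ring.
Qed.

Lemma conjM x y : conjO (x * y) = conjO x * conjO y.
Proof.
have [m ->] := eltP x; have [m' ->] := eltP y.
have TT : T * T = T by rewrite /T; case: ifP.
rewrite eltM !conj_elt eltM /=; congr elt; congr pair; last by ring.
by ring.
Qed.

Lemma conjK : involutive conjO.
Proof.
move=> x; have [m ->] := eltP x.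
by rewrite !conj_elt /=; case: m => a b; congr elt; congr pair => /=; ring.
Qed.

Lemma conj_int (n : int) : conjO n%:~R = n%:~R.
Proof. by rewrite elt_int conj_elt /= mulr0 addr0 oppr0. Qed.

Definition qnorm (m : int * int) : int := m.1 ^+ 2 + T * (m.1 * m.2) + n0 * m.2 ^+ 2.

Lemma mul_conj m : elt m * conjO (elt m) = (qnorm m)%:~R.
Proof.
by rewrite conj_elt eltM elt_int /=; congr elt; congr pair; rewrite ?/qnorm; ring.
Qed.

Lemma mulO_eq0 (x y : O) : x * y = 0 -> x = 0 \/ y = 0.
Proof.
move=> /(congr1 val); rewrite rmorphM rmorph0 => /eqP.
by rewrite mulf_eq0 => /orP[]/eqP h; [left|right]; apply: val_inj; rewrite h rmorph0.
Qed.

(** The form may be indefinite, for real fields, but it is anisotropic: x conj(x) = 0 forces x = 0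
    in a domain. *)
Lemma qnorm_eq0 m : qnorm m = 0 -> m = (0, 0).
Proof.
move=> h; have := mul_conj m; rewrite h => /mulO_eq0[].
  by rewrite -elt0 => /elt_inj.
rewrite conj_elt -elt0 => /elt_inj; case: m {h} => a b [] + /eqP.
by rewrite oppr_eq0 => /[swap] /eqP -> /=; rewrite mulr0 addr0 => ->.
Qed.

Lemma mulO_cancel (n : int) (x y : O) : n != 0 -> n%:~R * x = n%:~R * y -> x = y.
Proof.
move=> n_neq0 /eqP; rewrite -subr_eq0 -mulrBr => /eqP/mulO_eq0[].
  by rewrite -[0](_ : 0%:~R = _) // => /intO_inj n0E; rewrite n0E eqxx in n_neq0.
by move=> /eqP; rewrite subr_eq0 => /eqP.
Qed.

(* Otherwise (b + delta) / g would be an integer outside Z + Z delta. *)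
Lemma order_maximal (g b : int) : g != 0 ->
  (g %| 2 * b + T)%Z -> (g ^+ 2 %| qnorm (b, 1))%Z -> (g %| 1)%Z.
Proof.
move=> g_neq0 /dvdzP[u uE] /dvdzP[v vE].
have gC : g%:~R != 0 :> algC by rewrite intr_eq0.
pose y : algC := val (elt (b, 1)) / g%:~R.
have y_int : y \in quad_int d.
  rewrite inE; apply/andP; split.
    have := valP (elt (b, 1)); rewrite inE => /andP[/asboolP[r [s rsE]] _].
    apply/asboolP; exists (r / g%:~R), (s / g%:~R).
    by rewrite /y rsE !fmorph_div /= !ratr_int; field.
  (* y is a root of X^2 - u X + v: its trace (2 b + T) / g = u and norm qnorm (b, 1) / g^2 = v are
     integers by hypothesis. *)
  apply: (@root_monic_Aint ('X^2 - (u%:~R *: 'X - (v%:~R)%:P))).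
  - rewrite rootE !(hornerD, hornerN, hornerXn, hornerZ, hornerX, hornerC); apply/eqP.
    have : elt (b, 1) ^+ 2 = (u * g)%:~R * elt (b, 1) - (v * g ^+ 2)%:~R.
      rewrite -uE -vE expr2 eltM elt_scale elt_int eltB.
      by congr elt; congr pair; rewrite /= /qnorm /=; ring.
    move=> /(congr1 val); rewrite rmorphB rmorphXn rmorphM !rmorph_int => E.
    rewrite [g ^+ 2]expr2 !intrM in E.
    have {}E : val (elt (b, 1)) ^+ 2 = u%:~R * g%:~R * val (elt (b, 1))
      - v%:~R * (g%:~R * g%:~R) by exact: E.
    have yE : val (elt (b, 1)) = y * g%:~R by rewrite /y divfK.
    rewrite yE in E.
    have : (y ^+ 2 - (u%:~R * y - v%:~R)) * g%:~R ^+ 2 = 0.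
      by rewrite mulrBl -exprMn E; ring.
    by move/eqP; rewrite mulf_eq0 expf_eq0 (negPf gC) orbF => /eqP.
  - apply/monicP; rewrite lead_coefDl ?lead_coefXn // size_polyN size_polyXn.
    rewrite (leq_ltn_trans (size_polyD _ _)) // gtn_max size_polyN.
    rewrite (leq_ltn_trans (size_scale_leq _ _)) ?size_polyX //.
    by rewrite (leq_ltn_trans (size_polyC_leq1 _)).
  - apply/polyOverP => i; rewrite !coefE.
    apply: rpredB; first by rewrite natr_int.
    apply: rpredB; last by case: ifP => _; rewrite ?intr_int ?rpred0.
    by rewrite rpredM ?intr_int ?natr_int.
have [m mE] := eltP (RingInt y_int).
have /elt_inj[_ m2] : elt (b, 1) = elt (g * m.1, g * m.2).
  rewrite -elt_scale -mE; apply: val_inj.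
  by rewrite rmorphM rmorph_int /= /y [RHS]mulrC divfK.
by apply/dvdzP; exists m.2; rewrite mulrC.
Qed.

Implicit Types (I J p : set O) (m : int * int).

(** * Hermite normal form and norm of an ideal *)

Definition nz_ideal I := is_ideal I /\ I <> [set 0].

Lemma nz_idealP I : is_ideal I -> I <> [set 0] <-> exists2 x, I x & x != 0.
Proof.
move=> iI; split=> [I0|[x Ix x0 IE]]; last by move: Ix x0; rewrite IE /= => ->; rewrite eqxx.
apply: contrapT => h; apply: I0; apply/seteqP; split=> [x Ix|_ ->]; last by case: iI.
by apply: contrapT => x0; apply: h; exists x => //; apply/eqP.
Qed.

Lemma nz_ideal_int I : nz_ideal I -> exists2 n : int, I n%:~R & n != 0.
Proof.
move=> [iI /(nz_idealP iI)[x Ix x0]]; have [m xE] := eltP x.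
exists (qnorm m).
  by rewrite -mul_conj -xE mulrC; case: iI => _ _; apply.
by apply: contra_neq x0 => /qnorm_eq0 m0; rewrite xE m0 elt0.
Qed.

Lemma nz_ideal_sub I J : nz_ideal I -> is_ideal J -> I `<=` J -> nz_ideal J.
Proof.
move=> [iI /(nz_idealP iI)[x Ix x0]] iJ sIJ; split=> //.
by apply/(nz_idealP iJ); exists x => //; exact: sIJ.
Qed.

Lemma nz_ideal_mul I J : nz_ideal I -> nz_ideal J -> nz_ideal (ideal_mul I J).
Proof.
move=> [iI /(nz_idealP iI)[x Ix x0]] [iJ /(nz_idealP iJ)[y Jy y0]].
split; first exact: is_ideal_mul.
apply/(nz_idealP (is_ideal_mul _ _)); exists (x * y); first exact: mem_ideal_mul.
by apply/eqP => /mulO_eq0[] /eqP; apply/negP.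
Qed.

Lemma nz_idealT : nz_ideal [set: O].
Proof.
split=> //; apply/(nz_idealP (is_ideal_setT _)); exists 1 => //; exact: oner_neq0.
Qed.

Lemma ideal_int I (n : int) x : is_ideal I -> I x -> I (n%:~R * x).
Proof. by case=> _ _ h ?; exact: h. Qed.

(** I = c (a Z + (b + delta) Z). Here c generates the group of second coordinates of I, and c a = a'
    the group of rational integers in I. Stability under [delta] makes c divide a' and the first
    coordinate b' of an element with second coordinate c. Multiplying c (b + delta) by the conjugate
    of b + delta puts c qnorm (b, 1) into I, hence a divides qnorm (b, 1). *)
Lemma ideal_hnf I : nz_ideal I -> exists a b c : int,
  [/\ 0 < a, 0 < c, (a %| qnorm (b, 1))%Z &
   forall m, I (elt m) <-> exists u v, m = (c * (a * u + b * v), c * v)].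
Proof.
move=> nzI; have [N IN N_neq0] := nz_ideal_int nzI; have [iI _] := nzI.
have [_ ID IM] := iI.
have I0 : I (elt (0, 0)) by rewrite elt0; case: iI.
have IB m m' : I (elt m) -> I (elt m') -> I (elt (m.1 - m'.1, m.2 - m'.2)).
  by move=> ? ?; rewrite -eltB; exact: ideal_sub.
have IZ (n : int) m : I (elt m) -> I (elt (n * m.1, n * m.2)).
  by move=> ?; rewrite -elt_scale; exact: ideal_int.
have Idelta x y : I (elt (x, y)) -> I (elt (- n0 * y, x + T * y)).
  move=> Ixy; rewrite (_ : elt _ = elt (0, 1) * elt (x, y)); first exact: IM.
  by rewrite eltM /=; congr (elt _); congr pair; ring.
have [c c_gt0 cP] : exists2 c : int, 0 < c &
    forall y, (exists x, I (elt (x, y))) <-> (c %| y)%Z.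
  apply: (@int_subgroup [set y | exists x, I (elt (x, y))] N) => //=.
  - by exists 0.
  - by move=> y y' [x Ix] [x' Ix']; exists (x - x'); exact: IB Ix Ix'.
  - exists 0; rewrite (_ : elt _ = elt (0, 1) * N%:~R); first exact: IM.
    by rewrite elt_int eltM /=; congr (elt _); congr pair; ring.
have [a' a'_gt0 aP] : exists2 a' : int, 0 < a' & forall x, I (elt (x, 0)) <-> (a' %| x)%Z.
  apply: (@int_subgroup [set x | I (elt (x, 0))] N) => //=.
  - by move=> x x' Ix Ix'; have := IB _ _ Ix Ix'; rewrite /= subr0.
  - by rewrite -elt_int.
have [b' Ib'] := (cP c).2 (dvdzz c).
have /dvdzP[a aE] : (c %| a')%Z.
  apply/cP; exists (- n0 * 0); have /Idelta := (aP a').2 (dvdzz a').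
  by rewrite mulr0 mulr0 addr0.
have /dvdzP[b bE] : (c %| b')%Z.
  have : (c %| b' + T * c)%Z by apply/cP; exists (- n0 * c); exact: Idelta.
  by rewrite rpredDr // dvdz_mull.
have hnf m : I (elt m) <-> exists u v, m = (c * (a * u + b * v), c * v).
  case: m => x y; split=> [Ixy|[u [v [-> ->]]]].
    have /dvdzP[v vE] : (c %| y)%Z by apply/cP; exists x.
    have /dvdzP[u uE] : (a' %| x - v * b')%Z.
      by apply/aP; have := IB _ _ Ixy (IZ v _ Ib'); rewrite /= vE subrr.
    exists u, v; congr pair; last by rewrite vE mulrC.
    by move: uE; rewrite aE bE => /eqP; rewrite subr_eq => /eqP ->; ring.
  have := ID _ _ (IZ u _ ((aP a').2 (dvdzz a'))) (IZ v _ Ib').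
  rewrite eltD /= aE bE (_ : (_, _) = (c * (a * u + b * v), c * v)) //.
  by congr pair; ring.
exists a, b, c; split => //.
  by move: a'_gt0; rewrite aE pmulr_lgt0.
have /hnf[u [v [E1 E2]]] : I (elt (c * qnorm (b, 1), 0)).
  rewrite (_ : elt _ = conjO (elt (b, 1)) * elt (c * b, c * 1)); last first.
    by rewrite -(elt_scale c (b, 1)) mulrCA [conjO _ * _]mulrC mul_conj -intrM elt_int.
  by apply: IM; apply/hnf; exists 0, 1; congr pair; ring.
have v0 : v = 0 by apply/eqP; move/eqP: E2; rewrite eq_sym mulf_eq0 gt_eqF.
apply/dvdzP; exists u; apply: (@mulfI _ c); rewrite ?gt_eqF//.
by rewrite E1 v0; ring.
Qed.
Definition has_hnf I (a b c : int) := [/\ 0 < a, 0 < c, (a %| qnorm (b, 1%R))%Z &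
   forall m, I (elt m) <-> exists u v, m = (c * (a * u + b * v), c * v)].

Lemma hnf_dvd I a b c : has_hnf I a b c -> forall x y, I (elt (x, y)) <->
  (c %| y)%Z /\ (c * a %| x - b * y)%Z.
Proof.
move=> [a_gt0 c_gt0 _ h] x y; split=> [/h[u [v [-> ->]]]|[/dvdzP[v ->] /dvdzP[u /eqP]]].
  split; first by rewrite dvdz_mulr.
  by apply/dvdzP; exists u; ring.
rewrite subr_eq => /eqP ->; apply/h; exists u, v; congr pair; ring.
Qed.

Lemma coset_eq I x y : is_ideal I ->
  ([set x + z | z in I] = [set y + z | z in I]) <-> I (x - y).
Proof.
move=> iI; split=> [E|Ixy].
  have : [set x + z | z in I] x by exists 0; rewrite ?addr0//; case: iI.
  by rewrite E => -[z Iz <-]; rewrite addrC addKr.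
have [_ ID _] := iI; apply/seteqP; split=> _ [z Iz <-].
  by exists (x - y + z); [exact: ID|ring].
exists (y - x + z); last by ring.
by apply: ID => //; rewrite -opprB; exact: ideal_opp.
Qed.

(** The points i + j delta with 0 <= i < c a and 0 <= j < c represent each coset once: reduce the
    second coordinate modulo c first, then the first one modulo c a. *)
Lemma hnf_norm I a b c : is_ideal I -> has_hnf I a b c ->
  ideal_norm I = absz (c ^+ 2 * a).
Proof.
move=> iI hI; have [a_gt0 c_gt0 _ _] := hI; have hd := hnf_dvd hI.
pose f (ij : 'I_(absz (c * a)) * 'I_(absz c)) : set O :=
  [set elt (ij.1%:Z, ij.2%:Z) + y | y in I].
rewrite /ideal_norm (_ : [set _ | x in _] = f @` setT); last first.
  apply/seteqP; split=> [_ [x _ <-]|_ [ij _ <-]]; last by exists (elt (ij.1%:Z, ij.2%:Z)).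
  have [[x1 x2] ->] := eltP x.
  have c_neq0 : c != 0 by rewrite gt_eqF.
  have ca_gt0 : 0 < c * a by rewrite mulr_gt0.
  have ca_neq0 : c * a != 0 by rewrite gt_eqF.
  have j_lt : (absz (x2 %% c)%Z < absz c)%N.
    by have := modz_ge0 x2 c_neq0; have := ltz_pmod x2 c_gt0; lia.
  pose i0 := ((x1 - b * (x2 - (x2 %% c)%Z)) %% (c * a))%Z.
  have i_lt : (absz i0 < absz (c * a)%R)%N.
    by rewrite /i0; have := modz_ge0 (x1 - b * (x2 - (x2 %% c)%Z)) ca_neq0;
    have := ltz_pmod (x1 - b * (x2 - (x2 %% c)%Z)) ca_gt0; lia.
  exists (Ordinal i_lt, Ordinal j_lt) => //; apply/coset_eq => //=.
  rewrite !gez0_abs ?modz_ge0// eltB; apply/hd => /=.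
  have E2 := divz_eq x2 c; have E1 := divz_eq (x1 - b * (x2 - (x2 %% c)%Z)) (c * a).
  rewrite -/i0 in E1; split.
    by apply/dvdzP; exists (- (x2 %/ c)%Z); lia.
  apply/dvdzP; exists (- ((x1 - b * (x2 - (x2 %% c)%Z)) %/ (c * a))%Z).
  rewrite mulNr; apply/eqP; rewrite -subr_eq0 opprK; apply/eqP.
  transitivity (((x1 - b * (x2 - (x2 %% c)%Z)) %/ (c * a))%Z * (c * a) + i0
    - (x1 - b * (x2 - (x2 %% c)%Z))); first by ring.
  by rewrite -E1 subrr.
rewrite card_fset_set_image ?card_prod ?card_ord; last first.
  move=> [i j] [i' j'] /(coset_eq _ _ iI); rewrite eltB => /hd /= [].
  have := ltn_ord i; have := ltn_ord i'; have := ltn_ord j; have := ltn_ord j'.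
  move=> hj' hj hi' hi /dvdzP[v vE] h; have v0 : v = 0 by nia.
  have jj : j = j' by apply: val_inj => /=; move: vE; rewrite v0; lia.
  move: h; rewrite jj subrr mulr0 subr0 => /dvdzP[u uE].
  have u0 : u = 0 by nia.
  have ii : i = i' by apply: val_inj => /=; move: uE; rewrite u0; lia.
  by rewrite ii.
by rewrite -abszM; congr absz; ring.
Qed.

Lemma hnf_norm_val I a b c : is_ideal I -> has_hnf I a b c ->
  (ideal_norm I)%:Z = c ^+ 2 * a.
Proof.
move=> iI hI; have [a_gt0 c_gt0 _ _] := hI.
by rewrite (hnf_norm iI hI) gez0_abs // mulr_ge0 ?exprn_ge0 ?ltW.
Qed.

Lemma ideal_norm_gt0 I : nz_ideal I -> (0 < ideal_norm I)%N.
Proof.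
move=> nzI; have [iI _] := nzI; have [a [b [c hI]]] := ideal_hnf nzI.
have [a_gt0 c_gt0 _ _] := hI.
by rewrite -ltz_nat (hnf_norm_val iI hI) mulr_gt0 ?exprn_gt0.
Qed.

(** The norm of c (a u + (b + delta) v) is c^2 times a form in u, v with coefficients a^2, a (2 b +
    T) and qnorm (b, 1), all divisible by a. *)
Lemma ideal_norm_dvd I m : nz_ideal I -> I (elt m) -> ((ideal_norm I)%:Z %| qnorm m)%Z.
Proof.
move=> nzI Im; have [iI _] := nzI; have [a [b [c hI]]] := ideal_hnf nzI.
rewrite (hnf_norm_val iI hI); have [_ _ /dvdzP[q qE] h] := hI.
have [u [v ->]] := (h m).1 Im; apply/dvdzP.
exists (a * u ^+ 2 + u * v * (2 * b + T) + v ^+ 2 * q).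
transitivity (c ^+ 2 * (a ^+ 2 * u ^+ 2 + a * u * v * (2 * b + T)
  + v ^+ 2 * qnorm (b, 1))); first by rewrite /qnorm /=; ring.
by rewrite qE; ring.
Qed.

Lemma ideal_norm_mem I : nz_ideal I -> I (ideal_norm I)%:Z%:~R.
Proof.
move=> nzI; have [iI _] := nzI; have [a [b [c hI]]] := ideal_hnf nzI.
rewrite (hnf_norm_val iI hI) elt_int; apply/(hnf_dvd hI); split; first exact: dvdz0.
by rewrite mulr0 subr0 expr2 -mulrA dvdz_mull.
Qed.

Lemma int_mem_dvd_hnf I a b c (n : int) : has_hnf I a b c -> I n%:~R -> (c * a %| n)%Z.
Proof. by move=> hI; rewrite elt_int => /(hnf_dvd hI)[_]; rewrite mulr0 subr0. Qed.

(** M in I means that c a divides M, say M = C A q, so the box consists of full periods: A q of the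
    second coordinates are admissible modulo c, and each leaves q first coordinates in one class
    modulo c a. The product A q^2 is M^2 / N(I), without error term. *)
Lemma count_box_ideal I (M : nat) (z : int * int) : nz_ideal I -> (0 < M)%N ->
  I M%:Z%:~R ->
  (count_box M [set m | I (elt (m.1 - z.1, m.2 - z.2)%R)] * ideal_norm I = M ^ 2)%N.
Proof.
move=> nzI M_gt0 IM; have [iI _] := nzI; have [a [b [c hI]]] := ideal_hnf nzI.
have [a_gt0 c_gt0 _ _] := hI.
have [A [aA A_gt0]] : exists A : nat, a = A%:Z /\ (0 < A)%N.
  by exists (absz a); split; lia.
have [C [cC C_gt0]] : exists C : nat, c = C%:Z /\ (0 < C)%N.
  by exists (absz c); split; lia.
have /dvdzP[r rE] := int_mem_dvd_hnf hI IM.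
have [q [qE q_gt0]] : exists q : nat, M = (C * A * q)%N /\ (0 < q)%N.
  by exists (absz r); rewrite cC aA in rE; split; nia.
have -> : count_box M [set m | I (elt (m.1 - z.1, m.2 - z.2))] = (A * q * q)%N.
  rewrite /count_box exchange_big /=.
  transitivity (\sum_(j < M) q * (c %| (j%:Z - z.2)%R)%Z)%N.
    apply: eq_bigr => j _; have [/dvdzP[v vE]|cj] := boolP (c %| _)%Z; last first.
      rewrite muln0 big1 // => i _; case: asboolP => // /(hnf_dvd hI)[] cj'.
      by rewrite cj' in cj.
    move: (nat_of_ord j) vE => {}j vE.
    rewrite muln1 -[RHS](@count_residue (C * A) q (z.1 + b * (j%:Z - z.2))) ?muln_gt0 ?C_gt0 //.
    rewrite qE; apply: eq_bigr => i _; congr nat_of_bool.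
    apply/asboolP/idP => [/(hnf_dvd hI)[_]|h].
      by rewrite cC aA -PoszM opprD addrA.
    apply/(hnf_dvd hI); split; first by rewrite vE dvdz_mull.
    by move: h; rewrite cC aA -PoszM opprD addrA.
  rewrite -big_distrr /= cC -[in LHS](_ : (C * (A * q))%N = M) ?count_residue //.
    by rewrite mulnC.
  by rewrite qE mulnA.
apply/eqP; rewrite -eqz_nat; apply/eqP; rewrite PoszM (hnf_norm_val iI hI).
by rewrite qE aA cC; lia.
Qed.

(** * Conjugate ideals, cancellation and multiplicativity of the norm *)

Definition conj_ideal I : set O := conjO @` I.

Lemma conj_idealP I x : conj_ideal I x <-> I (conjO x).
Proof.
by split=> [[y Iy <-]|Ix]; [rewrite conjK|exists (conjO x); rewrite ?conjK].
Qed.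

Lemma is_ideal_conj I : is_ideal I -> is_ideal (conj_ideal I).
Proof.
move=> [I0 ID IM]; split=> [|x y /conj_idealP Ix /conj_idealP Iy|a x /conj_idealP Ix].
- by apply/conj_idealP; rewrite -[0](_ : 0%:~R = _) // conj_int.
- by apply/conj_idealP; rewrite conjD; exact: ID.
- by apply/conj_idealP; rewrite conjM; exact: IM.
Qed.

(* I conj(I) is generated by c^2 a times a, 2 b + T and qnorm (b, 1) / a, which
   are coprime by [order_maximal]. *)
Lemma mul_conj_ideal I : nz_ideal I ->
  ideal_mul I (conj_ideal I) = principal (ideal_norm I)%:Z%:~R.
Proof.
move=> nzI; have [iI _] := nzI; have [a [b [c hI]]] := ideal_hnf nzI.
have [a_gt0 c_gt0 /dvdzP[q qE] h] := hI; rewrite (hnf_norm_val iI hI).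
apply/seteqP; split.
  apply: ideal_mul_subset; first exact: is_ideal_principal.
  move=> x _ + [y + <-]; have [m ->] := eltP x; have [m' ->] := eltP y.
  move=> /h[u [v ->]] /h[u' [v' ->]]; apply/principalP.
  exists (elt (a * (u * u') + v * v' * q + b * (u' * v) + (b + T) * (u * v'),
    u' * v - u * v')).
  rewrite conj_elt [RHS]mulrC elt_scale eltM /=; congr (elt _).
  have qE' : n0 = q * a - b ^+ 2 - T * b.
    by rewrite -qE /qnorm /=; ring.
  by congr pair; rewrite ?qE'; ring.
apply/principal_subset; first exact: is_ideal_mul.
have iK := is_ideal_mul I (conj_ideal I).
have [_ KD KM] := iK.
have Ia : I (c * a)%:~R by rewrite elt_int; apply/h; exists 1, 0; congr pair; ring.
have Ib : I (elt (c * b, c * 1)) by apply/h; exists 0, 1; congr pair; ring.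
have Ica : conj_ideal I (c * a)%:~R.
  by apply/conj_idealP; rewrite conj_int.
have Icb : conj_ideal I (conjO (elt (c * b, c * 1))) by apply/conj_idealP; rewrite conjK.
have K1 : ideal_mul I (conj_ideal I) (c ^+ 2 * a * a)%:~R.
  by rewrite (_ : _%:~R = (c * a)%:~R * (c * a)%:~R :> O);
    [exact: mem_ideal_mul|rewrite -intrM; congr intmul; ring].
have K2 : ideal_mul I (conj_ideal I) (c ^+ 2 * a * (2 * b + T))%:~R.
  rewrite (_ : _%:~R = (c * a)%:~R * conjO (elt (c * b, c * 1))
    + elt (c * b, c * 1) * (c * a)%:~R :> O).
    by apply: KD; exact: mem_ideal_mul.
  rewrite [elt _ * _]mulrC conj_elt !elt_scale eltD elt_int /=.
  by congr (elt _); congr pair; ring.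
have K3 : ideal_mul I (conj_ideal I) (c ^+ 2 * a * q)%:~R.
  rewrite (_ : _%:~R = elt (c * b, c * 1) * conjO (elt (c * b, c * 1))).
    exact: mem_ideal_mul.
  rewrite mul_conj; congr intmul.
  transitivity (c ^+ 2 * qnorm (b, 1)); last by rewrite /qnorm /=; ring.
  by rewrite qE; ring.
pose g := gcdz (gcdz a (2 * b + T)) q.
have g1 : g = 1.
  have : (g %| 1)%Z.
    apply: (@order_maximal _ b).
    - by rewrite /g; apply/eqP => /eqP; rewrite !gcdz_eq0 (gt_eqF a_gt0).
    - exact: dvdz_trans (dvdz_gcdl _ _) (dvdz_gcdr _ _).
    - rewrite qE expr2; apply: dvdz_mul; first exact: dvdz_gcdr.
      exact: dvdz_trans (dvdz_gcdl _ _) (dvdz_gcdl _ _).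
  by rewrite dvdz1 => /eqP /(congr1 Posz); rewrite gez0_abs.
have [u [v uvE]] := Bezoutz (gcdz a (2 * b + T)) q.
have [u' [v' uvE']] := Bezoutz a (2 * b + T).
rewrite (_ : _%:~R = (u * u')%:~R * (c ^+ 2 * a * a)%:~R
  + (u * v')%:~R * (c ^+ 2 * a * (2 * b + T))%:~R + v%:~R * (c ^+ 2 * a * q)%:~R :> O).
  by apply: (KD); [apply: (KD)|]; exact: KM.
rewrite -!intrM -!intrD; congr intmul.
rewrite -[LHS]mulr1 -[X in _ * X](_ : g = 1) // /g -uvE -uvE'; ring.
Qed.
Lemma is_ideal_add I J : is_ideal I -> is_ideal J ->
  is_ideal [set x + y | x in I & y in J].
Proof.
move=> [I0 ID IM] [J0 JD JM]; split=> [|_ _ [x Ix [y Jy <-]] [x' Ix' [y' Jy' <-]]|a _ [x Ix [y Jy <-]]].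
- by exists 0 => //; exists 0; rewrite ?addr0.
- exists (x + x'); first exact: ID.
  by exists (y + y'); [exact: JD|rewrite addrACA].
- exists (a * x); first exact: IM.
  by exists (a * y); [exact: JM|rewrite mulrDr].
Qed.

Lemma mul_principalP (x y : O) K : is_ideal K ->
  ideal_mul (principal x) K y <-> exists2 z, K z & y = x * z.
Proof.
move=> [K0 KD KM]; split=> [|[z Kz ->]]; last by apply: mem_ideal_mul => //; exact: mem_principal.
apply: (@ideal_mul_subset _ _ _ [set y | exists2 z, K z & y = x * z]).
  split=> [|_ _ [u Ku ->] [v Kv ->]|a _ [u Ku ->]].
  - by exists 0; rewrite ?mulr0.
  - by exists (u + v); [exact: KD|rewrite mulrDr].
  - by exists (a * u); [exact: KM|rewrite mulrCA].
move=> _ z /principalP[a ->] Kz; exists (a * z); first exact: KM.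
by ring.
Qed.

(** Multiplication by conj(I) replaces I by the nonzero integer N(I), which cancels elementwise. *)
Lemma ideal_mul_cancel I J K : nz_ideal I -> is_ideal J -> is_ideal K ->
  ideal_mul I J `<=` ideal_mul I K -> J `<=` K.
Proof.
move=> nzI iJ iK sJK x Jx; have n_gt0 := ideal_norm_gt0 nzI.
have : ideal_mul (conj_ideal I) (ideal_mul I K) ((ideal_norm I)%:Z%:~R * x).
  apply: (ideal_mulSS (@subset_refl _ _) sJK).
  rewrite ideal_mulA [ideal_mul _ I]ideal_mulC mul_conj_ideal //.
  by apply: mem_ideal_mul => //; exact: mem_principal.
rewrite ideal_mulA [ideal_mul _ I]ideal_mulC mul_conj_ideal //.
move=> /(mul_principalP _ _ iK)[z Kz]; move/mulO_cancel => -> //.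
by rewrite eqz_nat -lt0n.
Qed.

Lemma ideal_mul_inj I J K : nz_ideal I -> is_ideal J -> is_ideal K ->
  ideal_mul I J = ideal_mul I K -> J = K.
Proof.
move=> nzI iJ iK E; apply/seteqP; split; apply: (ideal_mul_cancel nzI) => //; rewrite E; exact: subset_refl.
Qed.

(* To contain is to divide: multiply [I `<=` J] by the conjugate of J. *)
Lemma ideal_dvd I J : is_ideal I -> nz_ideal J -> I `<=` J ->
  exists2 K, is_ideal K & I = ideal_mul J K.
Proof.
move=> iI nzJ sIJ; have n_gt0 := ideal_norm_gt0 nzJ; have [iJ _] := nzJ.
pose n : O := (ideal_norm J)%:Z%:~R.
pose K := [set y | ideal_mul I (conj_ideal J) (y * n)].
have iK : is_ideal K by apply: is_ideal_colon; exact: is_ideal_mul.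
have nK : ideal_mul I (conj_ideal J) = ideal_mul (principal n) K.
  apply/seteqP; split=> x.
    move=> Ix; have : principal n x.
      by rewrite -mul_conj_ideal//; apply: (ideal_mulSS sIJ (@subset_refl _ _)) Ix.
    move=> /principalP[y yE]; apply/(mul_principalP _ _ iK); exists y; last by rewrite mulrC.
    by rewrite /K /= -yE.
  by move=> /(mul_principalP _ _ iK)[y Ky ->]; rewrite mulrC.
exists K => //; have : ideal_mul (principal n) I = ideal_mul (principal n) (ideal_mul J K).
  rewrite -mul_conj_ideal // -ideal_mulA [ideal_mul (conj_ideal J) _]ideal_mulC nK.
  by rewrite mul_conj_ideal // !ideal_mulA [ideal_mul J _]ideal_mulC.
move=> E; suff h X Y : is_ideal X -> is_ideal Y ->
    ideal_mul (principal n) X = ideal_mul (principal n) Y -> X `<=` Y.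
  by apply/seteqP; split; apply: h => //; exact: is_ideal_mul.
move=> iX iY EXY x Xx; have : ideal_mul (principal n) Y (n * x).
  by rewrite -EXY; apply/(mul_principalP _ _ iX); exists x.
move=> /(mul_principalP _ _ iY)[y Yy]; move/mulO_cancel => -> //.
by rewrite eqz_nat -lt0n.
Qed.

Lemma conj_ideal_mul I J :
  conj_ideal (ideal_mul I J) = ideal_mul (conj_ideal I) (conj_ideal J).
Proof.
have h X Y : conj_ideal (ideal_mul X Y) `<=` ideal_mul (conj_ideal X) (conj_ideal Y).
  move=> _ [x + <-]; move: x.
  apply: (@ideal_mul_subset _ _ _ [set x | ideal_mul (conj_ideal X) (conj_ideal Y) (conjO x)]).
    have [Z0 ZD ZM] := is_ideal_mul (conj_ideal X) (conj_ideal Y).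
    split=> /= [|x y ? ?|a x ?].
    - by rewrite -[0](_ : 0%:~R = _) // conj_int.
    - by rewrite conjD; exact: ZD.
    - by rewrite conjM; exact: ZM.
  by move=> x y Xx Yy /=; rewrite conjM; apply: mem_ideal_mul; [exists x|exists y].
have conjIK X : conj_ideal (conj_ideal X) = X.
  by apply/seteqP; split=> x; rewrite !conj_idealP conjK.
apply/seteqP; split; first exact: h.
rewrite -[X in X `<=` _]conjIK => x /conj_idealP/h; rewrite !conjIK => ?.
by apply/conj_idealP.
Qed.

Lemma principal_int_inj (m n : nat) : (0 < m)%N -> (0 < n)%N ->
  principal (m%:Z%:~R : O) = principal n%:Z%:~R -> m = n.
Proof.
have h (a b : nat) : principal (b%:Z%:~R : O) a%:Z%:~R -> (b %| a)%N.
  move=> /principalP[x]; have [[x1 x2] ->] := eltP x.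
  rewrite mulrC elt_scale elt_int => /elt_inj[E _].
  by rewrite -[(b %| a)%N]/(b%:Z %| a%:Z)%Z; apply/dvdzP; exists x1; rewrite E mulrC.
move=> m_gt0 n_gt0 E; apply/eqP; rewrite eqn_dvd.
by rewrite !h // -?E; [|rewrite E]; exact: mem_principal.
Qed.

(** I J conj(I J) is generated both by N(I J) and by N(I) N(J), and a positive integer is determined
    by the ideal it generates. *)
Lemma ideal_norm_mul I J : nz_ideal I -> nz_ideal J ->
  ideal_norm (ideal_mul I J) = (ideal_norm I * ideal_norm J)%N.
Proof.
move=> nzI nzJ; have nzIJ := nz_ideal_mul nzI nzJ.
apply: principal_int_inj; rewrite ?muln_gt0 ?ideal_norm_gt0 //.
rewrite -mul_conj_ideal // conj_ideal_mul PoszM intrM -principal_mul.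
by rewrite -!mul_conj_ideal // -!ideal_mulA; congr ideal_mul; rewrite ideal_mulA
   [ideal_mul J (conj_ideal I)]ideal_mulC -ideal_mulA.
Qed.

Lemma ideal_normT : ideal_norm [set: O] = 1%N.
Proof.
have nzT := nz_idealT; have := mul_conj_ideal nzT.
have -> : conj_ideal [set: O] = [set: O].
  by apply/seteqP; split=> // x _; apply/conj_idealP.
rewrite ideal_mulT // => E; apply: principal_int_inj; rewrite ?ideal_norm_gt0 //.
by rewrite -E; apply/esym/ideal1; [exact: is_ideal_principal|exact: mem_principal].
Qed.

Lemma ideal_norm_eq1 I : nz_ideal I -> ideal_norm I = 1%N -> I = setT.
Proof.
by move=> nzI N1; apply: ideal1; [case: nzI|have := ideal_norm_mem nzI; rewrite N1].
Qed.

Lemma nz_ideal_exp I n : nz_ideal I -> nz_ideal (ideal_exp I n).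
Proof.
by move=> nzI; elim: n => [|n IH]; [exact: nz_idealT|exact: nz_ideal_mul].
Qed.

Lemma ideal_norm_exp I n : nz_ideal I -> ideal_norm (ideal_exp I n) = (ideal_norm I ^ n)%N.
Proof.
move=> nzI; elim: n => [|n IH]; first by rewrite /ideal_exp /= ideal_normT.
by rewrite ideal_expS ideal_norm_mul ?IH ?expnS //; exact: nz_ideal_exp.
Qed.

Lemma ideal_norm_lt I J : nz_ideal I -> is_ideal J -> I `<=` J -> I <> J ->
  (ideal_norm J < ideal_norm I)%N.
Proof.
move=> nzI iJ sIJ IJ; have nzJ := nz_ideal_sub nzI iJ sIJ.
have [iI _] := nzI; have [K iK E] := ideal_dvd iI nzJ sIJ.
have nzK : nz_ideal K.
  by apply: (nz_ideal_sub nzI iK); rewrite E; exact: ideal_mul_subr.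
rewrite E ideal_norm_mul // ltn_Pmulr ?ideal_norm_gt0 // ltn_neqAle eq_sym.
rewrite ideal_norm_gt0 // andbT; apply/eqP => K1; apply: IJ.
by rewrite E (ideal_norm_eq1 nzK K1) ideal_mulT.
Qed.

(** * Prime ideals, factorisation and k-freeness *)

Definition nz_prime p := is_prime_ideal p /\ p <> [set 0].

Lemma nz_primeW p : nz_prime p -> nz_ideal p.
Proof. by case=> -[ip _ _] p0. Qed.

(** J = I + p contains p, hence p = J K. Since J is not inside p, primality gives K inside p, so p
    is contained in p J, and cancelling p shows that J is the whole ring. *)
Lemma prime_comaximal p I : nz_prime p -> is_ideal I -> ~ (I `<=` p) ->
  exists2 x, I x & p (1 - x).
Proof.
move=> pp iI nIp; have nzp := nz_primeW pp; have [ip _] := nzp; have [prp _] := pp.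
pose J := [set x + y | x in I & y in p].
have iJ : is_ideal J by exact: is_ideal_add.
have sIJ : I `<=` J by move=> x Ix; exists x => //; exists 0; rewrite ?addr0; case: ip.
have spJ : p `<=` J by move=> x px; exists 0; [case: iI|exists x; rewrite ?add0r].
have nzJ := nz_ideal_sub nzp iJ spJ.
have [K iK E] := ideal_dvd ip nzJ spJ.
have : K `<=` p.
  have [||//] := prime_mul_subset prp iJ iK; first by rewrite -E; exact: subset_refl.
  by move=> sJp; case: nIp; exact: subset_trans sIJ sJp.
move=> sKp; have : [set: O] `<=` J.
  apply: (ideal_mul_cancel nzp) => //; rewrite ideal_mulT // {1}E [X in _ `<=` X]ideal_mulC.
  exact: ideal_mulSS.
by move=> /(_ 1 Logic.I)[x Ix [y py xy]]; exists x; rewrite // -xy addrC addKr.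
Qed.

Lemma nz_prime_eq p p' : nz_prime p -> nz_prime p' -> p `<=` p' -> p' = p.
Proof.
move=> pp [[ip' p'1 _] _] spp'; apply/seteqP; split=> //; apply: contrapT => nsp'p.
have [x p'x px] := prime_comaximal pp ip' nsp'p.
by apply: p'1; rewrite -[1](subrK x); case: ip' => _ h _; apply: h => //; exact: spp'.
Qed.

Lemma prime_ideal_exp p I n : is_prime_ideal p -> is_ideal I ->
  ideal_exp I n `<=` p -> I `<=` p.
Proof.
move=> pp iI /(prime_prod_subset pp)[J /nseqP[->]//|J].
by rewrite mem_nseq => /andP[_ /eqP->].
Qed.

Lemma prime_int_factor p (n : nat) : is_prime_ideal p -> (0 < n)%N -> p n%:Z%:~R ->
  exists q, [/\ prime q, (q %| n)%N & p q%:Z%:~R].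
Proof.
move=> [ip p1 pM]; elim/ltn_ind: n => n IH n_gt0 pn.
have n_gt1 : (1 < n)%N.
  by case: n n_gt0 pn {IH} => [//|[|//]] _ /p1.
have /pM[h|h] : p ((n %/ pdiv n)%N%:Z%:~R * (pdiv n)%:Z%:~R).
- by rewrite -intrM -PoszM divnK ?pdiv_dvd.
- have [||//|q [qp qn pq]] := IH (n %/ pdiv n)%N.
  + by rewrite ltn_Pdiv // prime_gt1 // pdiv_prime.
  + by rewrite divn_gt0 ?pdiv_gt0 // dvdn_leq // pdiv_dvd.
  + by exists q; split => //; apply: dvdn_trans qn _; rewrite dvdn_div // pdiv_dvd.
- by exists (pdiv n); split; rewrite ?pdiv_prime ?pdiv_dvd.
Qed.

Lemma prime_int_dvd p (q n : nat) : is_prime_ideal p -> prime q -> p q%:Z%:~R ->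
  p n%:Z%:~R -> (q %| n)%N.
Proof.
move=> [ip p1 _] qp pq pn; apply: contrapT => /negP; rewrite -prime_coprime // => cqn.
have /eqP : coprimez q%:Z n%:Z by [].
have [u [v <-]] := Bezoutz q%:Z n%:Z => E; apply: p1.
rewrite -[1](_ : 1%:~R = _) // -E intrD !intrM.
by case: ip => _ h h'; apply: h; exact: h'.
Qed.

Lemma prime_norm_dvd p q : nz_prime p -> prime q -> p q%:Z%:~R -> (q %| ideal_norm p)%N.
Proof.
move=> pp qp pq; have nzp := nz_primeW pp; apply: prime_int_dvd qp pq _; first by case: pp.
exact: ideal_norm_mem.
Qed.

(** p conj(p) is generated by N(p), a multiple of q, hence lies in p'; so p' contains p or conj(p),
    and nonzero primes are maximal. This bounds the number of primes over q by two. *)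
Lemma primes_over p p' q : nz_prime p -> nz_prime p' -> prime q ->
  p q%:Z%:~R -> p' q%:Z%:~R -> p' = p \/ p' = conj_ideal p.
Proof.
move=> pp pp' qp pq p'q; have [[ip p1 pM] _] := pp; have [pr' _] := pp'.
have nzp := nz_primeW pp; have nzp' := nz_primeW pp'; have [ip' _] := nzp'.
have ic := is_ideal_conj ip.
have [|h|h] := prime_mul_subset pr' ip ic.
- rewrite mul_conj_ideal//; apply/principal_subset => //.
  have /dvdnP[r ->] := prime_norm_dvd pp qp pq.
  by rewrite PoszM intrM; case: ip' => _ _; apply.
- by left; exact: nz_prime_eq.
right; apply: nz_prime_eq => //; split; last first.
  apply/(nz_idealP ic); exists q%:Z%:~R; first by apply/conj_idealP; rewrite conj_int.
  apply/eqP => /(intO_inj (m := 0)) q0.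
  by case: (q) q0 qp.
split=> // [/conj_idealP|x y /conj_idealP].
  by rewrite -[1](_ : 1%:~R = _) // conj_int.
by rewrite conjM => /pM[] ?; [left|right]; apply/conj_idealP.
Qed.

(** A proper ideal J above I of least norm is prime: if x is not in J, then J + (x) has smaller
    norm, so it is the whole ring, and x y in J gives y in J. *)
Lemma exists_prime I : nz_ideal I -> I <> setT -> exists2 p, nz_prime p & I `<=` p.
Proof.
move=> nzI IT; pose P n := `[< exists J, [/\ is_ideal J, I `<=` J, J <> setT & ideal_norm J = n] >].
have exP : exists n, P n.
  by exists (ideal_norm I); apply/asboolP; exists I; split=> //; case: nzI.
have [n /asboolP[J [iJ sIJ JT Jn]] n_min] := ex_minnP exP.
have nzJ := nz_ideal_sub nzI iJ sIJ; exists J => //; split; last by case: nzJ.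
have J1 : ~ J 1 by move=> /(ideal1 iJ).
split=> // x y Jxy; have [?|nJx] := pselect (J x); [by left|right].
pose L := [set u + v | u in J & v in principal x].
have iL : is_ideal L by apply: is_ideal_add => //; exact: is_ideal_principal.
have sJL : J `<=` L.
  by move=> u Ju; exists u => //; exists 0; rewrite ?addr0; case: (is_ideal_principal x).
have Lx : L x by exists 0; [case: iJ|exists x; rewrite ?add0r //; exact: mem_principal].
have LT : L = setT.
  apply: contrapT => LT; have : (ideal_norm L < n)%N.
    by rewrite -Jn; apply: ideal_norm_lt => // JL; apply: nJx; rewrite JL.
  rewrite ltnNge n_min //; apply/asboolP; exists L; split=> //.
  exact: subset_trans sIJ sJL.
have : L 1 by rewrite LT.
move=> [u Ju [_ /principalP[a ->] uv]].
have [_ JD JM] := iJ; rewrite -[y]mul1r -uv mulrDl -mulrA.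
by apply: (JD); [rewrite mulrC|]; exact: JM.
Qed.

Lemma exists_factorisation I : nz_ideal I ->
  exists s, (forall p, p \in s -> is_prime_ideal p) /\ ideal_prod s = I.
Proof.
move: {2}(ideal_norm I) (leqnn (ideal_norm I)) => n; elim: n I => [|n IH] I In nzI.
  by have := ideal_norm_gt0 nzI; rewrite ltnNge In.
have [->|IT] := pselect (I = setT); first by exists [::].
have [p pp sIp] := exists_prime nzI IT; have nzp := nz_primeW pp; have [iI _] := nzI.
have [J iJ E] := ideal_dvd iI nzp sIp.
have sIJ : I `<=` J by rewrite E; apply: ideal_mul_subr.
have nzJ := nz_ideal_sub nzI iJ sIJ.
have [|//|s [ps sJ]] := IH J.
  rewrite -ltnS (leq_trans _ In) //; apply: ideal_norm_lt => // IJ.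
  have [ip _] := nzp; have [[_ p1 _] _] := pp; apply: p1.
  apply: ((ideal_mul_cancel nzI (is_ideal_setT _) ip) _ 1 Logic.I).
  by rewrite ideal_mulT // ideal_mulC {2}IJ -E; exact: subset_refl.
exists (p :: s); split; last by rewrite /= sJ.
by move=> p'; rewrite inE => /predU1P[->|]; [case: pp|exact: ps].
Qed.

Lemma ideal_exp_le p j n : (j <= n)%N -> ideal_exp p n `<=` ideal_exp p j.
Proof.
elim: n j => [|n IH] [|j] //; try by move=> _ x _.
by rewrite ltnS => /IH h; apply: ideal_mulSS => //; exact: subset_refl.
Qed.

Lemma prod_subset_exp_count p s : ideal_prod s `<=` ideal_exp p (count_mem p s).
Proof.
elim: s => [|J s IH] //=; have [->|_] := eqVneq J p.
  by apply: ideal_mulSS => //; exact: subset_refl.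
rewrite add0n; apply: subset_trans IH; apply: ideal_mul_subr.
by case: s => [|? ?] //=; exact: is_ideal_mul.
Qed.

(** With [prod_subset_exp_count] this identifies the multiplicity of p in any factorisation as the
    largest n with the product inside p^n; uniqueness of factorisation is never stated
    separately. *)
Lemma prod_subset_exp p s n : nz_prime p -> (forall J, J \in s -> nz_prime J) ->
  ideal_prod s `<=` ideal_exp p n -> (n <= count_mem p s)%N.
Proof.
move=> pp; elim: n s => [//|n IH] s ps h; have [[ip _ _] _] := pp.
have iprod (s' : seq (set O)) : is_ideal (ideal_prod s').
  by case: s' => [|? ?] //=; exact: is_ideal_mul.
have [J Js sJp] : exists2 J, J \in s & J `<=` p.
  apply: prime_prod_subset; first by case: pp.
    by move=> J /ps[[]].
  by apply: subset_trans h _; exact: ideal_mul_subl.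
have JE : p = J by apply: nz_prime_eq => //; exact: ps.
have sE := perm_to_rem Js; rewrite -JE in sE.
move: h; rewrite (ideal_prod_perm sE) (permP sE) /= eqxx add1n ltnS => h.
apply: IH; first by move=> K /mem_rem; exact: ps.
exact: (ideal_mul_cancel (nz_primeW pp) (iprod (rem p s)) (is_ideal_exp p n) h).
Qed.

(** Trades the valuation, read off a chosen factorisation, for membership in p^k, the form in which
    lattice points are counted. The zero ideal is prime in the sense of the definition, but it is
    not a factor of a nonzero x and so has valuation 0. *)
Lemma kfreeE (k : nat) (x : O) : (0 < k)%N ->
  kfree k x <-> x <> 0 /\ forall p, nz_prime p -> ~ ideal_exp p k x.
Proof.
move=> k_gt0; suff h : x <> 0 ->
    (forall p, is_prime_ideal p -> (valuation p x < k)%N) <->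
    (forall p, nz_prime p -> ~ ideal_exp p k x).
  split=> -[x0 hx]; last by split; [exact/eqP|exact/(h x0)].
  by move/eqP: x0 => x0; split=> //; exact/(h x0).
move=> x0; have nzx : nz_ideal (principal x).
  split; first exact: is_ideal_principal.
  apply/nz_idealP; first exact: is_ideal_principal.
  by exists x; [exact: mem_principal|apply/eqP].
rewrite /valuation /factorisation; case: xgetP => [s _ [ps sE]|]; last first.
  by have [s ?] := exists_factorisation nzx => /(_ s).
have nzs p : p \in s -> nz_prime p.
  move=> p_s; split; [exact: ps|move=> p0].
  have : principal x `<=` [set 0].
    rewrite -sE (ideal_prod_perm (perm_to_rem p_s)) /= p0.
    by apply: ideal_mul_subl; rewrite -p0; case: (ps _ p_s).
  by move=> h; apply/x0/h; exact: mem_principal.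
split=> h p pp; last first.
  have [nzp|] := pselect (nz_prime p).
    rewrite ltnNge; apply/negP => kp; apply: (h p nzp).
    apply: (ideal_exp_le kp); apply: prod_subset_exp_count; rewrite sE; exact: mem_principal.
  move=> np; rewrite (_ : count_mem p s = 0%N) //; apply/count_memPn/negP.
  exact/contra_not/np/nzs.
have {}h : ideal_prod s `<=` ideal_exp p k -> False.
  move=> /(prod_subset_exp pp nzs); rewrite leqNgt h //; by case: pp.
by move=> px; apply: h; rewrite sE; apply/principal_subset => //; exact: is_ideal_exp.
Qed.

(** * The zeta function as an Euler product *)

Section ZetaProduct.
Variables (R : realType) (k : nat).
Hypothesis k_ge2 : (2 <= k)%N.
Implicit Types (G H F : seq (set O)).

Definition weight I : R := ((ideal_norm I)%:R ^+ k)^-1.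

Definition weight_sum G : R := \sum_(I <- G) weight I.

Definition euler_prod F : R := \prod_(p <- F) (1 - weight p).

Lemma weight_gt0 I : nz_ideal I -> 0 < weight I.
Proof. by move=> nzI; rewrite invr_gt0 exprn_gt0 // ltr0n ideal_norm_gt0. Qed.

Lemma weight_ge0 I : 0 <= weight I.
Proof. by rewrite invr_ge0 exprn_ge0. Qed.

Lemma weight_mul I J : nz_ideal I -> nz_ideal J ->
  weight (ideal_mul I J) = weight I * weight J.
Proof. by move=> nzI nzJ; rewrite /weight ideal_norm_mul // natrM exprMn invfM. Qed.

Lemma weight_powR I : nz_ideal I -> (ideal_norm I)%:R `^ (- k%:R) = weight I.
Proof. by move=> nzI; rewrite powRN powR_mulrn. Qed.

(** N(p) >= q and k >= 2. The exponent 2 is the one for which the product over q telescopes. *)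
Lemma weight_prime p q : nz_prime p -> prime q -> p q%:Z%:~R ->
  weight p <= (q%:R ^+ 2)^-1.
Proof.
move=> pp qp pq; have N_gt0 := ideal_norm_gt0 (nz_primeW pp).
have qN : (q <= ideal_norm p)%N by apply: dvdn_leq => //; exact: prime_norm_dvd.
have q_gt0 := prime_gt0 qp.
rewrite lef_pV2 ?posrE ?exprn_gt0 ?ltr0n // -!natrX ler_nat.
apply: (@leq_trans (q ^ k)); first by rewrite leq_pexp2l.
by rewrite leq_exp2r // (leq_trans _ k_ge2).
Qed.

Lemma nz_prime_over p : nz_prime p -> exists q, [/\ prime q, (q %| ideal_norm p)%N & p q%:Z%:~R].
Proof.
move=> pp; have [prp _] := pp; have nzp := nz_primeW pp.
by apply: prime_int_factor => //; [exact: ideal_norm_gt0|exact: ideal_norm_mem].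
Qed.

Lemma weight_prime_lt1 p : nz_prime p -> weight p < 1.
Proof.
move=> pp; have [q [qp _ pq]] := nz_prime_over pp.
apply: le_lt_trans (weight_prime pp qp pq) _.
by rewrite invf_lt1 ?exprn_gt0 ?ltr0n ?prime_gt0 // -natrX ltr1n -(exp1n 2) ltn_exp2r ?prime_gt1.
Qed.

Lemma euler_prod_gt0 F : (forall p, p \in F -> nz_prime p) -> 0 < euler_prod F.
Proof.
move=> Fp; rewrite /euler_prod big_seq; apply: prodr_gt0 => p /Fp pp.
by rewrite subr_gt0 weight_prime_lt1.
Qed.

Lemma weight_sum_map p G : nz_prime p -> (forall I, I \in G -> nz_ideal I) ->
  weight_sum (map (ideal_mul p) G) = weight p * weight_sum G.
Proof.
move=> pp nzG; rewrite /weight_sum big_map big_distrr /= !big_seq.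
by apply: eq_bigr => I /nzG nzI; rewrite weight_mul //; exact: nz_primeW.
Qed.

Lemma uniq_map_ideal_mul p G : nz_prime p -> (forall I, I \in G -> nz_ideal I) ->
  uniq G -> uniq (map (ideal_mul p) G).
Proof.
move=> pp nzG; rewrite map_inj_in_uniq // => I J /nzG[iI _] /nzG[iJ _].
by apply: ideal_mul_inj => //; exact: nz_primeW.
Qed.

(** Induction on F. Split G into the ideals prime to p, whose weights sum to at most B = 1 /
    [euler_prod F], and p times a list of ideals of smaller norm. An inner induction on the norms
    bounds the whole by B + w B / (1 - w) = B / (1 - w), w = [weight p], which avoids geometric
    series. *)
Lemma euler_upper F G : (forall p, p \in F -> nz_prime p) -> uniq G ->
  (forall I, I \in G -> nz_ideal I /\ forall p, nz_prime p -> I `<=` p -> p \in F) ->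
  weight_sum G <= (euler_prod F)^-1.
Proof.
elim: F G => [|p F IH] G Fp uG hG.
  have hT I : I \in G -> I = setT.
    move=> /hG[nzI hI]; apply: contrapT => IT.
    by have [p pp sIp] := exists_prime nzI IT; have := hI _ pp sIp.
  rewrite /euler_prod big_nil invr1; case: G uG hT {hG} => [|I [|J G]] /= uG hT.
  - by rewrite /weight_sum big_nil.
  - rewrite /weight_sum big_seq1 (hT I) ?mem_head // /weight ideal_normT.
    by rewrite expr1n invr1.
  - by move: uG; rewrite (hT I) ?mem_head // (hT J) ?inE ?eqxx ?orbT.
have pp : nz_prime p by apply: Fp; rewrite mem_head.
have Fp' p' : p' \in F -> nz_prime p' by move=> p'F; apply: Fp; rewrite inE p'F orbT.
have nzp := nz_primeW pp.
have w_lt1 := weight_prime_lt1 pp.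
have w_ge0 := weight_ge0 p.
have N_ge2 : (1 < ideal_norm p)%N.
  rewrite ltn_neqAle eq_sym ideal_norm_gt0 // andbT; apply/eqP => /(ideal_norm_eq1 nzp) pT.
  by have [[_ p1 _] _] := pp; apply: p1; rewrite pT.
set B := (euler_prod F)^-1; have B_gt0 : 0 < B by rewrite invr_gt0 euler_prod_gt0.
have -> : (euler_prod (p :: F))^-1 = B / (1 - weight p).
  by rewrite /euler_prod big_cons invfM mulrC.
(* Division by p at least halves the norm, so the exponent n drops by one each time. *)
have [n nG] : exists n, forall I, I \in G -> (ideal_norm I < 2 ^ n)%N.
  exists (\max_(I <- G) ideal_norm I)%N => I IG.
  apply: leq_ltn_trans (ltn_expl _ _) => //.
  by rewrite (big_rem I) //= leq_maxl.
elim: n G uG hG nG => [|n IHn] G uG hG nG.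
  have -> : G = [::].
    case: G hG nG {uG} => // I G hG /(_ I (mem_head _ _)).
    by have [/ideal_norm_gt0 + _] := hG I (mem_head _ _) => /[swap]; case: ideal_norm.
  by rewrite /weight_sum big_nil divr_ge0 ?ltW // subr_gt0.
pose inp := fun I : set O => `[< I `<=` p >].
have -> : weight_sum G =
    weight_sum [seq I <- G | ~~ inp I] + weight_sum [seq I <- G | inp I].
  by rewrite /weight_sum !big_filter addrC [LHS](bigID inp).
have h0 : weight_sum [seq I <- G | ~~ inp I] <= B.
  apply: IH => //; first exact: filter_uniq.
  move=> I; rewrite mem_filter => /andP[/asboolPn sIp /hG[nzI hI]]; split=> // p' pp' sIp'.
  by have := hI _ pp' sIp'; rewrite inE => /predU1P[p'E|//]; case: sIp; rewrite -p'E.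
have /choice[f fP] (I : set O) : exists J, I \in G -> I `<=` p ->
    nz_ideal J /\ I = ideal_mul p J.
  have [[IG sIp]|h] := pselect (I \in G /\ I `<=` p); last first.
    by exists setT => IG sIp; case: h.
  have [nzI _] := hG _ IG; have [iI _] := nzI; have [J iJ E] := ideal_dvd iI nzp sIp.
  exists J => _ _; split=> //; apply: (nz_ideal_sub nzI) => //.
  by rewrite E; exact: ideal_mul_subr.
have fP' I : I \in [seq I <- G | inp I] -> nz_ideal (f I) /\ I = ideal_mul p (f I).
  by rewrite mem_filter => /andP[/asboolP sIp IG]; exact: fP.
have GE : [seq I <- G | inp I] = map (ideal_mul p) (map f [seq I <- G | inp I]).
  rewrite -map_comp -[LHS]map_id; apply/eq_in_map => I /fP'[_ E].
  by rewrite /= -E.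
have nzf J : J \in map f [seq I <- G | inp I] -> nz_ideal J.
  by move=> /mapP[I /fP'[? _] ->].
have h1 : weight_sum (map f [seq I <- G | inp I]) <= B / (1 - weight p).
  apply: IHn.
  - by rewrite map_inj_in_uniq ?filter_uniq // => I J /fP'[_ +] /fP'[_ +] E; rewrite E => -> <-.
  - move=> _ /mapP[I IG ->]; have [nzJ E] := fP' _ IG; split=> // p' pp' sJp'.
    have {}IG : I \in G by move: IG; rewrite mem_filter => /andP[].
    have [_ hI] := hG _ IG; apply: hI => //; rewrite E; apply: subset_trans sJp'.
    by apply: ideal_mul_subr; case: nzJ.
  - move=> _ /mapP[I IG ->]; have [nzJ E] := fP' _ IG.
    have {}IG : I \in G by move: IG; rewrite mem_filter => /andP[].
    have := nG _ IG; rewrite {1}E ideal_norm_mul // expnS => h.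
    rewrite -(ltn_pmul2l (isT : (0 < 2)%N)); apply: leq_ltn_trans h.
    by rewrite leq_pmul2r ?ideal_norm_gt0.
rewrite GE weight_sum_map //.
apply: le_trans (lerD h0 (ler_wpM2l w_ge0 h1)) _.
rewrite le_eqVlt; apply/orP; left; apply/eqP; field.
by rewrite subr_eq0 eq_sym lt_eqF.
Qed.

(** The cutoff is on the rational prime q below p rather than on N(p), so that F can be built one q
    at a time, with all primes over q entering together. *)
Definition primes_upto (P : nat) F := [/\ uniq F,
  (forall p, p \in F -> nz_prime p) &
  (forall p q, nz_prime p -> prime q -> p q%:Z%:~R -> (p \in F) = (q <= P)%N)].

Lemma exists_primes_over q : prime q -> exists s, [/\ uniq s, (size s <= 2)%N &
  forall p, (p \in s) <-> nz_prime p /\ p q%:Z%:~R].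
Proof.
move=> qp; have [[p0 [pp0 p0q]]|h] := pselect (exists p, nz_prime p /\ p q%:Z%:~R); last first.
  by exists [::]; split=> // p; split=> // ?; case: h; exists p.
exists (undup [seq p <- [:: p0; conj_ideal p0] | `[< nz_prime p /\ p q%:Z%:~R >]]).
split=> [||p]; first exact: undup_uniq.
  by apply: leq_trans (size_undup _) _; rewrite size_filter (leq_trans (count_size _ _)).
rewrite mem_undup mem_filter; split=> [/andP[/asboolP//]|[pp pq]].
rewrite asboolT //= !inE.
by have [->|->] := primes_over pp0 pp qp p0q pq; rewrite eqxx ?orbT.
Qed.

Lemma euler_prod_cat F F' : euler_prod (F ++ F') = euler_prod F * euler_prod F'.
Proof. by rewrite /euler_prod big_cat. Qed.

(* At most two primes p lie over each q, both of norm at least q, and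
   prod_(2 <= n <= P) (1 - 1/n^2) = (P + 1) / (2 P). *)
Lemma exists_primes_upto (P : nat) : exists F, primes_upto P.+1 F /\
  (P.+2%:R / (2 * P.+1%:R)) ^+ 2 <= euler_prod F.
Proof.
elim: P => [|P [F [[uF Fp FP] IH]]].
  exists [::]; split; last by rewrite /euler_prod big_nil mulr1 divff // expr1n.
  split=> // p q _ qp _; rewrite in_nil; apply/esym/negbTE.
  by rewrite -ltnNge prime_gt1.
set a : R := _ / _ in IH.
pose c : R := 1 - (P.+2%:R ^+ 2)^-1.
have P2_gt0 : 0 < P.+2%:R :> R by rewrite ltr0n.
have P1_gt0 : 0 < P.+1%:R :> R by rewrite ltr0n.
have c_ge0 : 0 <= c.
  by rewrite subr_ge0 invf_le1 ?exprn_gt0 // -natrX ler1n expn_gt0.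
have c_le1 : c <= 1 by rewrite gerBl invr_ge0 exprn_ge0.
have -> : P.+3%:R / (2 * P.+2%:R) = a * c.
  rewrite /a /c -[P.+3]addn1 -[P.+2]addn1 !natrD; field.
  by rewrite !gt_eqF // -?natr1 // addr_gt0.
have [qp|qnp] := boolP (prime P.+2); last first.
  exists F; split.
    split=> // p q pp qp pq; rewrite (FP _ _ pp qp pq) [RHS]leq_eqVlt ltnS; case: eqP => // qE.
    by move: qnp; rewrite -qE qp.
  apply: le_trans IH; rewrite exprMn ler_piMr ?exprn_ge0 ?divr_ge0 ?mulr_ge0 //.
  by rewrite exprn_ile1.
have [s [us s2 sP]] := exists_primes_over qp.
exists (F ++ s); split; last first.
  rewrite euler_prod_cat exprMn ler_pM ?exprn_ge0 ?divr_ge0 ?mulr_ge0 //.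
  have cs p : p \in s -> c <= 1 - weight p.
    by move=> /sP[pp pq]; rewrite lerD2l lerN2; exact: weight_prime.
  case: s s2 cs {us sP} => [|p [|p' [|//]]] _ cs; rewrite /euler_prod.
  - by rewrite big_nil exprn_ile1.
  - rewrite big_seq1 expr2; apply: le_trans (cs p _); last exact: mem_head.
    by rewrite ler_piMr.
  - rewrite big_cons big_seq1 expr2.
    by rewrite ler_pM ?cs // !inE eqxx ?orbT.
have sF p : p \in s -> p \notin F.
  by move=> /sP[pp pq]; rewrite (FP _ _ pp qp pq) -ltnNge.
split.
- rewrite cat_uniq uF us andbT /=; apply/hasPn => p /sF //.
- by move=> p; rewrite mem_cat => /orP[/Fp//|/sP[]].
move=> p q pp qp' pq; rewrite mem_cat (FP _ _ pp qp' pq) [RHS]leq_eqVlt ltnS orbC.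
congr orb; apply/idP/eqP => [/sP[_ pP]|qE]; last by apply/sP; rewrite -qE.
apply/eqP; rewrite -dvdn_prime2 //; apply: prime_int_dvd pq pP => //.
by case: pp.
Qed.

Lemma prime_over_norm I p : nz_ideal I -> nz_prime p -> I `<=` p ->
  exists q, [/\ prime q, (q <= ideal_norm I)%N & p q%:Z%:~R].
Proof.
move=> nzI [pp _] sIp; have N_gt0 := ideal_norm_gt0 nzI.
have [|q [qp qN pq]] := prime_int_factor pp N_gt0; first by apply/sIp; exact: ideal_norm_mem.
by exists q; split=> //; exact: dvdn_leq.
Qed.

Lemma weight_sum_le_euler P F G : primes_upto P F -> uniq G ->
  (forall I, I \in G -> nz_ideal I /\ (ideal_norm I <= P)%N) ->
  weight_sum G <= (euler_prod F)^-1.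
Proof.
move=> [uF Fp FP] uG hG; apply: euler_upper => // I /hG[nzI IP]; split=> // p pp sIp.
have [q [qp qI pq]] := prime_over_norm nzI pp sIp.
by rewrite (FP _ _ pp qp pq) (leq_trans qI).
Qed.

(** This is the convergence of the zeta series. The lower bound of [exists_primes_upto] for the
    Euler product stays above (1/2)^2, whence the constant. *)
Lemma weight_sum_le4 G : uniq G -> (forall I, I \in G -> nz_ideal I) -> weight_sum G <= 4.
Proof.
move=> uG nzG; pose P := (\max_(I <- G) ideal_norm I)%N.
have [F [FP hF]] := exists_primes_upto P.
have GP I : I \in G -> nz_ideal I /\ (ideal_norm I <= P.+1)%N.
  move=> IG; split; first exact: nzG.
  by rewrite leqW // /P (big_rem I) //= leq_maxl.
apply: le_trans (weight_sum_le_euler FP uG GP) _.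
have [_ Fp _] := FP.
rewrite invf_ple ?posrE ?euler_prod_gt0 //; apply: le_trans hF.
rewrite (_ : 4^-1 = (2^-1) ^+ 2); last by rewrite exprVn -natrX.
rewrite lerXn2r ?nnegrE ?invr_ge0 ?divr_ge0 ?mulr_ge0 //.
by rewrite invfM mulrCA ler_peMr ?invr_ge0 // ler_pdivlMr ?ltr0n // mul1r ler_nat.
Qed.

Definition coprime_seq F G :=
  uniq G /\ forall I, I \in G -> nz_ideal I /\ forall p, p \in F -> ~ (I `<=` p).

(** The zeta value with the Euler factors at F removed, as a supremum of finite sums over the ideals
    contained in no prime of F. *)
Definition zeta_coprime F : R := sup [set weight_sum G | G in coprime_seq F].

Definition zetaR : R := zeta_coprime [::].

Lemma zeta_coprime_has_sup F : has_sup [set weight_sum G | G in coprime_seq F].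
Proof.
split; first by exists (weight_sum [::]), [::].
by exists 4 => _ [G [uG hG] <-]; apply: weight_sum_le4 => // I /hG[].
Qed.

Lemma weight_sum_le_zeta F G : coprime_seq F G -> weight_sum G <= zeta_coprime F.
Proof. by move=> hG; apply: ub_le_sup; [case: (zeta_coprime_has_sup F)|exists G]. Qed.

(* Among the ideals coprime to F, the multiples of p contribute the fraction weight p. *)
Lemma zeta_coprime_cons p F : nz_prime p -> (forall p', p' \in F -> nz_prime p') ->
  p \notin F -> zeta_coprime (p :: F) <= (1 - weight p) * zeta_coprime F.
Proof.
move=> pp Fp pF; have w_gt0 := weight_gt0 (nz_primeW pp).
have nzp := nz_primeW pp; have [ip _] := nzp.
apply: ge_sup; first by case: (zeta_coprime_has_sup (p :: F)).
move=> _ [G [uG hG] <-].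
suff h H : coprime_seq F H -> weight_sum G + weight p * weight_sum H <= zeta_coprime F.
  rewrite mulrBl mul1r lerBrDr -lerBrDl -ler_pdivlMl //.
  apply: ge_sup; first by case: (zeta_coprime_has_sup F).
  by move=> _ [H hH <-]; rewrite ler_pdivlMl // lerBrDl; exact: h.
move=> [uH hH]; have nzH I : I \in H -> nz_ideal I by move=> /hH[].
rewrite -weight_sum_map // -[_ + _]big_cat; apply: weight_sum_le_zeta.
split.
  rewrite cat_uniq uG uniq_map_ideal_mul // andbT; apply/hasPn => _ /mapP[I _ ->].
  apply/negP => /hG[_ /(_ p (mem_head _ _))]; apply; exact: ideal_mul_subl.
move=> I; rewrite mem_cat => /orP[/hG[nzI hI]|/mapP[J JH ->]].
  by split=> // p' p'F; apply: hI; rewrite inE p'F orbT.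
have [nzJ hJ] := hH _ JH; split; first exact: nz_ideal_mul.
move=> p' p'F; have pp' := Fp _ p'F; have [prp' _] := pp'; have [iJ _] := nzJ.
move=> /(prime_mul_subset prp' ip iJ)[|]; last exact: hJ.
by move=> /(nz_prime_eq pp pp') p'E; move: p'F; rewrite p'E (negPf pF).
Qed.

Lemma zeta_coprime_ge1 F : (forall p, p \in F -> nz_prime p) -> 1 <= zeta_coprime F.
Proof.
move=> Fp; have -> : 1 = weight_sum [:: [set: O]].
  by rewrite /weight_sum big_seq1 /weight ideal_normT expr1n invr1.
apply: weight_sum_le_zeta; split=> // I; rewrite inE => /eqP ->.
split; first exact: nz_idealT.
by move=> p /Fp[[_ p1 _] _] h; apply/p1/h.
Qed.

Lemma zetaR_ge1 : 1 <= zetaR. Proof. exact: zeta_coprime_ge1. Qed.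

Lemma zetaR_gt0 : 0 < zetaR. Proof. exact: lt_le_trans zetaR_ge1. Qed.

(** Removing one prime at a time gives [zeta_coprime F] <= [euler_prod F] * [zetaR], and the unit
    ideal alone makes the left side at least 1. *)
Lemma euler_prod_ge F : uniq F -> (forall p, p \in F -> nz_prime p) ->
  zetaR^-1 <= euler_prod F.
Proof.
move=> uF Fp; rewrite -div1r ler_pdivrMr ?zetaR_gt0 //.
apply: le_trans (zeta_coprime_ge1 Fp) _.
elim: F uF Fp => [|p F IH] /=; first by rewrite /euler_prod big_nil mul1r.
move=> /andP[pF uF] Fp; have pp : nz_prime p by apply: Fp; rewrite mem_head.
have Fp' p' : p' \in F -> nz_prime p' by move=> p'F; apply: Fp; rewrite inE p'F orbT.
apply: le_trans (zeta_coprime_cons pp Fp' pF) _.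
rewrite /euler_prod big_cons -mulrA ler_wpM2l ?IH //.
by rewrite subr_ge0 ltW // weight_prime_lt1.
Qed.

Lemma zetaR_adherent (e : R) : 0 < e -> exists G, coprime_seq [::] G /\ zetaR - e < weight_sum G.
Proof.
move=> e_gt0; have [_ [G hG <-] h] := sup_adherent e_gt0 (zeta_coprime_has_sup [::]).
by exists G.
Qed.

(** A finite list within e of the supremum leaves room for at most e in any list disjoint from it;
    larger norms ensure disjointness. *)
Lemma zeta_tail (e : R) : 0 < e -> exists P, forall G, uniq G ->
  (forall I, I \in G -> nz_ideal I /\ (P < ideal_norm I)%N) -> weight_sum G <= e.
Proof.
move=> e_gt0; have [G0 [[uG0 hG0] lt_G0]] := zetaR_adherent e_gt0.
exists (\max_(I <- G0) ideal_norm I)%N => G uG hG.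
rewrite -(lerD2l (weight_sum G0)) -[_ + weight_sum G]big_cat.
apply: (@le_trans _ _ zetaR); last by rewrite -lerBlDr ltW.
apply: weight_sum_le_zeta; split.
  rewrite cat_uniq uG0 uG andbT; apply/hasPn => I /hG[_ IP]; apply/negP => IG0.
  by move: IP; rewrite ltnNge (big_rem I) //= leq_maxl.
move=> I; rewrite mem_cat => /orP[/hG0[]|/hG[]] nzI _; split=> //.
Qed.

(** With D = 1 / [zetaR], take a finite list of weight above 1 / (D + e). Once F contains every
    prime dividing its members, that weight is at most 1 / [euler_prod F]. *)
Lemma euler_prod_le (e : R) : 0 < e -> exists P0, forall P F, (P0 <= P)%N ->
  primes_upto P F -> euler_prod F <= zetaR^-1 + e.
Proof.
move=> e_gt0; pose D := zetaR^-1.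
have D_gt0 : 0 < D by rewrite invr_gt0 zetaR_gt0.
have De_gt0 : 0 < D + e by exact: addr_gt0.
have e'_gt0 : 0 < D^-1 - (D + e)^-1.
  by rewrite subr_gt0 ltf_pV2 ?posrE // ltrDl.
have [G [[uG hG] lt_G]] := zetaR_adherent e'_gt0.
exists (\max_(I <- G) ideal_norm I)%N => P F leP FP; have [_ Fp _] := FP.
have GP I : I \in G -> nz_ideal I /\ (ideal_norm I <= P)%N.
  move=> IG; split; first by case: (hG _ IG).
  by apply: leq_trans leP; rewrite (big_rem I) //= leq_maxl.
have := weight_sum_le_euler FP uG GP; move/(lt_le_trans lt_G)/ltW.
rewrite {1}/D invrK opprB addrC subrK => h.
by rewrite -(@lef_pV2 R) ?posrE ?euler_prod_gt0.
Qed.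

Lemma dedekind_zetaE : dedekind_zeta O (k%:R : R) = zetaR%:E.
Proof.
rewrite /dedekind_zeta /esum /zetaR /zeta_coprime.
have [ne ub] := zeta_coprime_has_sup [::].
rewrite -ereal_sup_EFin //; congr ereal_sup; apply/seteqP; split.
  move=> _ [A [finA sA] <-]; exists (weight_sum (fset_set A)); last first.
    rewrite fsbig_finite // /weight_sum -sumEFin !big_seq.
    apply: eq_bigr => I; rewrite in_fset_set // inE => /sA nzI.
    by rewrite weight_powR.
  exists (fset_set A) => //; split; first exact: fset_uniq.
  by move=> I; rewrite in_fset_set // inE => /sA nzI.
move=> _ [_ [G [uG hG] <-] <-]; exists [set` G].
  by split; [exact: finite_seq|move=> I /hG[]].
rewrite -fsbig_seq // /weight_sum -sumEFin !big_seq.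
by apply: eq_bigr => I /hG[nzI _]; rewrite weight_powR.
Qed.

(** * The sieve *)

Lemma count_boxC M (P Q : set (int * int)) :
  (count_box M [set m | P m /\ ~ Q m] + count_box M [set m | P m /\ Q m])%N = count_box M P.
Proof.
rewrite /count_box -big_split; apply: eq_bigr => i _; rewrite -big_split.
apply: eq_bigr => j _ /=.
by do 3![case: asboolP => //=]; tauto.
Qed.

Lemma eq_count_box M (P Q : set (int * int)) : (forall m, P m <-> Q m) ->
  count_box M P = count_box M Q.
Proof.
by move=> h; congr count_box; apply/seteqP; split=> m /h.
Qed.

(* Inclusion-exclusion over F, one prime at a time: for I coprime to p, the
   elements of I in p^k form the ideal I p^k. *)
Lemma count_box_sieve F I (M : nat) (z : int * int) : uniq F ->
  (forall p, p \in F -> nz_prime p) -> nz_ideal I -> (forall p, p \in F -> ~ (I `<=` p)) ->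
  (0 < M)%N -> I M%:Z%:~R -> (forall p, p \in F -> ideal_exp p k M%:Z%:~R) ->
  (count_box M [set m | I (elt (m.1 - z.1, m.2 - z.2)) /\
    forall p, p \in F -> ~ ideal_exp p k (elt (m.1 - z.1, m.2 - z.2))])%:R
  = M%:R ^+ 2 * euler_prod F / (ideal_norm I)%:R :> R.
Proof.
move=> uF Fp nzI cFI M_gt0 IM FM; elim: F I uF Fp nzI cFI IM FM => [|p F IH] I.
  move=> _ _ nzI _ IM _; have N_gt0 := ideal_norm_gt0 nzI.
  rewrite (@eq_count_box _ _ [set m | I (elt (m.1 - z.1, m.2 - z.2))]); last first.
    by move=> m; split=> [[]|].
  have N_neq0 : (ideal_norm I)%:R != 0 :> R by rewrite pnatr_eq0 -lt0n.
  rewrite /euler_prod big_nil mulr1; apply: (mulIf N_neq0); rewrite divfK //.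
  by rewrite -natrM -natrX (count_box_ideal _ nzI M_gt0 IM).
move=> /= /andP[pF uF] Fp nzI cFI IM FM.
have memF p' : p' \in F -> p' \in p :: F by rewrite inE orbC => ->.
have pp := Fp _ (mem_head _ _); have [prp _] := pp; have nzp := nz_primeW pp.
have nIp := cFI _ (mem_head _ _); have [iI _] := nzI; have [ip _] := nzp.
have E := comaximal_exp_capE k iI ip (prime_comaximal pp iI nIp).
set J := ideal_mul I (ideal_exp p k) in E.
have nzpk := nz_ideal_exp k nzp; have nzJ : nz_ideal J by exact: nz_ideal_mul.
have h1 := IH I uF (fun p' h => Fp _ (memF _ h)) nzI (fun p' h => cFI _ (memF _ h)) IM
  (fun p' h => FM _ (memF _ h)).
have cFJ p' : p' \in F -> ~ (J `<=` p').
  move=> p'F; have pp' := Fp _ (memF _ p'F); have [prp' _] := pp'.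
  move=> /(prime_mul_subset prp' iI (is_ideal_exp _ _))[|/(prime_ideal_exp prp' ip)].
    by apply: cFI; exact: memF.
  by move=> /(nz_prime_eq pp pp') p'E; move: pF; rewrite -p'E p'F.
have JM : J M%:Z%:~R by rewrite -E; split=> //; apply: FM; exact: mem_head.
have h2 := IH J uF (fun p' h => Fp _ (memF _ h)) nzJ cFJ JM (fun p' h => FM _ (memF _ h)).
have := count_boxC M [set m | I (elt (m.1 - z.1, m.2 - z.2)) /\
    forall p, p \in F -> ~ ideal_exp p k (elt (m.1 - z.1, m.2 - z.2))]
    [set m | ideal_exp p k (elt (m.1 - z.1, m.2 - z.2))].
rewrite (@eq_count_box _ [set m | _ /\ ~ _] [set m | I (elt (m.1 - z.1, m.2 - z.2)) /\
    forall p', p' \in p :: F -> ~ ideal_exp p' k (elt (m.1 - z.1, m.2 - z.2))]); last first.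
  move=> m; split=> /= [[[? h] ?]|[? h]].
    by split=> // p'; rewrite inE => /predU1P[->//|]; exact: h.
  by split; [split=> // p' /memF; exact: h|apply: h; exact: mem_head].
rewrite (@eq_count_box _ [set m | _ /\ _ m] [set m | J (elt (m.1 - z.1, m.2 - z.2)) /\
    forall p', p' \in F -> ~ ideal_exp p' k (elt (m.1 - z.1, m.2 - z.2))]); last first.
  by move=> m; rewrite /= -E; split=> [[[? ?] ?]|[[? ?] ?]].
move=> /(congr1 (fun n : nat => n%:R : R)); rewrite natrD h1 h2.
move/(canRL (addrK _)) => ->.
have NI_neq0 : (ideal_norm I)%:R != 0 :> R by rewrite pnatr_eq0 -lt0n ideal_norm_gt0.
have Np_neq0 : (ideal_norm p)%:R ^+ k != 0 :> R.
  by rewrite expf_neq0 // pnatr_eq0 -lt0n ideal_norm_gt0.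
rewrite ideal_norm_mul // ideal_norm_exp // natrM natrX /euler_prod big_cons /weight.
by field; rewrite NI_neq0.
Qed.

Definition sieve F : set (int * int) :=
  [set m | forall p, p \in F -> ~ ideal_exp p k (elt m)].

Lemma count_box_sieveT F (M : nat) (w : int * int) : uniq F ->
  (forall p, p \in F -> nz_prime p) -> (0 < M)%N ->
  (forall p, p \in F -> ideal_exp p k M%:Z%:~R) ->
  (count_box M [set m | sieve F (m.1 + w.1, m.2 + w.2)])%:R = M%:R ^+ 2 * euler_prod F.
Proof.
move=> uF Fp M_gt0 FM.
have := @count_box_sieve F setT M (- w.1, - w.2) uF Fp nz_idealT _ M_gt0 Logic.I FM.
rewrite ideal_normT divr1 => <-.
  congr (_%:R); apply: eq_count_box => m; rewrite /sieve /= !opprK.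
  by split=> [h|[_ h]]; [split|].
by move=> p /Fp[[_ p1 _] _] h; apply/p1/h.
Qed.

(* A multiple of q^k for every prime q <= P. *)
Definition primes_modulus (P : nat) : nat := (P`! ^ k)%N.

Lemma primes_modulus_gt0 P : (0 < primes_modulus P)%N.
Proof. by rewrite expn_gt0 fact_gt0. Qed.

Lemma prime_modulus_mem P p q (x : O) : nz_prime p -> prime q -> (q <= P)%N -> p q%:Z%:~R ->
  ideal_exp p k (x * (primes_modulus P)%:Z%:~R).
Proof.
move=> [[[_ _ pM] _ _] _] qp qP pq; have [_ _ EM] := is_ideal_exp p k; apply: EM.
have /dvdnP[r rE] : (q %| P`!)%N by rewrite dvdn_fact // prime_gt0.
rewrite /primes_modulus -pmulrn natrX; apply: mem_ideal_exp.
by rewrite rE natrM; apply: pM; rewrite pmulrn.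
Qed.
(** The sum of the absolute values of the coefficients of the norm form, hence its maximum on the
    square of half-side s is at most this times s^2. *)
Definition qnorm_bound : nat := (1 + `|T| + `|n0|)%N.

Lemma qnorm_boundP m (s : nat) : (`|m.1| <= s)%N -> (`|m.2| <= s)%N ->
  (`|qnorm m| <= qnorm_bound * s ^ 2)%N.
Proof.
move=> m1s m2s; rewrite /qnorm /qnorm_bound !mulnDl mul1n.
have hn (x y : int) : (`|(x + y)%R| <= `|x| + `|y|)%N by lia.
apply: leq_trans (hn _ _) (leq_add (leq_trans (hn _ _) (leq_add _ _)) _).
- by rewrite abszX leq_exp2r.
- by rewrite !abszM leq_mul // leq_mul.
- by rewrite abszM abszX leq_mul // leq_exp2r.
Qed.

Lemma count_box_card M (P : set (int * int)) :
  count_box M P = #|[set ij : 'I_M * 'I_M | `[< P (ij.1%:Z, ij.2%:Z) >]]%SET|.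
Proof.
rewrite /count_box pair_bigA /= -sum1_card [RHS]big_mkcond.
by apply: eq_bigr => -[i j] _; rewrite inE /=; case: asboolP.
Qed.

(* One point per cell of side l. *)
Lemma count_box_cell (M l : nat) (P : set (int * int)) : (0 < l)%N ->
  (forall y y', P y -> P y' -> (`|(y.1 - y'.1)%R| < l)%N -> (`|(y.2 - y'.2)%R| < l)%N -> y = y') ->
  (count_box M P <= (M %/ l).+1 ^ 2)%N.
Proof.
move=> l_gt0 hP; rewrite count_box_card.
pose f (ij : 'I_M * 'I_M) : 'I_(M %/ l).+1 * 'I_(M %/ l).+1 :=
  (inord (ij.1 %/ l), inord (ij.2 %/ l)).
have lt_div (i : 'I_M) : (i %/ l < (M %/ l).+1)%N.
  by rewrite ltnS leq_div2r // ltnW.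
have := max_card (f @: [set ij : 'I_M * 'I_M | `[< P (ij.1%:Z, ij.2%:Z) >]])%SET.
rewrite card_in_imset ?card_prod ?card_ord //.
move=> [i j] [i' j']; rewrite !inE => /asboolP Pij /asboolP Pij' [].
move=> /(congr1 val) + /(congr1 val); rewrite /= !inordK // => Ei Ej.
have cell (a b : nat) : (a %/ l = b %/ l)%N -> (`|(a%:Z - b%:Z)%R| < l)%N.
  move=> E; have := divn_eq a l; have := divn_eq b l.
  by rewrite E; have := ltn_pmod a l_gt0; have := ltn_pmod b l_gt0; lia.
have := hP _ _ (asboolW Pij) (asboolW Pij') (cell _ _ Ei) (cell _ _ Ej).
by move=> [Ei' Ej']; congr pair; apply: val_inj => /=; lia.
Qed.

Lemma elt_lin (z y : int * int) (Q : nat) :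
  elt (z.1 + Q%:Z * y.1, z.2 + Q%:Z * y.2) = elt z + Q%:Z%:~R * elt y.
Proof. by rewrite elt_scale eltD. Qed.

(* Nonzero elements of J have norm divisible by N(J), hence coordinates at least
   of order sqrt N(J): this is the side of the cells. *)
Lemma count_box_lattice J (M Q : nat) (z : int * int) : nz_ideal J ->
  (forall x, J (Q%:Z%:~R * x) -> J x) ->
  (count_box M [set y | J (elt (z.1 + Q%:Z * y.1, z.2 + Q%:Z * y.2))])%:R <=
  2 * (qnorm_bound%:R * M%:R ^+ 2 / (ideal_norm J)%:R + 1) :> R.
Proof.
move=> nzJ cQ; have N_gt0 := ideal_norm_gt0 nzJ; have [iJ _] := nzJ.
have C_gt0 : (0 < qnorm_bound)%N by [].
(* l is the least integer with N(J) <= C l^2. Two points of one cell differ by at most l - 1 in each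
   coordinate, so their difference has norm below N(J). *)
have [l [l_gt0 lN Nl]] : exists l, [/\ (0 < l)%N, (qnorm_bound * l.-1 ^ 2 < ideal_norm J)%N &
    (ideal_norm J <= qnorm_bound * l ^ 2)%N].
  have ex : exists l, (ideal_norm J <= qnorm_bound * l ^ 2)%N.
    exists (ideal_norm J); rewrite expnS expn1 mulnA leq_pmull //.
    by rewrite muln_gt0 N_gt0.
  have [l hl l_min] := ex_minnP ex; exists l; split=> //.
    by case: l hl {l_min} => //; rewrite muln0 leqNgt N_gt0.
  case: l hl l_min => [|l] hl l_min; first by rewrite muln0.
  by rewrite ltnNge; apply/negP => /l_min; rewrite ltnn.
have hcell : (count_box M [set y | J (elt (z.1 + Q%:Z * y.1, z.2 + Q%:Z * y.2)%R)] <=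
    (M %/ l).+1 ^ 2)%N.
  apply: count_box_cell => // y y' /=; rewrite !elt_lin => Jy Jy' y1 y2.
  have : J (elt (y.1 - y'.1, y.2 - y'.2)).
    apply: cQ; rewrite -eltB (_ : _ * _ = elt z + Q%:Z%:~R * elt y
      - (elt z + Q%:Z%:~R * elt y')); [exact: ideal_sub|ring].
  move=> Jd; have [q0|q0] := eqVneq (qnorm (y.1 - y'.1, y.2 - y'.2)) 0.
    have [/eqP + /eqP] := qnorm_eq0 q0; rewrite !subr_eq0.
    by case: (y) (y') => a b [a' b'] /= /eqP -> /eqP ->.
  have qd := ideal_norm_dvd nzJ Jd.
  have h : (`|qnorm (y.1 - y'.1, y.2 - y'.2)%R| <= qnorm_bound * l.-1 ^ 2)%N.
    by apply: qnorm_boundP; rewrite -ltnS prednK.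
  have : (ideal_norm J <= `|qnorm (y.1 - y'.1, y.2 - y'.2)%R|)%N.
    by apply: dvdn_leq; rewrite ?absz_gt0.
  by move=> /leq_trans/(_ h); rewrite leqNgt lN.
have N_gt0' : 0 < (ideal_norm J)%:R :> R by rewrite ltr0n.
have l_gt0' : 0 < l%:R :> R by rewrite ltr0n.
apply: le_trans (_ : ((M %/ l).+1 ^ 2)%:R <= _); first by rewrite ler_nat.
apply: le_trans (_ : (M%:R / l%:R + 1) ^+ 2 <= _).
  rewrite natrX lerXn2r ?nnegrE ?addr_ge0 ?divr_ge0 // -natr1 lerD2r.
  by rewrite ler_pdivlMr // -natrM ler_nat leq_divM.
apply: le_trans (_ : 2 * ((M%:R / l%:R) ^+ 2 + 1) <= _).
  by have := sqr_ge0 (M%:R / l%:R - 1 : R); rewrite !expr2; nra.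
rewrite ler_pM2l // lerD2r ler_pdivlMr // expr_div_n.
rewrite mulrAC ler_pdivrMr ?exprn_gt0 //.
rewrite [X in X <= _]mulrC [X in _ <= X]mulrAC ler_wpM2r ?exprn_ge0 //.
by rewrite -natrX -natrM ler_nat.
Qed.
(** (Q) and p are comaximal, so (Q) meets p^k in Q p^k, and Q cancels. *)
Lemma coprime_exp_mem p (Q : nat) x : nz_prime p -> (0 < Q)%N ->
  (forall q, prime q -> p q%:Z%:~R -> ~~ (q %| Q)%N) ->
  ideal_exp p k (Q%:Z%:~R * x) -> ideal_exp p k x.
Proof.
move=> pp Q_gt0 cQ pQx; have [prp _] := pp; have [ip _] := nz_primeW pp.
have iQ : is_ideal (principal (Q%:Z%:~R : O)) by exact: is_ideal_principal.
have nQp : ~ (principal (Q%:Z%:~R : O) `<=` p).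
  move=> /(principal_subset _ ip) pQ.
  by have [q [qp qQ pq]] := prime_int_factor prp Q_gt0 pQ; move: (cQ _ qp pq); rewrite qQ.
have E := comaximal_exp_capE k iQ ip (prime_comaximal pp iQ nQp).
have : ideal_mul (principal (Q%:Z%:~R : O)) (ideal_exp p k) (Q%:Z%:~R * x).
  by rewrite -E; split=> //; apply/principalP; exists x; rewrite mulrC.
move=> /(mul_principalP _ _ (is_ideal_exp _ _))[y py]; move/mulO_cancel => -> //.
by rewrite eqz_nat -lt0n.
Qed.

(** The points of the progression z + Q Z^2 spoiled by primes of norm above P prime to Q. The zero
    element lies in every p^k and is listed apart, so that for the other points the norm bounds the
    primes involved. *)
Definition sieve_bad (P Q : nat) (z : int * int) : set (int * int) :=
  [set y | elt (z.1 + Q%:Z * y.1, z.2 + Q%:Z * y.2) = 0 \/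
    exists p, [/\ nz_prime p, (P < ideal_norm p)%N,
      (forall q, prime q -> p q%:Z%:~R -> ~~ (q %| Q)%N) &
      ideal_exp p k (elt (z.1 + Q%:Z * y.1, z.2 + Q%:Z * y.2))]].

Lemma count_box_cover (A : eqType) M (P P0 : set (int * int)) (S : A -> set (int * int)) (G : seq A) :
  (forall i j : 'I_M, P (i%:Z, j%:Z) -> P0 (i%:Z, j%:Z) \/ exists2 a, a \in G & S a (i%:Z, j%:Z)) ->
  (count_box M P <= count_box M P0 + \sum_(a <- G) count_box M (S a))%N.
Proof.
move=> h; rewrite /count_box [X in (_ <= _ + X)%N]exchange_big /= -big_split /=; apply: leq_sum => i _.
rewrite [X in (_ <= _ + X)%N]exchange_big /= -big_split /=; apply: leq_sum => j _.
case: asboolP => // /h[P0ij|[a aG Sa]]; first by rewrite asboolT.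
by rewrite (big_rem a) //= (asboolT Sa) addnCA leq_addr.
Qed.

Lemma ideal_norm_le J m (s : nat) : nz_ideal J -> J (elt m) -> elt m <> 0 ->
  (`|m.1| <= s)%N -> (`|m.2| <= s)%N -> (ideal_norm J <= qnorm_bound * s ^ 2)%N.
Proof.
move=> nzJ Jm m0 m1s m2s; apply: leq_trans (qnorm_boundP m1s m2s).
apply: dvdn_leq; last exact: ideal_norm_dvd.
rewrite absz_gt0; apply/eqP => /qnorm_eq0 mE; apply: m0.
by rewrite mE elt0.
Qed.

(* A prime p with p^k meeting the box outside 0 has N(p)^k = O(Q^2 M^2), so the
   error term 1 in [count_box_lattice] is at most O(Q^2 M^2) weight p; beyond a
   second threshold P' depending on Q these sum up to a small multiple of M^2. *)
Lemma sieve_tail (e : R) : 0 < e -> exists P, forall Q, (0 < Q)%N -> exists M0, forall M z,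
  (M0 <= M)%N -> (`|z.1| <= M)%N -> (`|z.2| <= M)%N ->
  (count_box M (sieve_bad P Q z))%:R <= e * M%:R ^+ 2.
Proof.
move=> e_gt0; pose C : R := qnorm_bound%:R.
have C_gt0 : 0 < C by rewrite ltr0n.
have [|P hP] := @zeta_tail (e / (8 * C)); first by rewrite divr_gt0 // mulr_gt0.
exists P => Q Q_gt0; pose Qr : R := Q%:R.
have Qr_gt0 : 0 < Qr by rewrite ltr0n.
have [|P' hP'] := @zeta_tail (e / (64 * C * Qr ^+ 2)).
  by rewrite divr_gt0 // !mulr_gt0 // exprn_gt0.
pose B : R := (8 * P'%:R ^+ k + 1) / (e / 2).
have B_ge0 : 0 <= B by rewrite divr_ge0 ?addr_ge0 ?mulr_ge0 ?exprn_ge0 ?invr_ge0 // ltW.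
exists (Num.bound B).+1 => M z M0M z1M z2M.
have M_gt0 : (0 < M)%N by apply: leq_trans M0M.
pose x (ij : 'I_M * 'I_M) : O := elt (z.1 + Q%:Z * ij.1%:Z, z.2 + Q%:Z * ij.2%:Z).
pose bad1 (ij : 'I_M * 'I_M) p := [/\ nz_prime p, (P < ideal_norm p)%N,
      (forall q, prime q -> p q%:Z%:~R -> ~~ (q %| Q)%N) & ideal_exp p k (x ij)].
(* One bad prime per spoiled point is enough for a cover and keeps the list G finite and inside the
   range allowed by the norm. *)
have /choice[g gP] ij : exists p, (exists p', bad1 ij p') -> bad1 ij p.
  have [[p bp]|h] := pselect (exists p', bad1 ij p'); first by exists p.
  by exists setT => /h.
pose G := undup [seq g ij | ij <- enum {: 'I_M * 'I_M} &
  `[< x ij <> 0 /\ exists p, bad1 ij p >]].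
have GP p : p \in G -> exists ij, x ij <> 0 /\ bad1 ij p.
  rewrite mem_undup => /mapP[ij]; rewrite mem_filter => /andP[/asboolP[x0 hp] _] ->.
  by exists ij; split=> //; exact: gP.
have hcov : (count_box M (sieve_bad P Q z) <=
    count_box M [set y | elt (z.1 + Q%:Z * y.1, z.2 + Q%:Z * y.2)%R = 0%R] +
    \sum_(p <- G) count_box M [set y |
      ideal_exp p k (elt (z.1 + Q%:Z * y.1, z.2 + Q%:Z * y.2)%R)])%N.
  apply: count_box_cover => i j bij; have [x0|x0] := pselect (x (i, j) = 0); [by left|right].
  case: bij => // hp; have [pp Pp cp pij] := gP (i, j) hp.
  exists (g (i, j)) => //; rewrite mem_undup; apply: map_f.
  by rewrite mem_filter mem_enum andbT; apply/asboolP.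
have hzero : (count_box M [set y | elt (z.1 + Q%:Z * y.1, z.2 + Q%:Z * y.2)%R = 0%R] <= 1)%N.
  rewrite -(exp1n 2) -[X in (_ <= X ^ _)%N](_ : (M %/ M.+1).+1 = 1%N); last first.
    by rewrite divn_small.
  apply: count_box_cell => // -[a b] [a' b'] /= E E' _ _; move: E; rewrite -E' => /elt_inj[].
  have Q0 : Q%:Z != 0 by rewrite eqz_nat -lt0n.
  by move=> /addrI/(mulfI Q0) -> /addrI/(mulfI Q0) ->.
have wexp p : nz_prime p -> weight p = ((ideal_norm (ideal_exp p k))%:R)^-1.
  by move=> pp; rewrite ideal_norm_exp ?natrX //; exact: nz_primeW.
have hterm p : p \in G -> (count_box M [set y |
      ideal_exp p k (elt (z.1 + Q%:Z * y.1, z.2 + Q%:Z * y.2)%R)])%:R <=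
      2 * C * M%:R ^+ 2 * weight p + 2.
  move=> /GP[ij [_ [pp _ cp _]]]; have nzpk := nz_ideal_exp k (nz_primeW pp).
  apply: le_trans (count_box_lattice M z nzpk _) _; last by rewrite wexp // mulrDr mulr1 -!mulrA.
  by move=> y; exact: coprime_exp_mem.
(* H = C (2 Q M)^2 bounds the norm of z + Q y, whose coordinates are at most 2 Q M; a nonzero value
   in p^k then gives N(p)^k <= H. *)
pose H : R := 4 * C * Qr ^+ 2 * M%:R ^+ 2.
have hH p : p \in G -> 1 <= H * weight p.
  move=> /GP[[i j] [x0 [pp _ _ pij]]]; have nzpk := nz_ideal_exp k (nz_primeW pp).
  rewrite wexp // ler_pdivlMr ?ltr0n ?ideal_norm_gt0 // mul1r.
  have := ideal_norm_le (s := (2 * Q * M)%N) nzpk pij x0.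
  have hs (a : int) (b : 'I_M) : (`|a| <= M)%N -> (`|(a + Q%:Z * b%:Z)%R| <= 2 * Q * M)%N.
    by have := ltn_ord b; nia.
  move=> /(_ (hs _ _ z1M) (hs _ _ z2M)); rewrite -(ler_nat R) => /le_trans; apply.
  by rewrite natrM natrX !natrM /H /C /Qr; lra.
have hsmall p : p \in G -> (ideal_norm p <= P')%N -> 1 <= P'%:R ^+ k * weight p.
  move=> /GP[ij [_ [pp _ _ _]]] pP'.
  rewrite ler_pdivlMr ?exprn_gt0 ?ltr0n ?ideal_norm_gt0 //; last exact: nz_primeW.
  by rewrite mul1r -!natrX ler_nat leq_exp2r // (leq_trans _ k_ge2).
have uG : uniq G by exact: undup_uniq.
have nzG p : p \in G -> nz_ideal p by move=> /GP[ij [_ [pp _ _ _]]]; exact: nz_primeW.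
have hw : weight_sum G <= e / (8 * C).
  apply: hP => // p pG; split; first exact: nzG.
  by have [ij [_ []]] := GP _ pG.
(* The length of G: up to P' replace 1 by P'^k times the weight, with total weight at most 4; beyond
   P' replace 1 by H times the weight, a tail below e / (64 C Q^2). *)
have hone : \sum_(p <- G) (1 : R) <= 4 * P'%:R ^+ k + e / 16 * M%:R ^+ 2.
  rewrite (bigID (fun p => (ideal_norm p <= P')%N)) /= lerD //.
    apply: le_trans (_ : \sum_(p <- [seq p <- G | (ideal_norm p <= P')%N]) P'%:R ^+ k * weight p <= _).
      by rewrite big_filter big_seq_cond [leRHS]big_seq_cond ler_sum // => p /andP[pG ?]; exact: hsmall.
    rewrite -mulr_sumr mulrC ler_wpM2r ?exprn_ge0 //; apply: weight_sum_le4.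
      exact: filter_uniq.
    by move=> p; rewrite mem_filter => /andP[_]; exact: nzG.
  apply: le_trans (_ : \sum_(p <- [seq p <- G | ~~ (ideal_norm p <= P')%N]) H * weight p <= _).
    by rewrite big_filter big_seq_cond [leRHS]big_seq_cond ler_sum // => p /andP[pG ?]; exact: hH.
  rewrite -mulr_sumr; apply: le_trans (_ : H * (e / (64 * C * Qr ^+ 2)) <= _).
    rewrite ler_wpM2l //.
      by rewrite /H !mulr_ge0 // ?exprn_ge0 // ltW.
    apply: hP'; first exact: filter_uniq.
    move=> p; rewrite mem_filter ltnNge => /andP[pP' pG]; split=> //; exact: nzG.
  rewrite le_eqVlt; apply/orP; left; apply/eqP; rewrite /H; field.
  by rewrite !gt_eqF.
have M_gt0' : 1 <= M%:R :> R by rewrite ler1n.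
have hB : 8 * P'%:R ^+ k + 1 <= e / 2 * M%:R ^+ 2.
  have : B <= M%:R.
    apply: le_trans (ltW (archi_boundP B_ge0)) _; rewrite ler_nat.
    exact: leq_trans (leqnSn _) M0M.
  rewrite ler_pdivrMr ?divr_gt0 // => /le_trans; apply.
  by rewrite [leLHS]mulrC ler_pM2l ?divr_gt0 // expr2 ler_peMr.
apply: le_trans (_ : 1 + \sum_(p <- G) (2 * C * M%:R ^+ 2 * weight p + 2) <= _).
  move: hcov; rewrite -(ler_nat R) => /le_trans; apply.
  rewrite natrD lerD //; first by rewrite (ler_nat R _ 1).
  by rewrite natr_sum !big_seq ler_sum // => p pG; exact: hterm.
rewrite big_split /= -mulr_sumr -[X in _ + (_ + X)](_ : 2 * \sum_(p <- G) (1 : R) = _); last first.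
  by rewrite mulr_sumr; apply: eq_bigr => p _; rewrite mulr1.
have : 2 * C * M%:R ^+ 2 * weight_sum G <= e / 4 * M%:R ^+ 2.
  apply: le_trans (_ : 2 * C * M%:R ^+ 2 * (e / (8 * C)) <= _).
    by rewrite ler_wpM2l // !mulr_ge0 // ?exprn_ge0 // ltW.
  by rewrite le_eqVlt; apply/orP; left; apply/eqP; field; rewrite gt_eqF.
rewrite /weight_sum.
have : 0 <= e * M%:R ^+ 2 by rewrite mulr_ge0 ?exprn_ge0 // ltW.
move: hone hB; set s1 := \sum_(p <- G) _; set s2 := \sum_(p <- G) _.
rewrite -![e / _ * _]mulrAC; set u := e * _; lra.
Qed.

(** * Chinese remainder theorem and realisation of subsets *)

Lemma int_solve (Q n : nat) (c : int) : coprime Q n -> exists s : int, (n%:Z %| c + Q%:Z * s)%Z.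
Proof.
move=> cQn; have /eqP E : coprimez Q%:Z n%:Z by [].
have [u [v uv]] := Bezoutz Q%:Z n%:Z; rewrite E in uv.
exists (- c * u); apply/dvdzP; exists (c * v).
by rewrite -[X in X + _]mulr1 -uv; ring.
Qed.

(** Points of X are killed one by one: t is moved by a multiple of the current modulus Q so that q^k
    divides t + m for a fresh prime q. The clause on the primes of Q is what later shows that q does
    no harm to the wanted points. *)
Lemma crt_points (A N0 : nat) (X : seq (int * int)) : (0 < A)%N ->
  exists (Q : nat) (t : int * int), [/\ (0 < Q)%N, (A %| Q)%N, (A%:Z %| t.1)%Z /\ (A%:Z %| t.2)%Z,
    (forall q, prime q -> (q %| Q)%N -> (q %| A)%N \/ (N0 < q)%N /\
       exists2 m, m \in X & (q%:Z %| t.1 + m.1)%Z /\ (q%:Z %| t.2 + m.2)%Z) &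
    (forall m, m \in X -> exists q : nat, [/\ prime q, (q ^ k %| Q)%N,
       ((q ^ k)%:Z %| t.1 + m.1)%Z & ((q ^ k)%:Z %| t.2 + m.2)%Z])].
Proof.
move=> A_gt0; elim: X => [|m0 X [Q [t [Q_gt0 AQ [At1 At2] hQ hX]]]].
  by exists A, (0, 0); split=> //= q _ qA; left.
(* Above Q to be coprime to it, above N0 for the requested lower bound. *)
have [q q_gt qp] := prime_above (N0 + Q)%N.
have k_gt0 : (0 < k)%N by exact: leq_trans k_ge2.
have cQq : coprime Q (q ^ k).
  rewrite coprime_pexpr // coprime_sym prime_coprime //.
  by apply/negP => /(dvdn_leq Q_gt0); rewrite leqNgt (leq_trans _ q_gt) // ltnS leq_addl.
have [s1 s1E] := int_solve (t.1 + m0.1) cQq.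
have [s2 s2E] := int_solve (t.2 + m0.2) cQq.
have dvdQ (c n : nat) (a b s : int) : (c %| Q)%N -> (c%:Z %| a + b)%Z -> (c%:Z %| (a + Q%:Z * s) + b)%Z.
  by move=> cQ cab; rewrite addrAC rpredD // dvdz_mulr.
have q1E : ((q ^ k)%:Z %| (t.1 + Q%:Z * s1) + m0.1)%Z by rewrite addrAC.
have q2E : ((q ^ k)%:Z %| (t.2 + Q%:Z * s2) + m0.2)%Z by rewrite addrAC.
exists (Q * q ^ k)%N, (t.1 + Q%:Z * s1, t.2 + Q%:Z * s2); split.
- by rewrite muln_gt0 Q_gt0 expn_gt0 prime_gt0.
- exact: dvdn_mulr.
- by split; rewrite rpredD // dvdz_mulr.
- move=> q' q'p; rewrite Euclid_dvdM // Euclid_dvdX // => /orP[q'Q|/andP[q'q _]].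
    have [?|[? [m mX [? ?]]]] := hQ _ q'p q'Q; [by left|right; split=> //].
    by exists m; [rewrite inE mX orbT|split; exact: dvdQ].
  have -> : q' = q by apply/eqP; rewrite -dvdn_prime2.
  right; split; first by apply: leq_ltn_trans q_gt; exact: leq_addr.
  have qqk : (q%:Z %| (q ^ k)%:Z)%Z by rewrite -[q in X in (X %| _)%Z]expn1; exact: dvdn_exp2l.
  by exists m0; [exact: mem_head|split; apply: dvdz_trans qqk _].
- move=> m; rewrite inE => /predU1P[->|/hX[q' [? q'Q ? ?]]].
    by exists q; split=> //; exact: dvdn_mull.
  by exists q'; split=> //; [exact: dvdn_mulr|exact: dvdQ|exact: dvdQ].
Qed.

Lemma prime_dvd_fact q n : prime q -> (q %| n`!)%N -> (q <= n)%N.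
Proof.
move=> qp; elim: n => [|n IH]; first by rewrite fact0 dvdn1; case: q qp => [|[]].
by rewrite factS Euclid_dvdM // => /orP[/dvdn_leq-> //|/IH/leqW].
Qed.

Lemma exists_prime_over q : prime q -> exists2 p, nz_prime p & p q%:Z%:~R.
Proof.
move=> qp; have iq : is_ideal (principal (q%:Z%:~R : O)) by exact: is_ideal_principal.
have nzq : nz_ideal (principal (q%:Z%:~R : O)).
  split=> //; apply/(nz_idealP iq); exists q%:Z%:~R; first exact: mem_principal.
  by apply/eqP => /(intO_inj (m := 0)) q0; case: (q) q0 qp.
have qT : principal (q%:Z%:~R : O) <> setT.
  move=> E; have : principal (q%:Z%:~R : O) 1 by rewrite E.
  move=> /principalP[x]; have [[x1 x2] ->] := eltP x.
  rewrite mulrC elt_scale -[1](_ : 1%:~R = _) // elt_int => /elt_inj[/= E1 _].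
  have : (q%:Z %| 1)%Z by apply/dvdzP; exists x1; rewrite mulrC; exact: E1.
  by rewrite dvdz1 /= => /eqP q1; move: qp; rewrite q1.
have [p pp sp] := exists_prime nzq qT; exists p => //; apply: sp; exact: mem_principal.
Qed.

Definition kfree_pts : set (int * int) := [set m | kfree k (elt m)].
Local Notation V := kfree_pts.

Lemma kfree_ptsE m : V m <-> elt m <> 0 /\ forall p, nz_prime p -> ~ ideal_exp p k (elt m).
Proof. by apply: kfreeE; exact: leq_trans k_ge2. Qed.

(* Choose t in a residue class that makes t + m divisible by q_m^k for each
   unwanted m, with distinct large primes q_m, and makes t divisible by q^k for all
   small q; the sieve then finds a t in this class that leaves t + w k-free at the
   other primes for all w in W. *)
Lemma kfree_translate (S W : seq (int * int)) : (forall w, w \in W -> V w) ->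
  exists t : int * int, forall m, m \in S -> V (m.1 + t.1, m.2 + t.2) <-> m \in W.
Proof.
(* The bad sets of all w in W together then fill less than half of the box, so some y avoids them
   all. *)
move=> hW; pose e : R := (2 * (size W).+1%:R)^-1.
have [|P hP] := @sieve_tail e; first by rewrite invr_gt0 mulr_gt0 // ltr0n.
(* A prime ideal over q > N0 cannot contain t + w and t + m for distinct w in W and m in S: its norm
   would divide a nonzero number of size at most N0. *)
pose N0 := (\max_(w <- W) \max_(m <- S) `|qnorm (w.1 - m.1, w.2 - m.2)%R|)%N.
have [Q [t0 [Q_gt0 AQ [At1 At2] hQ hX]]] :=
  crt_points N0 [seq m <- S | m \notin W] (primes_modulus_gt0 P).
have [M0 hM0] := hP Q Q_gt0.
pose M := (M0 + 1 + \max_(w <- W) (`|(t0.1 + w.1)%R| + `|(t0.2 + w.2)%R|))%N.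
have M_gt0 : (0 < M)%N by rewrite /M; lia.
have [y hy] : exists y : int * int, forall w, w \in W ->
    ~ sieve_bad P Q (t0.1 + w.1, t0.2 + w.2) y.
  apply: contrapT => hno.
  have : (count_box M setT <= count_box M set0 +
      \sum_(w <- W) count_box M (sieve_bad P Q (t0.1 + w.1, t0.2 + w.2)%R))%N.
    apply: count_box_cover => i j _; right; apply: contrapT => h; apply: hno.
    by exists (i%:Z, j%:Z) => w wW hw; apply: h; exists w.
  have -> : count_box M setT = (M ^ 2)%N.
    rewrite /count_box (eq_bigr (fun=> M)) ?sum_nat_const ?card_ord ?expnS ?expn1 ?muln1 // => i _.
    rewrite (eq_bigr (fun=> 1%N)) ?sum1_card ?card_ord // => j _.
    by rewrite asboolT.
  have -> : count_box M set0 = 0%N.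
    by rewrite /count_box big1 // => i _; rewrite big1 // => j _; rewrite asboolF.
  rewrite add0n -(ler_nat R) natr_sum => h.
  have h' : \sum_(w <- W) (count_box M (sieve_bad P Q (t0.1 + w.1, t0.2 + w.2)))%:R <=
      \sum_(w <- W) e * M%:R ^+ 2.
    rewrite !big_seq ler_sum // => w wW.
    have wM : (`|(t0.1 + w.1)%R| + `|(t0.2 + w.2)%R| <= M)%N.
      by rewrite /M (big_rem w) //=; lia.
    apply: hM0 => /=; first by rewrite /M; lia.
      by apply: leq_trans wM; exact: leq_addr.
    by apply: leq_trans wM; exact: leq_addl.
  have := le_trans h h'.
  rewrite big_const_seq count_predT iter_addr addr0 -[leRHS]mulr_natr natrX.
  have M2_gt0 : 0 < M%:R ^+ 2 :> R by rewrite exprn_gt0 ?ltr0n.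
  rewrite mulrAC -{1}[_ ^+ 2]mul1r ler_pM2r // /e.
  have := ler0n R (size W); rewrite -natr1 => sW.
  by rewrite mulrC ler_pdivlMr ?mulr_gt0 ?addr_gt0 //; lra.
pose t : int * int := (t0.1 + Q%:Z * y.1, t0.2 + Q%:Z * y.2).
have tw m : elt (m.1 + t.1, m.2 + t.2) =
    elt ((t0.1 + m.1) + Q%:Z * y.1, (t0.2 + m.2) + Q%:Z * y.2).
  by rewrite /t /=; congr elt; congr pair; ring.
exists t => m mS; split=> [Vt|mW].
  apply: contrapT => mW; have mX : m \in [seq m <- S | m \notin W].
    by rewrite mem_filter mS andbT; exact/negP.
  have [q [qp qkQ q1 q2]] := hX _ mX.
  have [p pp pq] := exists_prime_over qp.
  have [_ _ EM] := is_ideal_exp p k.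
  apply: ((kfree_ptsE _).1 Vt).2 pp _; rewrite tw.
  have /dvdzP[a aE] : ((q ^ k)%:Z %| (t0.1 + m.1) + Q%:Z * y.1)%Z.
    by rewrite rpredD // dvdz_mulr.
  have /dvdzP[b bE] : ((q ^ k)%:Z %| (t0.2 + m.2) + Q%:Z * y.2)%Z.
    by rewrite rpredD // dvdz_mulr.
  rewrite aE bE [a * _]mulrC [b * _]mulrC -(elt_scale (q ^ k)%:Z (a, b)) mulrC.
  by apply: EM; rewrite -pmulrn natrX; apply: mem_ideal_exp; rewrite pmulrn.
apply/kfree_ptsE; rewrite tw; split=> [x0|p pp px].
  by apply: (hy _ mW); left.
have [q [qp qN pq]] := nz_prime_over pp.
have pkp : ideal_exp p k `<=` p.
  by apply: ideal_exp_subset; [case: (nz_primeW pp)|exact: leq_trans k_ge2].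
(* For q <= P, t is divisible by [primes_modulus P], so t + m and m agree modulo p^k and the claim
   at p is inherited from m in V. *)
have [qP|Pq] := leqP q P.
  have [_ hm] := (kfree_ptsE _).1 (hW _ mW); apply: (hm _ pp).
  have pkA x : ideal_exp p k (x * (primes_modulus P)%:Z%:~R).
    exact: prime_modulus_mem pp qp qP pq.
  have /dvdzP[a aE] : ((primes_modulus P)%:Z %| t.1)%Z by rewrite rpredD // dvdz_mulr.
  have /dvdzP[b bE] : ((primes_modulus P)%:Z %| t.2)%Z by rewrite rpredD // dvdz_mulr.
  rewrite (_ : elt m = elt (m.1 + t.1, m.2 + t.2) - elt (a, b) * (primes_modulus P)%:Z%:~R).
    by apply: ideal_sub; [exact: is_ideal_exp|rewrite tw|exact: pkA].
  rewrite mulrC elt_scale aE bE eltB /= [_ * a]mulrC [_ * b]mulrC.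
  by case: (m) => m1 m2 /=; congr elt; congr pair; ring.
have [ip _] := nz_primeW pp.
have [prp _] := pp.
(* If the large prime q divided Q, it would be one of the fresh primes and divide t + m' for an
   unwanted m'. As p contains t + m, it would contain m - m', against the choice of N0. *)
have cQ q' : prime q' -> p q'%:Z%:~R -> ~~ (q' %| Q)%N.
  move=> q'p pq'; have q'q : q' = q.
    by apply/eqP; rewrite eq_sym -dvdn_prime2 //; exact: prime_int_dvd pq pq'.
  rewrite q'q; apply/negP => qQ; case: (hQ _ qp qQ) => [|[N0q [m' m'X [q1 q2]]]].
    rewrite /primes_modulus Euclid_dvdX // => /andP[/(prime_dvd_fact qp)].
    by rewrite leqNgt Pq.
  have m'S : m' \in S by move: m'X; rewrite mem_filter => /andP[].
  have m'W : m' \notin W by move: m'X; rewrite mem_filter => /andP[].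
  have /dvdzP[a aE] : (q%:Z %| t.1 + m'.1)%Z by rewrite addrAC rpredD // dvdz_mulr //; exact: qQ.
  have /dvdzP[b bE] : (q%:Z %| t.2 + m'.2)%Z by rewrite addrAC rpredD // dvdz_mulr //; exact: qQ.
  have pd : p (elt (m.1 - m'.1, m.2 - m'.2)).
    rewrite (_ : elt _ = elt (m.1 + t.1, m.2 + t.2) - q%:Z%:~R * elt (a, b)).
      apply: ideal_sub => //; first by rewrite tw; exact: pkp.
      by rewrite mulrC; case: ip => _ _; apply.
    have E1 : q%:Z * a = t.1 + m'.1 by rewrite aE mulrC.
    have E2 : q%:Z * b = t.2 + m'.2 by rewrite bE mulrC.
    by rewrite elt_scale eltB E1 E2; congr elt; congr pair; rewrite /=; ring.
  have qn0 : qnorm (m.1 - m'.1, m.2 - m'.2) != 0.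
    apply/eqP => /qnorm_eq0[/eqP + /eqP]; rewrite !subr_eq0 => /eqP E1 /eqP E2.
    by move: m'W; rewrite (_ : m' = m) ?mW //; case: (m) (m') E1 E2 => ? ? [? ?] /= -> ->.
  have := ideal_norm_dvd (nz_primeW pp) pd => /(dvdn_trans qN) /dvdn_leq.
  rewrite absz_gt0 => /(_ qn0); rewrite leqNgt => /negP; apply.
  apply: leq_ltn_trans N0q; rewrite /N0 (big_rem m) //= (leq_trans _ (leq_maxl _ _)) //.
  by rewrite (big_rem m') //= leq_maxl.
apply: (hy _ mW); right; exists p; split=> //.
by apply: leq_trans Pq _; apply: dvdn_leq => //; apply: ideal_norm_gt0; exact: nz_primeW.
Qed.
(** This is [approximable] unfolded. U is the sieve by the primes over q <= P + 1, with P beyond the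
    thresholds of both the Euler product and the tail. A nonzero point of U outside V lies in p^k
    for a prime of norm above P1, so [sieve_tail] with Q = 1 bounds U \ V. *)
Lemma kfree_approx (e : R) : 0 < e -> exists (Q : nat) (U : set (int * int)),
  [/\ (0 < Q)%N, V `<=` U,
   (forall m s : int * int, U (m.1 + Q%:Z * s.1, m.2 + Q%:Z * s.2) <-> U m),
   (forall w : int * int, zetaR^-1 * Q%:R ^+ 2 <=
      (count_box Q [set m | U (m.1 + w.1, m.2 + w.2)])%:R <= (zetaR^-1 + e) * Q%:R ^+ 2) &
   exists M0, forall M (z : int * int), (M0 <= M)%N -> (`|z.1| <= M)%N -> (`|z.2| <= M)%N ->
     (count_box M [set y | U (y.1 + z.1, y.2 + z.2) /\ ~ V (y.1 + z.1, y.2 + z.2)])%:R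
     <= e * M%:R ^+ 2].
Proof.
move=> e_gt0; have [P1 hP1] := sieve_tail e_gt0; have [P2 hP2] := euler_prod_le e_gt0.
pose P := maxn P1 P2.
have [F [FP _]] := exists_primes_upto P; have [uF Fp FPE] := FP.
have Fover p : p \in F -> exists q, [/\ prime q, (q <= P.+1)%N & p q%:Z%:~R].
  move=> pF; have [q [qp _ pq]] := nz_prime_over (Fp _ pF); exists q; split=> //.
  by rewrite -(FPE _ _ (Fp _ pF) qp pq).
pose Q := primes_modulus P.+1.
have FQ p x : p \in F -> ideal_exp p k (x * Q%:Z%:~R).
  by move=> pF; have [q [qp qP pq]] := Fover _ pF; exact: prime_modulus_mem (Fp _ pF) qp qP pq.
have Q_gt0 : (0 < Q)%N by exact: primes_modulus_gt0.
exists Q, (sieve F); split=> //.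
- by move=> m /kfree_ptsE[_ hm] p pF; apply: hm; exact: Fp.
- move=> m s; rewrite /sieve /= elt_lin mulrC; split=> h p pF pm; apply: (h p pF).
    by have [_ ED _] := is_ideal_exp p k; apply: ED => //; exact: FQ.
  rewrite -[elt m](addrK (elt s * Q%:Z%:~R)).
  by apply: ideal_sub; [exact: is_ideal_exp| |exact: FQ].
- move=> w; rewrite count_box_sieveT //; last by move=> p pF; rewrite -[_%:~R]mul1r; exact: FQ.
  have Q2_gt0 : 0 < Q%:R ^+ 2 :> R by rewrite exprn_gt0 ?ltr0n.
  rewrite [_ * euler_prod F]mulrC !ler_pM2r //.
  rewrite euler_prod_ge //=; apply: hP2 FP.
  by rewrite leqW // leq_maxr.
have [M0 hM0] := hP1 1%N isT; exists M0 => M z M0M z1 z2.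
apply: le_trans (hM0 M z M0M z1 z2); rewrite ler_nat.
(* An empty family turns the covering bound into monotonicity of [count_box]. *)
have := @count_box_cover _ M [set y | sieve F (y.1 + z.1, y.2 + z.2) /\ ~ V (y.1 + z.1, y.2 + z.2)]
  (sieve_bad P1 1 z) (fun=> set0) (Nil nat).
rewrite big_nil addn0; apply=> i j [/= sF nV]; left.
have mE : elt (z.1 + 1%:Z * i%:Z, z.2 + 1%:Z * j%:Z) = elt (i%:Z + z.1, j%:Z + z.2).
  by congr elt; congr pair; ring.
rewrite /sieve_bad /= mE; have [?|x0] := pselect (elt (i%:Z + z.1, j%:Z + z.2) = 0); [by left|right].
apply: contrapT => h; apply: nV; apply/kfree_ptsE; split=> // p pp pk.
apply: h; exists p; have [q [qp qN pq]] := nz_prime_over pp.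
have pF : p \notin F by apply/negP => /sF.
split=> //; last by move=> q' q'p _; rewrite dvdn1; case: q' q'p => [|[]].
have := FPE _ _ pp qp pq; rewrite (negPf pF) => /esym/negbT; rewrite -ltnNge => Pq.
apply: leq_trans (_ : (q <= _)%N); last by apply: dvdn_leq => //; apply: ideal_norm_gt0; exact: nz_primeW.
by apply: leq_trans Pq; rewrite ltnS leqW // leq_maxl.
Qed.
End ZetaProduct.
End QuadraticArithmetic.

(** * Lattice points in a disk *)

Section GaussCircle.
Variable R : realType.
Implicit Types (x h r e : R).

Definition circ x : R := Num.sqrt (1 - x ^+ 2).

(** The area under the unit quarter circle between 0 and x, as a closed primitive of [circ]. *)
Definition circ_area x : R := (asin x + x * circ x) / 2.

Lemma is_derive_circ_area x : -1 < x < 1 -> is_derive x 1 circ_area (circ x).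
Proof.
move=> xI; have x2 : 0 < 1 - x ^+ 2.
  by move/andP: xI => [h1 h2]; rewrite subr_gt0 expr2; nra.
have s_gt0 : 0 < circ x by rewrite sqrtr_gt0.
have s2 : circ x ^+ 2 = 1 - x ^+ 2 by rewrite sqr_sqrtr // ltW.
have dasin : is_derive x 1 asin (circ x)^-1 by exact: is_derive1_asin.
have dsub : is_derive x 1 (fun y => 1 - y ^+ 2) (- (2 * x)).
  apply: is_derive_eq; rewrite /GRing.scale /=; ring.
have dsqrt : is_derive (1 - x ^+ 2) 1 Num.sqrt (2 * circ x)^-1.
  exact: is_derive1_sqrt.
have dcirc : is_derive x 1 circ (- x / circ x).
  have := @is_derive1_comp _ Num.sqrt (fun y => 1 - y ^+ 2) x _ _ dsqrt dsub.
  have -> : (2 * circ x)^-1 * - (2 * x) = - x / circ x.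
    by field; rewrite gt_eqF.
  by [].
have -> : circ_area = (2^-1 : R) \*: (asin + (@id R * circ)).
  by apply/funext => y; rewrite /circ_area /= mulrC.
apply: is_derive_eq (is_deriveZ 2^-1 (is_deriveD dasin (is_deriveM (is_derive_id x 1) dcirc))) _.
rewrite /GRing.scale /=.
have -> : x * (- x / circ x) = (circ x ^+ 2 - 1) / circ x.
  by rewrite s2 expr2; field; rewrite gt_eqF.
by field; rewrite gt_eqF.
Qed.

Lemma circ_decr x y : 0 <= x -> x <= y -> circ y <= circ x.
Proof.
by move=> x0 xy; rewrite ler_wsqrtr // lerD2l lerN2 lerXn2r // nnegrE (le_trans x0).
Qed.

Lemma circ_area_step x h : 0 <= x -> 0 < h -> x + h < 1 ->
  h * circ (x + h) <= circ_area (x + h) - circ_area x <= h * circ x.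
Proof.
move=> x0 h0 xh.
have sub z : x <= z -> z <= x + h -> -1 < z < 1.
  by move=> xz zx; apply/andP; split; lra.
have [|||c] := @MVT R circ_area circ x (x + h).
- by rewrite ltrDl.
- by move=> z; rewrite in_itv /= => /andP[xz zx]; apply/is_derive_circ_area/sub; exact: ltW.
- apply: derivable_within_continuous => z; rewrite in_itv /= => /andP[xz zx].
  by have [] := is_derive_circ_area (sub _ xz zx).
rewrite in_itv /= => /andP[xc cx] ->; rewrite (_ : x + h - x = h); last by ring.
rewrite [circ c * h]mulrC.
by rewrite !ler_pM2l // !circ_decr // ?ltW //; lra.
Qed.

Lemma circ_area0 : circ_area 0 = 0.
Proof. rewrite /circ_area mul0r addr0 -{1}sin0 sinK ?mul0r // in_itv /=.
by rewrite oppr_le0 !divr_ge0 // pi_ge0. Qed.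

(** Lower and upper Riemann sums of a decreasing function. The strict bound keeps the nodes inside
    ]-1, 1[, where asin is differentiable. *)
Lemma circ_area_sum h n : 0 < h -> n%:R * h < 1 ->
  h * (\sum_(1 <= a < n.+1) circ (a%:R * h)) <= circ_area (n%:R * h)
  <= h * (\sum_(0 <= a < n) circ (a%:R * h)).
Proof.
move=> h0; elim: n => [|n IH] nh.
  by rewrite !big_geq // mulr0 mul0r circ_area0 lexx.
have nh_ge0 : 0 <= n%:R * h by rewrite mulr_ge0 // ltW.
have nS : n.+1%:R * h = n%:R * h + h by rewrite -natr1 mulrDl mul1r.
have nh1 : n%:R * h + h < 1 by rewrite -nS.
have nh' : n%:R * h < 1 by lra.
have /andP[IH1 IH2] := IH nh'.
have /andP[s1 s2] := circ_area_step nh_ge0 h0 nh1.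
have E1 : \sum_(1 <= a < n.+2) circ (a%:R * h) =
    \sum_(1 <= a < n.+1) circ (a%:R * h) + circ (n.+1%:R * h) by rewrite big_nat_recr.
have E2 : \sum_(0 <= a < n.+1) circ (a%:R * h) =
    \sum_(0 <= a < n) circ (a%:R * h) + circ (n%:R * h) by rewrite big_nat_recr.
rewrite E1 E2 nS !mulrDr; apply/andP; split; lra.
Qed.

Lemma sum_ord_lt (m K : nat) : (\sum_(b < K) (b < m))%N = minn m K.
Proof.
elim: K => [|K IH]; first by rewrite big_ord0 minn0.
by rewrite big_ord_recr /= IH; case: ltnP => h; rewrite /= ?addn1 ?addn0; lia.
Qed.

Lemma column_le (K : nat) x : 0 <= x -> (\sum_(b < K) (b%:R < x)%R)%N%:R <= x + 1.
Proof.
move=> x0; have /andP[t1 t2] := truncn_itv x0.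
apply: le_trans (_ : (\sum_(b < K) (b < (Num.truncn x).+1))%N%:R <= _).
  rewrite ler_nat; apply: leq_sum => b _; case: (ltP b%:R x) => // bx.
  by rewrite -(ltr_nat R) (lt_trans bx t2).
by rewrite sum_ord_lt; apply: le_trans (_ : (Num.truncn x).+1%:R <= _);
  [rewrite ler_nat geq_minl|rewrite -natr1 lerD2r].
Qed.

(** One unit is lost to truncation and one to the excluded point b = 0. *)
Lemma column_ge (K : nat) x : 0 <= x -> x <= K%:R ->
  x - 2 <= (\sum_(b < K) ((0 < b)%N && (b%:R < x)%R))%N%:R.
Proof.
move=> x0 xK; have /andP[t1 t2] := truncn_itv x0.
have tK : (Num.truncn x <= K)%N by rewrite -(ler_nat R) (le_trans t1).
apply: le_trans (_ : (Num.truncn x - 1)%N%:R <= _).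
  have : (Num.truncn x)%:R <= (Num.truncn x - 1)%N%:R + 1 :> R by rewrite natr1 ler_nat; lia.
  by move: t2; rewrite -natr1; lra.
rewrite ler_nat -[X in (_ - 1 <= X)%N]addn0 leq_subLR.
apply: (@leq_trans (\sum_(b < K) (b < Num.truncn x))%N); first by rewrite sum_ord_lt; lia.
apply: (@leq_trans (\sum_(b < K) ((0 < b)%N && (b%:R < x)%R) + \sum_(b < K) (b < 1))%N); last first.
  by rewrite addn0 addnC leq_add2r sum_ord_lt geq_minl.
rewrite -big_split /=; apply: leq_sum => b _; case: ltnP => // bt.
have -> : b%:R < x by apply: lt_le_trans t1; rewrite ltr_nat.
by case: (nat_of_ord b).
Qed.

Lemma mem_disk_sub r (m : int * int) (K : nat) : 0 <= r -> r <= K%:R -> disk r m ->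
  (`|m.1| < K)%N /\ (`|m.2| < K)%N.
Proof.
move=> r0 rK; rewrite /disk /= => hm.
suff h (x : int) : x%:~R ^+ 2 < r ^+ 2 -> (`|x| < K)%N.
  split; apply: h; apply: le_lt_trans hm; rewrite ?lerDl ?lerDr; exact: sqr_ge0.
move=> xr; rewrite -(ltr_nat R); apply: lt_le_trans rK.
rewrite -[_%:R]/(`|x|%N%:~R) abszE intr_norm -(ltr_pXn2r (n := 2)) ?nnegrE //.
by rewrite real_normK ?num_real.
Qed.

Lemma finite_disk r : finite_set (disk r).
Proof.
have [K hK] : exists K : nat, `|r| <= K%:R.
  by exists (Num.truncn `|r|).+1; apply: ltW; exact: truncnS_gt.
pose f (ij : ('I_K * 'I_K) * (bool * bool)) : int * int :=
  ((-1) ^+ ij.2.1 * ij.1.1%:Z, (-1) ^+ ij.2.2 * ij.1.2%:Z).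
apply: (@sub_finite_set _ _ (f @` setT)); last by apply: finite_image; exact: finite_finset.
move=> m hm; have hm' : disk `|r| m by move: hm; rewrite /disk /= real_normK ?num_real.
have [m1 m2] := mem_disk_sub (normr_ge0 r) hK hm'.
exists ((Ordinal m1, Ordinal m2), (m.1 < 0, m.2 < 0)) => //.
by rewrite /f /= -!intEsign; case: (m).
Qed.

(* The four sign choices fold the disk onto the quadrant N x N. *)
Lemma card_disk_le r (K : nat) : 0 <= r -> r <= K%:R ->
  (#|` fset_set (disk r)| <= 4 * \sum_(a < K) \sum_(b < K)
     ((a%:R ^+ 2 + b%:R ^+ 2 < r ^+ 2)%R))%N.
Proof.
move=> r0 rK; rewrite pair_bigA /=.
pose S := [set ij : 'I_K * 'I_K | ij.1%:R ^+ 2 + ij.2%:R ^+ 2 < r ^+ 2]%SET.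
have -> : (\sum_(p : 'I_K * 'I_K) (p.1%:R ^+ 2 + p.2%:R ^+ 2 < r ^+ 2)%R)%N = #|S|.
  rewrite -sum1_card [RHS]big_mkcond; apply: eq_bigr => ij _.
  by rewrite finset.in_set; case: ifP.
pose f (ij : ('I_K * 'I_K) * (bool * bool)) : int * int :=
  ((-1) ^+ ij.2.1 * ij.1.1%:Z, (-1) ^+ ij.2.2 * ij.1.2%:Z).
have -> : (4 * #|S|)%N = #|finset.setX S [set: bool * bool]%SET|.
  by rewrite cardsX cardsT card_prod card_bool mulnC.
rewrite cardE -(size_map f); apply: uniq_leq_size; first exact: fset_uniq.
move=> m; rewrite in_fset_set; last exact: finite_disk.
rewrite inE => hm; have [m1 m2] := mem_disk_sub r0 rK hm.
apply/mapP; exists ((Ordinal m1, Ordinal m2), (m.1 < 0, m.2 < 0)); last first.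
  by rewrite /f /= -!intEsign; case: (m).
rewrite mem_enum finset.in_setX finset.in_setT andbT finset.in_set /=.
by rewrite !natr_absz !intr_norm !real_normK ?num_real.
Qed.

(** Off the axes the four sign choices are injective; the O(r) points on the axes are given up. *)
Lemma card_disk_ge r (K : nat) :
  (4 * \sum_(a < K) \sum_(b < K)
     ([&& 0 < a, 0 < b & (a%:R ^+ 2 + b%:R ^+ 2 < r ^+ 2)%R]) <= #|` fset_set (disk r)|)%N.
Proof.
rewrite pair_bigA /=.
pose S := [set ij : 'I_K * 'I_K | [&& (0 < ij.1)%N, (0 < ij.2)%N &
   ij.1%:R ^+ 2 + ij.2%:R ^+ 2 < r ^+ 2]]%SET.
have -> : (\sum_(p : 'I_K * 'I_K) ([&& 0 < p.1, 0 < p.2 &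
    (p.1%:R ^+ 2 + p.2%:R ^+ 2 < r ^+ 2)%R]))%N = #|S|.
  rewrite -sum1_card [RHS]big_mkcond; apply: eq_bigr => ij _.
  by rewrite finset.in_set; case: ifP.
pose f (ij : ('I_K * 'I_K) * (bool * bool)) : int * int :=
  ((-1) ^+ ij.2.1 * ij.1.1%:Z, (-1) ^+ ij.2.2 * ij.1.2%:Z).
have -> : (4 * #|S|)%N = #|finset.setX S [set: bool * bool]%SET|.
  by rewrite cardsX cardsT card_prod card_bool mulnC.
rewrite cardE -(size_map f); apply: uniq_leq_size.
  rewrite map_inj_in_uniq ?enum_uniq // => -[[i j] [s t]] [[i' j'] [s' t']].
  rewrite !mem_enum !finset.in_setX !finset.in_setT !finset.in_set !andbT /=.
  move=> /and3P[i0 j0 _] /and3P[i0' j0' _].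
  have sg (b b' : bool) (x y : nat) : (0 < x)%N -> (0 < y)%N ->
      (-1) ^+ b * x%:Z = (-1) ^+ b' * y%:Z -> b = b' /\ x = y.
    by case: b b' => [] []; rewrite ?expr0 ?expr1 => x0 y0 E; split=> //; lia.
  move=> [/(sg _ _ _ _ i0 i0')[-> ii] /(sg _ _ _ _ j0 j0')[-> jj]].
  by congr ((_, _), _); apply: val_inj.
move=> _ /mapP[[[i j] [s t]] + ->].
rewrite mem_enum finset.in_setX finset.in_setT andbT finset.in_set /= => /and3P[_ _ hij].
rewrite in_fset_set; last exact: finite_disk.
by rewrite inE /disk /= !rmorphM !exprMn !rmorph_sign !sqrr_sign !mul1r.
Qed.

Lemma ltr_sqrt_sub (x y : R) : 0 <= y -> (y ^+ 2 < x) = (y < Num.sqrt x).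
Proof.
move=> y0; have [x0|x0] := ltP 0 x.
  rewrite -[in LHS](sqr_sqrtr (ltW x0)) ltr_pXn2r // nnegrE ?sqrtr_ge0 //.
rewrite ler0_sqrtr // !ltNge y0; apply/negbTE; rewrite negbK.
by rewrite (le_trans x0) ?sqr_ge0.
Qed.

(** In one quadrant, column a holds sqrt (r^2 - a^2) points up to an error of 2, and the end terms
    of the Riemann sums cost at most r. With at most n + 1 columns, the four quadrants stay within
    12 r. *)
Lemma sum_circ_bounds r n : (0 < n)%N -> n%:R < r -> r <= n.+1%:R ->
  4 * r ^+ 2 * circ_area (n%:R / r) - 12 * r <= #|` fset_set (disk r)|%:R
  <= 4 * r ^+ 2 * circ_area (n%:R / r) + 12 * r.
Proof.
move=> n0 nr rn; have n_ge1 : 1 <= n%:R :> R by rewrite ler1n.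
have r0 : 0 < r by lra.
have ri0 : 0 < r^-1 by rewrite invr_gt0.
have nri : n%:R * r^-1 < 1 by rewrite ltr_pdivrMr // mul1r.
have /andP[B1 B2] := circ_area_sum ri0 nri.
pose rho (a : nat) := Num.sqrt (r ^+ 2 - a%:R ^+ 2).
have rhoE a : rho a = r * circ (a%:R * r^-1).
  rewrite /rho /circ -{2}[r]gtr0_norm // -sqrtr_sqr -sqrtrM ?sqr_ge0 //.
  by congr Num.sqrt; field; rewrite gt_eqF.
have rho_ge0 a : 0 <= rho a by exact: sqrtr_ge0.
have rho_le a : rho a <= r.
  rewrite -[leRHS]gtr0_norm // -sqrtr_sqr ler_wsqrtr // gerBl; exact: sqr_ge0.
have sumE (i j : nat) : \sum_(i <= a < j) rho a = r ^+ 2 * (r^-1 * \sum_(i <= a < j) circ (a%:R * r^-1)).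
  rewrite mulrA expr2 mulfK ?gt_eqF // mulr_sumr.
  by apply: eq_bigr => a _; exact: rhoE.
have S1 : \sum_(1 <= a < n.+1) rho a <= r ^+ 2 * circ_area (n%:R / r).
  by rewrite sumE ler_pM2l // exprn_gt0.
have S2 : r ^+ 2 * circ_area (n%:R / r) <= \sum_(0 <= a < n) rho a.
  by rewrite sumE ler_pM2l // exprn_gt0.
have S2' : \sum_(0 <= a < n) rho a = rho 0%N + \sum_(1 <= a < n) rho a by rewrite big_ltn.
have S1' : \sum_(1 <= a < n.+1) rho a = \sum_(1 <= a < n) rho a + rho n by rewrite big_nat_recr.
have h0 := rho_le 0%N; have hn := rho_ge0 n.
have subE (a b : nat) : (a%:R ^+ 2 + b%:R ^+ 2 < r ^+ 2) = (b%:R < rho a).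
  by rewrite /rho -ltr_sqrt_sub // ltrBrDl.
have sum_const (c : R) : \sum_(1 <= a < n.+1) c = n%:R * c.
  by rewrite big_const_nat iter_addr addr0 subSS subn0 mulr_natl.
apply/andP; split.
  have := card_disk_ge r n.+1; rewrite -(ler_nat R); apply: le_trans.
  rewrite natrM -(big_mkord xpredT (fun a => \sum_(b < n.+1)
    ([&& 0 < a, 0 < b & (a%:R ^+ 2 + b%:R ^+ 2 < r ^+ 2)%R]))%N).
  rewrite big_ltn // big1 // add0n natr_sum.
  have : \sum_(1 <= a < n.+1) (rho a - 2) <= \sum_(1 <= a < n.+1)
      (\sum_(b < n.+1) [&& 0 < a, 0 < b & (a%:R ^+ 2 + b%:R ^+ 2 < r ^+ 2)%R])%N%:R.
    rewrite !big_nat; apply: ler_sum => a /andP[a0 _].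
    have := column_ge (rho_ge0 a) (le_trans (rho_le a) rn); rewrite a0 /=.
    by under eq_bigr do rewrite -subE.
  rewrite big_split /= sum_const; lra.
have := card_disk_le (ltW r0) rn; rewrite -(ler_nat R) => /le_trans; apply.
rewrite natrM -(big_mkord xpredT (fun a => \sum_(b < n.+1)
    (a%:R ^+ 2 + b%:R ^+ 2 < r ^+ 2)%R)%N).
rewrite natr_sum big_ltn //.
have hcol (a : nat) : (\sum_(b < n.+1) (a%:R ^+ 2 + b%:R ^+ 2 < r ^+ 2)%R)%N%:R <= rho a + 1.
  by under eq_bigr do rewrite subE; exact: column_le.
have : \sum_(1 <= a < n.+1) (\sum_(b < n.+1) (a%:R ^+ 2 + b%:R ^+ 2 < r ^+ 2)%R)%N%:R
    <= \sum_(1 <= a < n.+1) (rho a + 1) by apply: ler_sum => a _; exact: hcol.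
rewrite big_split /= sum_const; have := hcol 0%N; lra.
Qed.

Lemma circ_area_le x : 0 <= x -> x <= 1 -> circ_area x <= pi / 4 + circ x / 2.
Proof.
move=> x0 x1; have : asin x <= pi / 2 by rewrite asin_lepi2 // x1 andbT; lra.
have : x * circ x <= circ x by rewrite ler_piMl // sqrtr_ge0.
rewrite /circ_area; lra.
Qed.

(* sin (pi/2 - e) < 1, and asin is increasing. *)
Lemma circ_area_ge e : 0 < e -> exists2 d : R, 0 < d &
  forall x, 0 <= x -> 1 - d <= x -> x <= 1 -> pi / 4 - e <= circ_area x.
Proof.
move=> e0; have pi0 := pi_gt0 R.
pose t := Num.max (pi / 2 - e) 0.
have t_lt : t < pi / 2 by rewrite /t gt_max divr_gt0 // andbT; lra.
have t_ge0 : 0 <= t by rewrite /t le_max lexx orbT.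
have tE : pi / 2 - e <= t by rewrite /t le_max lexx.
exists (1 - sin t).
  rewrite subr_gt0 -sin_pihalf ltr_sin // in_itv /=; apply/andP; split; lra.
move=> x x0; rewrite opprB addrC subrK => tx x1.
have xI : -1 <= x <= 1 by apply/andP; split; lra.
have : t <= asin x.
  rewrite leNgt -ltr_sin.
  - by rewrite asinK ?in_itv //= ltNge tx.
  - by rewrite in_itv /= asin_geNpi2 // asin_lepi2.
  - by rewrite in_itv /=; apply/andP; split; lra.
have : 0 <= x * circ x by rewrite mulr_ge0 // sqrtr_ge0.
rewrite /circ_area; lra.
Qed.

Lemma gauss_circle e : 0 < e -> exists2 r0 : R, 0 < r0 & forall r, r0 <= r ->
  (pi - e) * r ^+ 2 <= #|` fset_set (disk r)|%:R <= (pi + e) * r ^+ 2.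
Proof.
move=> e0; have [|d d0 hd] := circ_area_ge (_ : 0 < e / 8); first by rewrite divr_gt0.
(* The summands serve in turn to absorb the error 12 r, to have n > 0, to bring n / r within d of 1,
   and to make [circ] (n / r), at most sqrt (2 / r), no larger than e / 8. *)
exists (24 / e + 2 + d^-1 + 128 / e ^+ 2).
  by rewrite !addr_gt0 ?divr_gt0 ?invr_gt0 ?exprn_gt0.
move=> r hr.
have p1 : 0 < 24 / e by rewrite divr_gt0.
have p2 : 0 < d^-1 by rewrite invr_gt0.
have p3 : 0 < 128 / e ^+ 2 by rewrite divr_gt0 ?exprn_gt0.
have r2 : 2 < r by lra.
have r0 : 0 < r by lra.
have [n [n0 nr rn]] : exists n : nat, [/\ (0 < n)%N, n%:R < r & r <= n.+1%:R].
  have ex : exists n : nat, r <= n.+1%:R.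
    by exists (Num.truncn r); apply: ltW; exact: truncnS_gt.
  have [n hn n_min] := ex_minnP ex; exists n.
  have n0 : (0 < n)%N by case: n hn {n_min} => // h1; have := lt_le_trans r2 h1; rewrite ltr_nat.
  split=> //; rewrite ltNge; apply/negP => rn; have := n_min n.-1.
  by rewrite prednK // => /(_ rn); rewrite -ltnS prednK // ltnn.
have /andP[B1 B2] := sum_circ_bounds n0 nr rn.
have x0 : 0 <= n%:R / r by rewrite divr_ge0 // ltW.
have x1 : n%:R / r <= 1 by rewrite ler_pdivrMr // mul1r ltW.
have rr : 24 * r <= e * r ^+ 2.
  rewrite expr2 mulrA ler_pM2r // mulrC -ler_pdivrMr //; lra.
have r20 : 0 < r ^+ 2 by rewrite exprn_gt0.
have xd : 1 - r^-1 <= n%:R / r.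
  by rewrite ler_pdivlMr // mulrBl mul1r mulVf ?gt_eqF // lerBlDr natr1.
have rd : r^-1 <= d by rewrite invf_ple ?posrE //; lra.
have A1 := hd _ x0 (le_trans (lerB (lexx 1) rd) xd) x1.
have A2 := circ_area_le x0 x1.
have c_le : circ (n%:R / r) <= e / 8.
  rewrite -[leRHS]gtr0_norm ?divr_gt0 // -sqrtr_sqr ler_wsqrtr //.
  have h1 : 128 <= e ^+ 2 * r by rewrite mulrC -ler_pdivrMr ?exprn_gt0 //; lra.
  have h2 : 1 - (n%:R / r) ^+ 2 <= 2 * r^-1.
    have := sqr_ge0 (1 - n%:R / r); move: xd x0; set x := _ / r; rewrite !expr2; nra.
  apply: le_trans h2 _; rewrite ler_pdivrMr //; lra.
have C1 : 4 * r ^+ 2 * (pi / 4 - e / 8) <= 4 * r ^+ 2 * circ_area (n%:R / r).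
  by rewrite ler_pM2l // mulr_gt0.
have C2 : 4 * r ^+ 2 * circ_area (n%:R / r) <= 4 * r ^+ 2 * (pi / 4 + e / 16).
  by rewrite ler_pM2l ?mulr_gt0 //; lra.
apply/andP; split; nra.
Qed.

End GaussCircle.

(** * Counting points and patterns by tilings of Z^2 *)

Definition shift (B : set (int * int)) (c : int * int) : set (int * int) :=
  [set m | B (m.1 + c.1, m.2 + c.2)].

(* V lies in a periodic set U whose points have density between D and D + e
   in every square of side Q, and U \ V has density at most e. *)
Definition approximable (R : realType) (V : set (int * int)) (D : R) : Prop :=
  forall e : R, 0 < e -> exists (Q : nat) (U : set (int * int)),
  [/\ (0 < Q)%N, V `<=` U,
   (forall m s : int * int, U (m.1 + Q%:Z * s.1, m.2 + Q%:Z * s.2) <-> U m),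
   (forall w, D * Q%:R ^+ 2 <= (count_box Q (shift U w))%:R <= (D + e) * Q%:R ^+ 2) &
   exists M0, forall M (z : int * int), (M0 <= M)%N -> (`|z.1| <= M)%N -> (`|z.2| <= M)%N ->
     (count_box M (shift [set m | U m /\ ~ V m] z))%:R <= e * M%:R ^+ 2].

(** Heredity of the shift space in finite form: within any window, every finite part of V is what
    some translate of V shows. *)
Definition hereditary (V : set (int * int)) : Prop :=
  forall S W : seq (int * int), (forall w, w \in W -> V w) ->
  exists t : int * int, forall m, m \in S -> V (m.1 + t.1, m.2 + t.2) <-> m \in W.

Section SievedSets.
Variables (V : set (int * int)).
Local Notation pt := (int * int)%type.
Implicit Types (E T : {fset pt}) (U B : set pt) (Q : nat).

Definition cnt B E : nat := count (fun m => `[< B m >]) E.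

Definition tile Q (m : pt) : pt := ((m.1 %/ Q%:Z)%Z, (m.2 %/ Q%:Z)%Z).

Lemma cnt_fset B E : cnt B E = #|` [fset m in E | `[< B m >]]|%fset.
Proof.
rewrite /cnt -size_filter; apply: perm_size; apply: uniq_perm.
- by apply: filter_uniq; exact: fset_uniq.
- exact: fset_uniq.
- by move=> m; rewrite mem_filter !inE andbC.
Qed.

Lemma cnt_sub B B' E : (forall m, m \in E -> B m -> B' m) -> (cnt B E <= cnt B' E)%N.
Proof.
move=> h; rewrite !cnt_fset; apply: fsubset_leq_card; apply/fsubsetP => m.
by rewrite !inE => /andP[mE /asboolP Bm]; rewrite mE; apply/asboolP; exact: h.
Qed.

Lemma cnt_subset B E E' : {subset E <= E'} -> (cnt B E <= cnt B E')%N.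
Proof.
move=> EE'; rewrite !cnt_fset; apply: fsubset_leq_card; apply/fsubsetP => m.
by rewrite !inE => /andP[/EE' -> ->].
Qed.

Lemma sum_cnt_fiber (f : pt -> pt) B E T :
  (\sum_(v <- T) cnt [set m | B m /\ f m = v] E)%N = cnt [set m | B m /\ f m \in T] E.
Proof.
rewrite /cnt; under eq_bigr do rewrite -sum1_count big_mkcond.
rewrite exchange_big /= -sum1_count [RHS]big_mkcond /=.
apply: eq_bigr => m _; case: asboolP => [[Bm fT]|h].
  rewrite (big_fsetD1 (f m)) //= asboolT // big1_fset ?addn0 // => v.
  by rewrite !inE => /andP[/eqP vf _] _; rewrite asboolF // => -[_ E']; rewrite E' in vf.
rewrite big1_fset // => v vT _; rewrite asboolF // => -[Bm fv]; apply: h.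
by rewrite fv.
Qed.

Lemma tileP Q (m v : pt) : (0 < Q)%N -> tile Q m = v <->
  exists i j : nat, [/\ (i < Q)%N, (j < Q)%N & m = (i%:Z + Q%:Z * v.1, j%:Z + Q%:Z * v.2)].
Proof.
move=> Q_gt0; have Q_neq0 : Q%:Z != 0 by rewrite eqz_nat -lt0n.
split=> [<-|[i [j [iQ jQ ->]]]].
  have h (x : int) : exists2 i : nat, (i < Q)%N & x = i%:Z + Q%:Z * (x %/ Q%:Z)%Z.
    have x_ge0 := modz_ge0 x Q_neq0; have x_lt := ltz_pmod x (Q_gt0 : 0 < Q%:Z).
    exists `|(x %% Q%:Z)%Z|%N; first by lia.
    by rewrite gez0_abs // addrC mulrC -divz_eq.
  have [i iQ iE] := h m.1; have [j jQ jE] := h m.2.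
  by exists i, j; split=> //; rewrite /tile /= -iE -jE; case: (m).
rewrite /tile; case: v => v1 v2 /=; congr pair.
  by rewrite [Q%:Z * _]mulrC divzDr ?dvdz_mull // mulzK // divz_small ?add0r //; lia.
by rewrite [Q%:Z * _]mulrC divzDr ?dvdz_mull // mulzK // divz_small ?add0r //; lia.
Qed.

Lemma cnt_tile_le Q B E (v : pt) : (0 < Q)%N ->
  (cnt [set m | B m /\ tile Q m = v] E <= count_box Q (shift B (Q%:Z * v.1, Q%:Z * v.2)%R))%N.
Proof.
move=> Q_gt0; rewrite count_box_card cnt_fset cardE.
pose f (ij : 'I_Q * 'I_Q) : pt := (ij.1%:Z + Q%:Z * v.1, ij.2%:Z + Q%:Z * v.2).
rewrite -(size_map f); apply: uniq_leq_size; first exact: fset_uniq.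
move=> m; rewrite !inE => /andP[_ /asboolP[Bm /(tileP _ _ Q_gt0)[i [j [iQ jQ mE]]]]].
apply/mapP; exists (Ordinal iQ, Ordinal jQ); last by rewrite mE.
by rewrite mem_enum finset.in_set; apply/asboolP; rewrite /shift /= -mE.
Qed.

Lemma cnt_tile_ge Q B E (v : pt) : (0 < Q)%N -> (forall m, tile Q m = v -> m \in E) ->
  (count_box Q (shift B (Q%:Z * v.1, Q%:Z * v.2)%R) <= cnt [set m | B m /\ tile Q m = v] E)%N.
Proof.
move=> Q_gt0 vE; rewrite count_box_card cnt_fset cardE.
pose f (ij : 'I_Q * 'I_Q) : pt := (ij.1%:Z + Q%:Z * v.1, ij.2%:Z + Q%:Z * v.2).
rewrite -(size_map f); apply: uniq_leq_size.
  rewrite map_inj_in_uniq ?enum_uniq // => -[i j] [i' j'] _ _ [/addIr[ii] /addIr[jj]].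
  by congr pair; apply: val_inj.
move=> _ /mapP[[i j] + ->]; rewrite mem_enum finset.in_set => /asboolP hB.
have tE : tile Q (f (i, j)) = v by apply/(tileP _ _ Q_gt0); exists i, j.
by rewrite !inE vE //=; apply/asboolP; split.
Qed.

Lemma shiftA B (c c' : pt) : shift (shift B c) c' = shift B (c'.1 + c.1, c'.2 + c.2).
Proof. by apply/seteqP; split=> m; rewrite /shift /= !addrA. Qed.

(** T contains the index of every tile meeting E; in [cnt_tiling_ge] the tiles of T lie inside E
    instead. *)
Lemma cnt_tiling_le (R : realType) (b : R) Q B E T : (0 < Q)%N ->
  (forall w, (count_box Q (shift B w))%:R <= b) -> (forall m, m \in E -> tile Q m \in T) ->
  (cnt B E)%:R <= b * #|` T|%:R.
Proof.
move=> Q_gt0 hb hT; apply: le_trans (_ : (cnt [set m | B m /\ tile Q m \in T] E)%:R <= _).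
  by rewrite ler_nat; apply: cnt_sub => m mE Bm; split=> //; exact: hT.
rewrite -sum_cnt_fiber natr_sum mulrC mulr_natl card_fset_sum1 -sumrMnr.
apply: ler_sum => v _; rewrite mulr1n; apply: le_trans (hb (Q%:Z * v.1, Q%:Z * v.2)).
by rewrite ler_nat; exact: cnt_tile_le.
Qed.

Lemma cnt_tiling_ge (R : realType) (b : R) Q B E T : (0 < Q)%N ->
  (forall w, b <= (count_box Q (shift B w))%:R) ->
  (forall v m, v \in T -> tile Q m = v -> m \in E) ->
  b * #|` T|%:R <= (cnt B E)%:R.
Proof.
move=> Q_gt0 hb hT; apply: le_trans (_ : (cnt [set m | B m /\ tile Q m \in T] E)%:R <= _); last first.
  by rewrite ler_nat; apply: cnt_sub => m mE [].
rewrite -sum_cnt_fiber natr_sum mulrC mulr_natl card_fset_sum1 -sumrMnr !big_seq.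
apply: ler_sum => v vT; rewrite mulr1n; apply: le_trans (hb (Q%:Z * v.1, Q%:Z * v.2)) _.
by rewrite ler_nat; apply: cnt_tile_ge => // m; exact: hT.
Qed.

(** * Patterns in finite windows *)

Definition patt (t : pt) E : {fset pt} := [fset m in E | `[< shift V t m >]]%fset.

Definition patterns E : {fset {fset pt}} :=
  [fset W in fpowerset E | `[< exists t, W = patt t E >]]%fset.

Lemma patternsP W E : reflect (exists t, W = patt t E) (W \in patterns E).
Proof.
rewrite !inE; apply: (iffP andP) => [[_ /asboolP//]|[t ->]].
split; last by apply/asboolP; exists t.
by rewrite fpowersetE; apply/fsubsetP => m; rewrite !inE => /andP[].
Qed.

Lemma patterns_gt0 E : (0 < #|` patterns E|)%N.
Proof. by rewrite cardfs_gt0; apply/fset0Pn; exists (patt 0 E); apply/patternsP; exists 0. Qed.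

Lemma patterns_ge E : hereditary V -> (2 ^ cnt V E <= #|` patterns E|)%N.
Proof.
move=> hered; rewrite cnt_fset -card_fpowerset; apply: fsubset_leq_card.
apply/fsubsetP => W; rewrite fpowersetE => /fsubsetP WV; apply/patternsP.
have [w wW|t ht] := hered (E : seq pt) (W : seq pt).
  by have := WV w wW; rewrite !inE => /andP[_ /asboolP].
exists t; apply/fsetP => m; rewrite !inE; apply/idP/andP => [mW|[mE /asboolP]].
  have := WV m mW; rewrite !inE => /andP[mE _]; split=> //.
  exact: (ht m mE).2 mW.
by move=> Vm; exact: (ht m mE).1 Vm.
Qed.

(** The pattern at t is a subset of the translate of U by t, which depends only on t modulo Q: there
    are Q^2 translates, each with at most 2^b subsets in E. *)
Lemma patterns_le Q U E (b : nat) : (0 < Q)%N -> V `<=` U ->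
  (forall m s : pt, U (m.1 + Q%:Z * s.1, m.2 + Q%:Z * s.2) <-> U m) ->
  (forall c, (cnt (shift U c) E <= b)%N) -> (#|` patterns E| <= Q ^ 2 * 2 ^ b)%N.
Proof.
move=> Q_gt0 VU perU hb.
pose c (ij : 'I_Q * 'I_Q) : pt := (ij.1%:Z, ij.2%:Z).
pose Ec ij : {fset pt} := [fset m in E | `[< shift U (c ij) m >]]%fset.
pose L := flatten [seq enum_fset (fpowerset (Ec ij)) | ij <- enum {: 'I_Q * 'I_Q}].
apply: (@leq_trans (size L)).
  apply: uniq_leq_size; first exact: fset_uniq.
  move=> W /patternsP[t ->]; apply/flattenP.
  have [i [j [iQ jQ tE]]] := (tileP t (tile Q t) Q_gt0).1 erefl.
  exists (enum_fset (fpowerset (Ec (Ordinal iQ, Ordinal jQ)))).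
    by apply/mapP; exists (Ordinal iQ, Ordinal jQ); rewrite ?mem_enum.
  rewrite -[_ \in _]/(_ \in fpowerset _) fpowersetE; apply/fsubsetP => m; rewrite !inE.
  move=> /andP[-> /asboolP /VU Um] /=; apply/asboolP.
  rewrite /shift /=; apply/(perU _ (tile Q t)) => /=; move: Um; rewrite {1 2}tE /=.
  by rewrite !addrA.
rewrite size_flatten /shape -map_comp sumnE big_map.
apply: leq_trans (_ : \sum_(ij <- enum {: 'I_Q * 'I_Q}) 2 ^ b <= _)%N.
  apply: leq_sum => ij _ /=; rewrite card_fpowerset leq_exp2l // -cnt_fset; exact: hb.
by rewrite big_const_seq count_predT iter_addn_0 -cardE card_prod card_ord mulnC expnS expn1.
Qed.
Definition boxset (a : pt) (n : nat) : {fset pt} :=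
  [fset m in [seq (a.1 + ij.1%:Z, a.2 + ij.2%:Z)%R | ij : 'I_n * 'I_n]]%fset.

Lemma mem_boxset (a : pt) (n : nat) (m : pt) : (m \in boxset a n) =
  [&& a.1 <= m.1, m.1 < a.1 + n%:Z, a.2 <= m.2 & m.2 < a.2 + n%:Z].
Proof.
rewrite inE /=; apply/mapP/and4P => [[[i j] _ ->] /=|[h1 h2 h3 h4]].
  by rewrite !lerDl !ltrD2l !ltz_nat !ltn_ord.
have i_lt : (`|(m.1 - a.1)%R| < n)%N by lia.
have j_lt : (`|(m.2 - a.2)%R| < n)%N by lia.
exists (Ordinal i_lt, Ordinal j_lt); rewrite ?mem_enum //=.
by case: m h1 h2 h3 h4 {i_lt j_lt} => m1 m2 /= *; congr pair; lia.
Qed.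

Lemma card_boxset a n : #|` boxset a n| = (n ^ 2)%N.
Proof.
rewrite card_fseq undup_id.
  by rewrite size_map -cardE card_prod card_ord expnS expn1.
rewrite map_inj_uniq ?enum_uniq // => -[i j] [i' j'] [/addrI[ii] /addrI[jj]].
by congr pair; apply: val_inj.
Qed.

Lemma cnt_boxset B a n : (cnt B (boxset a n) <= count_box n (shift B a))%N.
Proof.
rewrite count_box_card cnt_fset cardE.
pose f (ij : 'I_n * 'I_n) : pt := (a.1 + ij.1%:Z, a.2 + ij.2%:Z).
rewrite -(size_map f); apply: uniq_leq_size; first exact: fset_uniq.
move=> m; rewrite !inE => /andP[/mapP[ij _ ->] /asboolP Bm].
apply/mapP; exists ij => //.
by rewrite mem_enum finset.in_set; apply/asboolP; rewrite /shift /= ![_ + a.1]addrC ![_ + a.2]addrC.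
Qed.

(** An interval of n integers meets at most n %/ Q + 2 tiles, counting a partial one at either
    end. *)
Lemma tile_boxset_out Q a n m : (0 < Q)%N -> m \in boxset a n ->
  tile Q m \in boxset (tile Q a) (n %/ Q + 2).
Proof.
move=> Q_gt0; rewrite !mem_boxset => /and4P[a1 m1 a2 m2] /=.
have h (x y : int) : x <= y -> y < x + n%:Z ->
    (x %/ Q%:Z)%Z <= (y %/ Q%:Z)%Z < (x %/ Q%:Z)%Z + (n %/ Q + 2)%N%:Z.
  move=> xy yx; have Q_neq0 : Q%:Z != 0 by rewrite eqz_nat -lt0n.
  have Ex := divz_eq x Q%:Z; have Ey := divz_eq y Q%:Z.
  have x0 := modz_ge0 x Q_neq0; have y0 := modz_ge0 y Q_neq0.
  have x1 := ltz_pmod x (Q_gt0 : 0 < Q%:Z); have y1 := ltz_pmod y (Q_gt0 : 0 < Q%:Z).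
  have En := divn_eq n Q; have n1 := ltn_pmod n Q_gt0.
  set X := (x %/ Q%:Z)%Z in Ex *; set Y := (y %/ Q%:Z)%Z in Ey *.
  set N := (n %/ Q)%N in En *.
  move: (x %% Q%:Z)%Z (y %% Q%:Z)%Z (n %% Q)%N Ex Ey En x0 y0 x1 y1 n1.
  move=> rx ry rn Ex Ey En x0 y0 x1 y1 n1; apply/andP; split; nia.
have /andP[-> ->] := h _ _ a1 m1; have /andP[-> ->] := h _ _ a2 m2; by [].
Qed.

(** The tile of the corner may stick out, so the inner tiles start one further; the truncated
    difference makes the family empty when n < 2 Q. *)
Lemma tile_boxset_in Q a n v m : (0 < Q)%N ->
  v \in boxset ((tile Q a).1 + 1, (tile Q a).2 + 1) (n %/ Q - 1) ->
  tile Q m = v -> m \in boxset a n.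
Proof.
move=> Q_gt0; rewrite !mem_boxset => /and4P[/= a1 v1 a2 v2].
move=> /(tileP _ _ Q_gt0)[i [j [iQ jQ ->]]] /=.
have h (x w : int) (i0 : nat) : (i0 < Q)%N -> (x %/ Q%:Z)%Z + 1 <= w ->
    w < (x %/ Q%:Z)%Z + 1 + (n %/ Q - 1)%N%:Z -> x <= i0%:Z + Q%:Z * w < x + n%:Z.
  move=> i0Q w1 w2; have Q_neq0 : Q%:Z != 0 by rewrite eqz_nat -lt0n.
  have Ex := divz_eq x Q%:Z; have x0 := modz_ge0 x Q_neq0.
  have x1 := ltz_pmod x (Q_gt0 : 0 < Q%:Z).
  have En := divn_eq n Q.
  set X := (x %/ Q%:Z)%Z in Ex w1 w2; set N := (n %/ Q)%N in En w2.
  move: (x %% Q%:Z)%Z (n %% Q)%N Ex En x0 x1 => rx rn Ex En x0 x1.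
  apply/andP; split; nia.
have /andP[-> ->] := h _ _ _ iQ a1 v1; have /andP[-> ->] := h _ _ _ jQ a2 v2; by [].
Qed.

Lemma ln_patterns_le (R : realType) Q U E (b : R) : (0 < Q)%N -> V `<=` U ->
  (forall m s : pt, U (m.1 + Q%:Z * s.1, m.2 + Q%:Z * s.2) <-> U m) ->
  (forall c, (cnt (shift U c) E)%:R <= b) ->
  ln #|` patterns E|%:R <= 2 * ln Q%:R + ln 2 * b.
Proof.
move=> Q_gt0 VU perU hb; have b_ge0 : 0 <= b by apply: le_trans (hb 0).
have := @patterns_le Q U E (Num.truncn b) Q_gt0 VU perU _.
move=> /(_ (fun c => _)) h; apply: le_trans (_ : ln (Q ^ 2 * 2 ^ Num.truncn b)%:R <= _).
  rewrite ler_ln ?posrE ?ltr0n ?patterns_gt0 ?muln_gt0 ?expn_gt0 ?Q_gt0 //.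
  by rewrite ler_nat; apply: h => c; rewrite truncn_ge_nat.
rewrite natrM !natrX lnM ?posrE ?exprn_gt0 ?ltr0n // !lnXn ?ltr0n //.
rewrite -[_ *+ 2]mulr_natl -[_ *+ Num.truncn b]mulr_natr lerD2l.
by rewrite ler_wpM2l ?truncn_le // ltW // ln_gt0 // ltr1n.
Qed.

Lemma ln_patterns_ge (R : realType) E : hereditary V ->
  ln 2 * (cnt V E)%:R <= ln #|` patterns E|%:R :> R.
Proof.
move=> hered; apply: le_trans (_ : ln (2 ^ cnt V E)%:R <= _).
  by rewrite natrX lnXn // mulr_natr.
by rewrite ler_ln ?posrE ?ltr0n ?patterns_gt0 ?expn_gt0 // ler_nat patterns_ge.
Qed.

(** * Growth of counts and patterns in squares and disks *)

Section Asymptotics.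
Variables (R : realType) (D : R).
Hypothesis D_gt0 : 0 < D.
Hypotheses (V_approx : approximable V D) (V_hered : hereditary V).

Lemma sqr_shift_le (c e : R) : 0 <= c -> 0 < e -> exists2 x0, 0 < x0 &
  forall x, x0 <= x -> (x + c) ^+ 2 <= (1 + e) * x ^+ 2 /\ (1 - e) * x ^+ 2 <= (x - c) ^+ 2.
Proof.
move=> c_ge0 e_gt0; exists (3 * c / e + c + 1).
  have : 0 <= 3 * c / e by rewrite divr_ge0 ?mulr_ge0 // ltW.
  lra.
move=> x x_ge; have h0 : 0 <= 3 * c / e by rewrite divr_ge0 ?mulr_ge0 // ltW.
have h1 : 3 * c <= e * x.
  by rewrite [leRHS]mulrC -ler_pdivrMr //; lra.
have x_ge0 : 0 <= x by lra.
have h2 := ler_wpM2r x_ge0 h1.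
have h3 : c * c <= c * x by rewrite ler_wpM2l //; lra.
have cx : 0 <= c * x by rewrite mulr_ge0.
split; rewrite !expr2; nra.
Qed.

Lemma nat_ge_real (x : R) : exists n0 : nat, forall n, (n0 <= n)%N -> x <= n%:R.
Proof.
exists (Num.truncn x).+1 => n hn; have := truncnS_gt x => h.
by apply: ltW; apply: lt_le_trans h _; rewrite ler_nat.
Qed.

Lemma cnt_split U E : (cnt U E <= cnt V E + cnt [set m | U m /\ ~ V m] E)%N.
Proof.
rewrite /cnt -!sum1_count [leqLHS]big_mkcond [X in (_ <= X + _)%N]big_mkcond.
rewrite [X in (_ <= _ + X)%N]big_mkcond -big_split /=; apply: leq_sum => m _.
by do 3![case: asboolP => //=]; tauto.
Qed.

Lemma cnt_boxset_ge (e : R) : 0 < e -> exists n0 : nat, forall (n : nat) (a : pt), (n0 <= n)%N ->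
  (`|a.1| <= n)%N -> (`|a.2| <= n)%N -> (D - e) * n%:R ^+ 2 <= (cnt V (boxset a n))%:R.
Proof.
move=> e_gt0; have e2_gt0 : 0 < e / 2 by rewrite divr_gt0.
(* One half of e pays for U \ V; the other half, D * (e / (2 * D)), pays for the boundary tiles. *)
have eD_gt0 : 0 < e / (2 * D) by rewrite divr_gt0 // mulr_gt0.
have [Q [U [Q_gt0 VU perU hbox [M0 hM0]]]] := V_approx e2_gt0.
have Qr_gt0 : 0 < Q%:R :> R by rewrite ltr0n.
have c_ge0 : 0 <= 2 * Q%:R :> R by rewrite mulr_ge0.
have [x0 x0_gt0 hx0] := sqr_shift_le c_ge0 eD_gt0.
have [n1 hn1] := nat_ge_real x0.
exists (maxn M0 (maxn n1 (2 * Q))) => n a.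
rewrite !geq_max => /andP[M0n /andP[n1n n2n]] an1 an2.
have [_ hlow] := hx0 _ (hn1 n n1n).
have hbad := hM0 n a M0n an1 an2.
have hU : D * Q%:R ^+ 2 * #|` boxset ((tile Q a).1 + 1, (tile Q a).2 + 1) (n %/ Q - 1)|%:R <=
    (cnt U (boxset a n))%:R.
  apply: (cnt_tiling_ge Q_gt0) => [w|v m]; first by case/andP: (hbox w).
  exact: tile_boxset_in.
have hQ : (n%:R - 2 * Q%:R) ^+ 2 <= Q%:R ^+ 2 * ((n %/ Q - 1) ^ 2)%:R :> R.
  rewrite natrX -exprMn -natrM.
  rewrite lerXn2r ?nnegrE ?subr_ge0 -?natrM ?ler_nat // lerBlDr -natrD ler_nat.
  rewrite mulnBr muln1 [(Q * _)%N]mulnC; have := ltn_pmod n Q_gt0.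
  by rewrite {2}(divn_eq n Q); move: (n %/ Q * Q)%N (n %% Q)%N; clear => a b; lia.
have hs : (cnt U (boxset a n))%:R <= (cnt V (boxset a n))%:R +
    (count_box n (shift [set m | U m /\ ~ V m] a))%:R :> R.
  rewrite -natrD ler_nat; apply: leq_trans (cnt_split _ _) _.
  by rewrite leq_add2l cnt_boxset.
rewrite card_boxset in hU.
have hD : D * (n%:R - 2 * Q%:R) ^+ 2 <= (cnt U (boxset a n))%:R.
  by apply: le_trans hU; rewrite -mulrA ler_pM2l.
have : (D - e / 2) * n%:R ^+ 2 <= D * (n%:R - 2 * Q%:R) ^+ 2.
  rewrite (_ : D - e / 2 = D * (1 - e / (2 * D))); last by field; rewrite gt_eqF.
  by rewrite -mulrA ler_pM2l.
have : (D - e) * n%:R ^+ 2 = (D - e / 2) * n%:R ^+ 2 - e / 2 * n%:R ^+ 2.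
  by field.
move: hbad hs hD; lra.
Qed.

Lemma ln2_gt0 : 0 < ln (2 : R). Proof. by rewrite ln_gt0 // ltr1n. Qed.

(** The margin w is the enlargement of the window caused by an open cover, while the growth is still
    measured against n^2. Of e, one half pays for the logarithm of the number of residues, a quarter
    for the density of U through e1, and a quarter for margin and boundary tiles through e2. *)
Lemma ln_patterns_boxset_le (w : nat) (e : R) : 0 < e -> exists n0 : nat, forall (n : nat) (a : pt),
  (n0 <= n)%N -> ln #|` patterns (boxset a (n + w))|%:R <= (ln 2 * D + e) * n%:R ^+ 2.
Proof.
move=> e_gt0; have l2 := ln2_gt0.
pose e1 := e / (4 * ln 2); have e1_gt0 : 0 < e1 by rewrite divr_gt0 // mulr_gt0.
have De_gt0 : 0 < D + e1 by rewrite addr_gt0.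
pose e2 := e / (4 * ln 2 * (D + e1)).
have e2_gt0 : 0 < e2 by rewrite divr_gt0 // !mulr_gt0.
have [Q [U [Q_gt0 VU perU hbox _]]] := V_approx e1_gt0.
have Qr_gt0 : 0 < Q%:R :> R by rewrite ltr0n.
have c_ge0 : 0 <= w%:R + 2 * Q%:R :> R by rewrite addr_ge0 ?mulr_ge0.
have [x0 x0_gt0 hx0] := sqr_shift_le c_ge0 e2_gt0.
have [n1 hn1] := nat_ge_real x0.
have [n2 hn2] := nat_ge_real (4 * ln Q%:R / e : R).
exists (maxn n1 n2).+1 => n a n0n.
have n1n : (n1 <= n)%N by rewrite ltnW // (leq_trans _ n0n) // ltnS leq_maxl.
have n2n : (n2 <= n)%N by rewrite ltnW // (leq_trans _ n0n) // ltnS leq_maxr.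
have n_ge1 : 1 <= n%:R :> R by rewrite ler1n (leq_trans _ n0n).
have [hup _] := hx0 _ (hn1 n n1n).
have hT c : (cnt (shift U c) (boxset a (n + w)))%:R <=
    (D + e1) * Q%:R ^+ 2 * #|` boxset (tile Q a) ((n + w) %/ Q + 2)|%:R.
  apply: (cnt_tiling_le Q_gt0) => [w'|m]; last exact: tile_boxset_out.
  by rewrite shiftA; case/andP: (hbox (w'.1 + c.1, w'.2 + c.2)).
have := ln_patterns_le Q_gt0 VU perU hT; rewrite card_boxset => /le_trans; apply.
have hQ : Q%:R ^+ 2 * (((n + w) %/ Q + 2) ^ 2)%:R <= (n%:R + (w%:R + 2 * Q%:R)) ^+ 2 :> R.
  rewrite natrX -exprMn -natrM lerXn2r ?nnegrE ?addr_ge0 ?mulr_ge0 //.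
  rewrite -natrM -!natrD ler_nat.
  by rewrite mulnDr mulnC addnA [(Q * 2)%N]mulnC leq_add2r leq_divM.
have h1 : ln 2 * ((D + e1) * Q%:R ^+ 2 * (((n + w) %/ Q + 2) ^ 2)%:R) <=
    ln 2 * ((D + e1) * ((1 + e2) * n%:R ^+ 2)).
  by rewrite ler_pM2l // -mulrA ler_pM2l //; exact: le_trans hQ hup.
have h2 : 2 * ln Q%:R <= e / 2 * n%:R ^+ 2.
  have : 4 * ln Q%:R <= e * n%:R by rewrite [leRHS]mulrC -ler_pdivrMr // hn2.
  have : e * n%:R <= e * n%:R ^+ 2 by rewrite ler_pM2l // expr2 ler_peMr // (le_trans _ n_ge1).
  by lra.
have h3 : ln 2 * (D + e1) * (1 + e2) = ln 2 * D + e / 2.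
  have DL := mulr_gt0 D_gt0 l2.
  rewrite /e2 /e1; field.
  by rewrite !gt_eqF //=; lra.
rewrite !mulrA h3 in h1; move: h1 h2; rewrite !mulrDl; lra.
Qed.
(** A displacement of length at most sqrt 2. It compares a point scaled by 1 / Q with the index of
    its tile. *)
Lemma disk_perturb (x y s u r : R) : 0 <= r -> x ^+ 2 + y ^+ 2 < r ^+ 2 ->
  `|s| <= 1 -> `|u| <= 1 -> (x + s) ^+ 2 + (y + u) ^+ 2 < (r + 2) ^+ 2.
Proof.
move=> r0 xyr; rewrite !ler_norml => /andP[s1 s2] /andP[u1 u2].
have y20 := sqr_ge0 y; have x20 := sqr_ge0 x.
have xr : `|x| <= r by rewrite -(ger0_norm r0) -ler_sqr ?nnegrE ?normr_ge0 // !real_normK ?num_real //; lra.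
have yr : `|y| <= r by rewrite -(ger0_norm r0) -ler_sqr ?nnegrE ?normr_ge0 // !real_normK ?num_real //; lra.
move: xr yr; rewrite !ler_norml => /andP[x1 x2] /andP[y1 y2].
have h1 : x * s <= r by nra.
have h2 : y * u <= r by nra.
have h3 : s ^+ 2 <= 1 by rewrite expr2; nra.
have h4 : u ^+ 2 <= 1 by rewrite expr2; nra.
move: xyr x20 y20 h3 h4; rewrite !expr2; nra.
Qed.

Lemma tile_real Q (m : pt) : (0 < Q)%N -> exists s u : R,
  [/\ `|s| <= 1, `|u| <= 1,
   m.1%:~R / Q%:R = (tile Q m).1%:~R + s & m.2%:~R / Q%:R = (tile Q m).2%:~R + u].
Proof.
move=> Q_gt0; have Qr_gt0 : 0 < Q%:R :> R by rewrite ltr0n.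
have [i [j [iQ jQ mE]]] := (tileP m (tile Q m) Q_gt0).1 erefl.
have h (i0 : nat) : (i0 < Q)%N -> `|i0%:R / Q%:R : R| <= 1.
  move=> i0Q; rewrite ger0_norm ?divr_ge0 // ler_pdivrMr // mul1r ler_nat ltnW //.
exists (i%:R / Q%:R), (j%:R / Q%:R); split; [exact: h|exact: h| |].
  by rewrite {1}mE /= intrD intrM -!pmulrn; field; rewrite gt_eqF.
by rewrite {1}mE /= intrD intrM -!pmulrn; field; rewrite gt_eqF.
Qed.

Lemma disk_div Q (m : pt) (r : R) : (0 < Q)%N -> disk r m <->
  (m.1%:~R / Q%:R) ^+ 2 + (m.2%:~R / Q%:R) ^+ 2 < (r / Q%:R) ^+ 2.
Proof.
move=> Q_gt0; have Qr_gt0 : 0 < Q%:R :> R by rewrite ltr0n.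
rewrite !expr_div_n -mulrDl ltr_pM2r ?invr_gt0 ?exprn_gt0 //.
Qed.

Lemma tile_disk_out Q (m : pt) (r : R) : (0 < Q)%N -> 0 <= r -> disk r m ->
  disk (r / Q%:R + 2) (tile Q m).
Proof.
move=> Q_gt0 r0 /(disk_div _ _ Q_gt0) hm; have [s [u [s1 u1 E1 E2]]] := tile_real m Q_gt0.
rewrite /disk /= (_ : (tile Q m).1%:~R = m.1%:~R / Q%:R - s); last by rewrite E1 addrK.
rewrite (_ : (tile Q m).2%:~R = m.2%:~R / Q%:R - u); last by rewrite E2 addrK.
by apply: disk_perturb; rewrite ?normrN // divr_ge0.
Qed.

Lemma tile_disk_in Q (m : pt) (r : R) : (0 < Q)%N -> 2 * Q%:R <= r ->
  disk (r / Q%:R - 2) (tile Q m) -> disk r m.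
Proof.
move=> Q_gt0 r0 hm; have [s [u [s1 u1 E1 E2]]] := tile_real m Q_gt0.
apply/(disk_div _ _ Q_gt0); rewrite E1 E2 -[r / Q%:R](subrK 2).
by apply: disk_perturb => //; rewrite subr_ge0 ler_pdivlMr // ltr0n.
Qed.

Lemma disk_sub_boxset (r : R) (L : nat) m : 0 <= r -> r <= L%:R -> disk r m ->
  m \in boxset (- L%:Z, - L%:Z) (2 * L).
Proof.
move=> r0 rL hm; have [m1 m2] := mem_disk_sub r0 rL hm.
by rewrite mem_boxset /=; apply/and4P; split; lia.
Qed.

Local Notation Edisk r := (fset_set (disk (r : R))).

Lemma mem_Edisk (r : R) m : (m \in Edisk r) = `[< disk r m >].
Proof. by rewrite in_fset_set ?inE //; exact: finite_disk. Qed.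

Lemma cnt_disk_asymptotics (e : R) : 0 < e -> exists (Q : nat) (U : set pt) (r0 : R),
  [/\ (0 < Q)%N, V `<=` U, (forall m s : pt, U (m.1 + Q%:Z * s.1, m.2 + Q%:Z * s.2) <-> U m),
   1 <= r0 & forall r, r0 <= r ->
     (forall c, (cnt (shift U c) (Edisk r))%:R <= (D * pi + e) * r ^+ 2) /\
     (D * pi - e) * r ^+ 2 <= (cnt V (Edisk r))%:R].
Proof.
move=> e0; have p0 := pi_gt0 R.
(* t C dominates the excess of (D + t) (pi + t) (1 + t) over D pi, and the deficit on the lower side
   together with 16 t for U \ V, counted in a square of side 2 L <= 4 r around the disk. *)
pose C : R := pi + D + 1 + (D + 1) * (pi + 1) + 16.
have C0 : 0 < C.
  have DP : 0 < (D + 1) * (pi + 1) by apply: mulr_gt0; apply: addr_gt0.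
  by rewrite /C; move: DP D_gt0 p0; set a := _ * _; lra.
pose t := Num.min 1 (e / C).
have t0 : 0 < t by rewrite /t lt_min ltr01 divr_gt0.
have t1 : t <= 1 by rewrite /t ge_min lexx.
have tC : t * C <= e by rewrite -ler_pdivlMr // /t ge_min lexx orbT.
have tp : t <= pi by apply: le_trans t1 _; apply: le_trans (pi_ge2 R); rewrite ler1n.
have [Q [U [Q_gt0 VU perU hbox [M0 hM0]]]] := V_approx t0.
have Qr_gt0 : 0 < Q%:R :> R by rewrite ltr0n.
have c_ge0 : 0 <= 2 * Q%:R :> R by rewrite mulr_ge0.
have [x0 x0_gt0 hx0] := sqr_shift_le c_ge0 t0.
have [g0 g0_gt0 hg0] := gauss_circle t0.
exists Q, U, (x0 + g0 * Q%:R + 2 * Q%:R + M0%:R + 1).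
have gQ : 0 < g0 * Q%:R by rewrite mulr_gt0.
have M00 : 0 <= M0%:R :> R by [].
split=> //; first lra.
move=> r hr; have r0 : 0 <= r by lra.
have x0r : x0 <= r by lra.
have [hup hlow] := hx0 r x0r.
have r20 : 0 <= r ^+ 2 by exact: sqr_ge0.
split=> [c|].
  have hT : (cnt (shift U c) (Edisk r))%:R <= (D + t) * Q%:R ^+ 2 * #|` Edisk (r / Q%:R + 2)|%:R.
    apply: (cnt_tiling_le Q_gt0) => [w|m].
      by rewrite shiftA; case/andP: (hbox (w.1 + c.1, w.2 + c.2)).
    by rewrite !mem_Edisk => /asboolP hm; apply/asboolP; exact: tile_disk_out.
  apply: le_trans hT _.
  have gr : g0 <= r / Q%:R + 2 by rewrite -lerBlDr ler_pdivlMr //; lra.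
  have /andP[_ hG] := hg0 _ gr.
  have E : Q%:R ^+ 2 * (r / Q%:R + 2) ^+ 2 = (r + 2 * Q%:R) ^+ 2.
    by rewrite -exprMn; congr (_ ^+ 2); field; rewrite gt_eqF.
  have h1 : (D + t) * Q%:R ^+ 2 * #|` Edisk (r / Q%:R + 2)|%:R <=
      (D + t) * ((pi + t) * ((1 + t) * r ^+ 2)).
    rewrite -mulrA ler_pM2l ?addr_gt0 //.
    apply: le_trans (_ : Q%:R ^+ 2 * ((pi + t) * (r / Q%:R + 2) ^+ 2) <= _).
      by rewrite ler_pM2l // exprn_gt0.
    by rewrite mulrCA E ler_pM2l // addr_gt0.
  apply: le_trans h1 _.
  rewrite (_ : (D + t) * ((pi + t) * ((1 + t) * r ^+ 2)) =
    (D + t) * (pi + t) * (1 + t) * r ^+ 2); last by ring.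
  apply: ler_wpM2r => //.
  suff h : (D + t) * (pi + t) * (1 + t) <= D * pi + t * C.
    by apply: le_trans h _; rewrite lerD2l.
  have tt : t * t <= t by rewrite ler_piMl // ltW.
  have ttt : t * t * t <= t by rewrite (le_trans _ tt) // ler_piMr // mulr_ge0 // ltW.
  rewrite /C; have := mulr_ge0 (ltW D_gt0) (ltW t0); have := mulr_ge0 (ltW p0) (ltW t0).
  have hD : D * (t * t) <= D * t by rewrite ler_pM2l.
  have hp : pi * (t * t) <= pi * t by rewrite ler_pM2l.
  lra.
have hU : D * Q%:R ^+ 2 * #|` Edisk (r / Q%:R - 2)|%:R <= (cnt U (Edisk r))%:R.
  apply: (cnt_tiling_ge Q_gt0) => [w|v m]; first by case/andP: (hbox w).
  rewrite !mem_Edisk => /asboolP hv vE; apply/asboolP; apply: (tile_disk_in Q_gt0); first lra.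
  by rewrite vE.
have gr : g0 <= r / Q%:R - 2 by rewrite lerBrDr ler_pdivlMr //; lra.
have /andP[hG _] := hg0 _ gr.
have E : Q%:R ^+ 2 * (r / Q%:R - 2) ^+ 2 = (r - 2 * Q%:R) ^+ 2.
  by rewrite -exprMn; congr (_ ^+ 2); field; rewrite gt_eqF.
have h1 : D * ((pi - t) * ((1 - t) * r ^+ 2)) <= D * Q%:R ^+ 2 * #|` Edisk (r / Q%:R - 2)|%:R.
  rewrite -[leRHS]mulrA ler_pM2l //.
  apply: le_trans (_ : Q%:R ^+ 2 * ((pi - t) * (r / Q%:R - 2) ^+ 2) <= _); last first.
    by rewrite ler_pM2l // exprn_gt0.
  by rewrite [leRHS]mulrCA E ler_wpM2l // subr_ge0.
pose L := (Num.truncn r).+1.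
have /andP[L1 L2] := truncn_itv r0.
have Lr : L%:R <= r + 1 by rewrite /L -natr1 lerD2r.
have rL : r <= L%:R by exact: ltW.
have M0L : (M0 <= 2 * L)%N.
  rewrite -(ler_nat R); apply: le_trans (_ : L%:R <= _); first by lra.
  by rewrite ler_nat leq_pmull.
have hbad := hM0 (2 * L)%N (- L%:Z, - L%:Z) M0L.
have {}hbad : (count_box (2 * L) (shift [set m | U m /\ ~ V m] (- L%:Z, - L%:Z)))%:R <=
    16 * t * r ^+ 2.
  apply: le_trans (hbad _ _) _; rewrite /= ?abszN ?leq_pmull //.
  rewrite natrM exprMn; have : L%:R ^+ 2 <= 4 * r ^+ 2.
    rewrite (_ : 4 = 2 ^+ 2); last by rewrite -natrX.
    by rewrite -exprMn lerXn2r ?nnegrE ?mulr_ge0 //; lra.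
  by move=> hL; rewrite -[16](_ : 4 * 4 = _) ?mulrA; [have := ler_wpM2l (ltW t0) hL; lra|rewrite -natrM].
have hs : (cnt U (Edisk r))%:R <= (cnt V (Edisk r))%:R +
    (count_box (2 * L) (shift [set m | U m /\ ~ V m] (- L%:Z, - L%:Z)))%:R :> R.
  rewrite -natrD ler_nat; apply: leq_trans (cnt_split _ _) _.
  rewrite leq_add2l; apply: leq_trans (cnt_boxset _ _ _).
  apply: cnt_subset => m; rewrite mem_Edisk => /asboolP; exact: disk_sub_boxset.
suff : (D * pi - t * C) * r ^+ 2 <= (cnt V (Edisk r))%:R.
  by apply: le_trans; rewrite ler_wpM2r // lerD2l lerN2.
have : (D * pi - t * C + 16 * t) * r ^+ 2 <= D * ((pi - t) * ((1 - t) * r ^+ 2)).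
  rewrite (_ : D * ((pi - t) * ((1 - t) * r ^+ 2)) =
    D * ((pi - t) * (1 - t)) * r ^+ 2); last by ring.
  apply: ler_wpM2r => //; rewrite /C.
  have := mulr_gt0 D_gt0 t0; have := mulr_gt0 p0 t0; have := mulr_gt0 t0 t0.
  have := mulr_gt0 (mulr_gt0 t0 t0) D_gt0; have := mulr_gt0 (mulr_gt0 D_gt0 p0) t0.
  lra.
move: hs hU h1 hbad; rewrite mulrDl; lra.
Qed.
Lemma cvg_disk_ratio (f : R -> R) (L : R) :
  (forall e, 0 < e -> exists r0, forall r, r0 <= r -> (L * pi - e) * r ^+ 2 <= f r <= (L * pi + e) * r ^+ 2) ->
  (f r / (pi * r ^+ 2)) @[r --> +oo] --> L.
Proof.
move=> h; apply/cvgrPdist_le => e e0; have p0 := pi_gt0 R.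
have [r0 hr0] := h (e * pi) (mulr_gt0 e0 p0).
near=> r.
have r_gt0 : 0 < r by near: r; exact: nbhs_pinfty_gt.
have /hr0/andP[h1 h2] : r0 <= r by near: r; apply: nbhs_pinfty_ge; rewrite num_real.
have pr_gt0 : 0 < pi * r ^+ 2 by rewrite mulr_gt0 // exprn_gt0.
rewrite distrC ler_distl ler_pdivlMr // ler_pdivrMr //; apply/andP; split.
  by apply: le_trans h1; rewrite le_eqVlt; apply/orP; left; apply/eqP; ring.
by apply: le_trans h2 _; rewrite le_eqVlt; apply/orP; left; apply/eqP; ring.
Unshelve. all: by end_near. Qed.

Lemma shift0 B : shift B (0, 0) = B.
Proof. by apply/seteqP; split=> -[a b]; rewrite /shift /= !addr0. Qed.

Lemma tied_density_of_approx : tied_density V D.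
Proof.
apply: cvg_disk_ratio => e e0; have [Q [U [r0 [_ VU _ _ hr0]]]] := cnt_disk_asymptotics e0.
exists r0 => r /hr0[/(_ (0, 0)) + h2].
have -> : fset_set (V `&` disk r) = [fset m in Edisk r | `[< V m >]]%fset.
  apply/fsetP => m; rewrite in_fset_set; last first.
    by apply: (sub_finite_set (B := disk r)) (finite_disk r) => ? [].
  rewrite !inE /= mem_Edisk; apply/idP/andP; rewrite inE => -[? ?]; split=> //; exact/asboolP.
rewrite shift0 -cnt_fset => h1; rewrite h2 /=; apply: le_trans h1.
by rewrite ler_nat; apply: cnt_sub => m _; exact: VU.
Qed.

Lemma patch_number_patterns (r : R) : patch_number V r = #|` patterns (Edisk r)|.
Proof.
rewrite /patch_number; pose f (W : {fset pt}) : set pt := [set` W].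
have -> : [set [set v - t | v in V] `&` disk r | t in [set: pt]] = f @` [set` patterns (Edisk r)].
  have pE t : [set v - t | v in V] `&` disk r = f (patt t (Edisk r)).
    apply/seteqP; split=> m; rewrite /f /= !inE mem_Edisk /shift /=.
      move=> [[v Vv <-] hm]; apply/andP; split; first exact/asboolP.
      by apply/asboolP; case: (v) (t) Vv => ? ? [? ?] /=; rewrite !subrK.
    move=> /andP[/asboolP hm /asboolP Vm]; split=> //.
    exists (m.1 + t.1, m.2 + t.2) => //.
    by case: (m) (t) => ? ? [? ?]; congr pair; rewrite /= addrK.
  apply/seteqP; split=> [_ [t _ <-]|_ [W /patternsP[t ->] <-]].
    by exists (patt t (Edisk r)); [apply/patternsP; exists t|rewrite pE].
  by exists t => //; rewrite pE.
have f_inj : injective f.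
  move=> W W' E; apply/fsetP => m; apply/idP/idP => hm.
    by have : f W m := hm; rewrite E.
  by have : f W' m := hm; rewrite -E.
rewrite fset_set_image; last exact: finite_fset.
by rewrite set_fsetK card_imfset.
Qed.

Lemma patch_entropy_of_approx : patch_counting_entropy V (ln 2 * D : R).
Proof.
apply: cvg_disk_ratio => e e0; have l2 := ln2_gt0.
pose t := e / (2 * ln 2); have t0 : 0 < t by rewrite divr_gt0 // mulr_gt0.
have lt : ln 2 * t = e / 2 by rewrite /t; field; rewrite gt_eqF.
have [Q [U [r0 [Q_gt0 VU perU r01 hr0]]]] := cnt_disk_asymptotics t0.
have q0 : 0 <= 4 * ln (Q%:R : R) / e.
  by apply: divr_ge0; [rewrite mulr_ge0 // ln_ge0 // ler1n|exact: ltW].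
exists (r0 + 4 * ln Q%:R / e) => r hr; rewrite patch_number_patterns.
have r0r : r0 <= r by lra.
have [h1 h2] := hr0 r r0r.
have p2 := @ln_patterns_ge R (Edisk r) V_hered.
have p1 := ln_patterns_le Q_gt0 VU perU h1.
apply/andP; split.
  apply: le_trans p2; apply: le_trans (_ : ln 2 * ((D * pi - t) * r ^+ 2) <= _); last first.
    by rewrite ler_pM2l.
  rewrite mulrA mulrBr lt -mulrA ler_wpM2r ?sqr_ge0 //; lra.
apply: le_trans p1 _.
have h3 : 2 * ln Q%:R <= e / 2 * r ^+ 2.
  have : 4 * ln Q%:R <= e * r by rewrite [leRHS]mulrC -ler_pdivrMr //; lra.
  have : e * r <= e * r ^+ 2 by rewrite ler_pM2l // expr2 ler_peMr //; lra.
  by lra.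
have -> : ln 2 * ((D * pi + t) * r ^+ 2) = (ln 2 * D * pi + ln 2 * t) * r ^+ 2 by ring.
by rewrite lt; move: h3; rewrite !mulrDl; lra.
Qed.
End Asymptotics.
End SievedSets.

(** * Topological entropy *)

Section Cylinders.
Local Notation pt := (int * int)%type.
Implicit Types (F : {fset pt}) (x y : full_shift) (A : set full_shift).

Definition cyl F x : set full_shift := [set y | forall m, m \in F -> y m = x m].

Lemma nbhs_cyl F x : nbhs x (cyl F x).
Proof.
have -> : cyl F x = \bigcap_(m in [set` F]) [set y : full_shift | y m = x m].
  by apply/seteqP; split=> y h m; exact: h.
apply: filter_bigI => m _.
have := @proj_continuous pt (fun=> bool) m x [set x m].
by apply; rewrite nbhs_principalE; apply/principal_filterP.
Qed.

(* The cylinders at x generate a filter that converges to x pointwise. *)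
Lemma cyl_subset A x : nbhs x A -> exists F, cyl F x `<=` A.
Proof.
pose G : set_system full_shift := filter_from setT (fun F => cyl F x).
have FG : Filter G.
  apply: filter_from_filter; first by exists fset0.
  move=> F F' _ _; exists (F `|` F')%fset => // y yx.
  by split=> m mF; apply: yx; rewrite in_fsetU mF ?orbT.
suff Gx : G --> x by move=> /Gx[F _ FA]; exists F.
apply/cvg_sup => i; apply/cvg_image; first by rewrite eqEsubset; split=> b // _; exists (fun=> b).
move=> W /= Wx; exists [set y : full_shift | W (y i)]; last first.
  by rewrite eqEsubset; split=> [b [y Wy <-]//|b Wb]; exists (fun=> b).
exists [fset i]%fset => // y yx; rewrite /= yx ?in_fset1 //.
exact: nbhs_singleton.
Qed.

Lemma compact_full_shift : compact [set: full_shift].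
Proof.
have := @tychonoff pt (fun=> bool) (fun=> setT) (fun=> bool_compact).
by rewrite (_ : [set f | _] = setT) //; apply/seteqP; split.
Qed.

Lemma open_coord (m : pt) b : open [set x : full_shift | x m = b].
Proof.
rewrite openE => x xb; apply: filterS (nbhs_cyl [fset m]%fset x) => y yx /=.
by rewrite yx ?in_fset1.
Qed.

End Cylinders.
Section ShiftSpace.
Variable V : set (int * int).
Local Notation pt := (int * int)%type.
Local Notation X := (shift_space V).
Implicit Types (F E : {fset pt}) (x y : full_shift) (U : set (set full_shift)).

Definition shift_point (t : pt) : full_shift := fun m => `[< shift V t m >].

Lemma char_fun_translate (t : pt) :
  char_fun [set t + v | v in V] = shift_point (- t.1, - t.2).
Proof.
apply/funext => m; apply: asbool_equiv_eq; split=> [[v Vv <-]|Vm].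
  by rewrite /shift /= ![_ + v.1]addrC ![_ + v.2]addrC !addrK; case: v Vv.
exists (m.1 - t.1, m.2 - t.2) => //.
by case: m t {Vm} => a b [a' b'] /=; congr pair; rewrite /= addrC subrK.
Qed.

(** Cylinders form a neighbourhood base, so closure is tested on finite windows. *)
Lemma shift_spaceP y : X y <-> forall F, exists t, forall m, m \in F -> y m = shift_point t m.
Proof.
split=> [Xy F|h A /cyl_subset[F FA]].
  have [_ [[t _ <-] yF]] := Xy _ (nbhs_cyl F y); rewrite char_fun_translate in yF.
  by exists (- t.1, - t.2) => m mF; rewrite yF.
have [t ht] := h F; exists (shift_point t); split; last by apply: FA => m mF; rewrite ht.
exists (- t.1, - t.2) => //; rewrite char_fun_translate /= !opprK.
by case: t {ht}.
Qed.

Lemma shift_space_point t : X (shift_point t).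
Proof. by apply/shift_spaceP => F; exists t. Qed.

Lemma shift_space_translate (s : pt) y : X y -> X (translate s y).
Proof.
move=> /shift_spaceP Xy; apply/shift_spaceP => F.
have [t ht] := Xy [fset (m - s)%R | m in F]%fset.
exists (t.1 - s.1, t.2 - s.2) => m mF; rewrite /translate ht; last first.
  by apply/imfsetP; exists m.
have E1 : (m - s).1 + t.1 = m.1 + (t.1 - s.1) by rewrite /=; ring.
have E2 : (m - s).2 + t.2 = m.2 + (t.2 - s.2) by rewrite /=; ring.
by rewrite /shift_point /shift /= -E1 -E2.
Qed.

Lemma patt_eqP (t t' : pt) E : patt V t E = patt V t' E <->
  forall m, m \in E -> shift_point t m = shift_point t' m.
Proof.
split=> [EE m mE|h]; last first.
  by apply/fsetP => m; rewrite !inE; case: (boolP (m \in E)) => //= mE; exact: h.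
have := congr1 (fun W : {fset pt} => m \in W) EE; rewrite !inE mE /=.
by [].
Qed.

Lemma compact_shift_space : compact X.
Proof. by apply: (subclosed_compact _ compact_full_shift) => //; exact: closed_closure. Qed.

(* The Lebesgue number lemma, a finite window playing the role of the radius. *)
Lemma open_cover_window U : open_cover X U ->
  exists F, forall x, X x -> exists2 A, U A & cyl F x `<=` A.
Proof.
move=> [oU XU]; pose G : set_system {fset pt} :=
  filter_from setT (fun F => [set F' | F `<=` F']%fset).
have FG : Filter G.
  apply: filter_from_filter; first by exists fset0.
  move=> F F' _ _; exists (F `|` F')%fset => // F'' /=.
  by rewrite fsubUset => /andP[].
have cov := (compact_near_coveringP X).1 compact_shift_space _ G
  (fun F x => exists2 A, U A & cyl F x `<=` A) FG.
have [|F _ hF] := cov; last by exists F => x Xx; exact: (hF F (fsubset_refl F) x Xx).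
move=> x Xx; have [A UA Ax] := XU x Xx.
have [F FA] := cyl_subset (open_nbhs_nbhs (conj (oU _ UA) Ax)).
exists (cyl F x, [set F' | F `<=` F']%fset).
  by split; [exact: nbhs_cyl|exists F].
move=> [x' F'] /= [xx' FF']; exists A => // y yx; apply: FA => m mF.
by rewrite yx ?xx' //; exact: (fsubsetP FF').
Qed.

(** [translate s] reads the coordinate j - s, so the square is reflected: with |j| <= w and 0 <= s <
    n the coordinates run from 1 - n - w to w. *)
Definition window (w n : nat) : {fset pt} := boxset (- (n + w)%N%:Z, - (n + w)%N%:Z) (n + (2 * w).+1).

Lemma fset_window F : exists w : nat, forall n j (s : pt), j \in F -> square n s -> j - s \in window w n.
Proof.
exists (\max_(j <- F) (`|j.1| + `|j.2|))%N => n j s jF [s1 s2 s3 s4].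
have : (`|j.1| + `|j.2| <= \max_(j <- F) (`|j.1| + `|j.2|))%N.
  by rewrite (big_rem j) //= leq_maxl.
move: (\max_(j <- F) _)%N => w jw; rewrite mem_boxset.
by case: j s s1 s2 s3 s4 jw {jF} => a b [a' b'] /= *; apply/and4P; split; lia.
Qed.

(** The pattern of x on the window fixes the F-cylinder of each [translate s x], s in the square,
    hence a member of [U] containing it. One element of the join per pattern thus covers X. *)
Lemma iterated_join_subcover U : open_cover X U -> exists w : nat, forall n,
  exists s : seq (set full_shift), [/\ forall A, A \in s -> iterated_join translate U n A,
    X `<=` \bigcup_(A in [set` s]) A & size s = #|` patterns V (window w n)|].
Proof.
move=> oU; have [F hF] := open_cover_window oU; have [w hw] := fset_window F; exists w => n.
have /choice[phi phiP] (W : {fset pt}) : exists phi : pt -> set full_shift,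
    (forall s, U (phi s)) /\ forall x, X x ->
    (exists t, W = patt V t (window w n) /\ forall m, m \in window w n -> x m = shift_point t m) ->
    forall s, square n s -> phi s (translate s x).
  have [[t tW]|nW] := pselect (exists t, W = patt V t (window w n)); last first.
    (* A set W that is no pattern gets an arbitrary member of [U]; its second property is void. *)
    have [A UA _] := hF (shift_point 0) (@shift_space_point 0); exists (fun=> A); split=> // x _ [t [tW _]].
    by case: nW; exists t.
  have /choice[psi psiP] (s : pt) : exists A, U A /\ cyl F (translate s (shift_point t)) `<=` A.
    by have [A ? ?] := hF _ (@shift_space_translate s _ (@shift_space_point t)); exists A.
  exists psi; split=> [s|x Xx [t' [tW' xt']] s sn]; first by case: (psiP s).
  case: (psiP s) => _; apply => j jF; rewrite /translate xt' ?hw //.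
  by apply: (patt_eqP t' t (window w n)).1; rewrite -?tW -?tW' // hw.
pose B W := \bigcap_(s in square n) (translate s @^-1` phi W s).
exists (map B (patterns V (window w n))); split; last by rewrite size_map.
  by move=> _ /mapP[W _ ->]; exists (phi W) => // s; case: (phiP W).
move=> x Xx; have [t ht] := (shift_spaceP x).1 Xx (window w n).
exists (B (patt V t (window w n))).
  by rewrite /=; apply: map_f; apply/patternsP; exists t.
by move=> s sn; case: (phiP (patt V t (window w n))) => _ h; apply: h => //; exists t.
Qed.

End ShiftSpace.
Section LimnEsup.
Variables (R : realType) (u : nat -> R) (c : R).

Lemma limn_esup_le_near (n0 : nat) : (forall n, (n0 <= n)%N -> u n <= c) ->
  (limn_esup (fun n => (u n)%:E) <= c%:E)%E.
Proof.
move=> h; apply: (@le_trans _ _ (ereal_sup [set (u n)%:E | n in [set n | (n0 <= n)%N]])).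
  by apply: ereal_inf_lbound; exists [set n | (n0 <= n)%N] => //; exists n0.
by apply: ge_ereal_sup => _ [n hn <-]; rewrite lee_fin h.
Qed.

Lemma limn_esup_ge_near (n0 : nat) : (forall n, (n0 <= n)%N -> c <= u n) ->
  (c%:E <= limn_esup (fun n => (u n)%:E))%E.
Proof.
move=> h; apply: le_ereal_inf_tmp => _ [A [n1 _ hA] <-].
apply: (@le_trans _ _ (u (maxn n0 n1))%:E); first by rewrite lee_fin h // leq_maxl.
by apply: ereal_sup_ubound; exists (maxn n0 n1) => //; apply: hA; exact: leq_maxr.
Qed.
End LimnEsup.

Section ShiftEntropy.
Variables (R : realType) (V : set (int * int)) (D : R).
Local Notation pt := (int * int)%type.
Local Notation X := (shift_space V).
Hypothesis D_gt0 : 0 < D.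
Hypotheses (V_approx : approximable V D) (V_hered : hereditary V).

Lemma subcover_number_le (U : set (set full_shift)) (s : seq (set full_shift)) :
  (forall A, A \in s -> U A) -> X `<=` \bigcup_(A in [set` s]) A ->
  subcover_number R X U <= (size s)%:R.
Proof.
move=> sU Xs; apply: ge_inf; first by exists 0 => _ [s' _ <-].
by exists s.
Qed.

(** x may be nonpositive, where [ln] takes the default value 0. *)
Lemma ln_le_of_le (x y : R) : 1 <= y -> x <= y -> ln x <= ln y.
Proof.
move=> y1 xy; have [x0|x0] := ltP 0 x.
  by rewrite ler_ln ?posrE // (lt_le_trans ltr01).
by rewrite (ln0 x0) ln_ge0.
Qed.

Lemma cover_entropy_le U : open_cover X U ->
  (cover_entropy R translate X U <= (ln 2 * D)%:E)%E.
Proof.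
move=> oU; have [w hw] := iterated_join_subcover oU.
apply/lee_addgt0Pr => e e0.
have [n0 hn0] := ln_patterns_boxset_le D_gt0 V_approx (2 * w).+1 e0.
apply: (@limn_esup_le_near _ _ _ n0.+1) => n n0n.
have n2 : 0 < n%:R ^+ 2 :> R by rewrite exprn_gt0 // ltr0n (leq_ltn_trans _ n0n).
have [s [sU Xs size_s]] := hw n.
rewrite ler_pdivrMr //; apply: le_trans (hn0 n (- (n + w)%N%:Z, - (n + w)%N%:Z) (ltnW n0n)).
apply: ln_le_of_le; first by rewrite ler1n patterns_gt0.
by rewrite -[boxset _ _]/(window w n) -size_s; exact: subcover_number_le.
Qed.

Definition coord_cover : set (set full_shift) :=
  [set [set x : full_shift | x (0, 0) = b] | b in [set: bool]].

Lemma open_coord_cover : open_cover X coord_cover.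
Proof.
split=> [_ [b _ <-]|x _]; first exact: open_coord.
by exists [set y : full_shift | y (0, 0) = x (0, 0)] => //; exists (x (0, 0)).
Qed.

(** An element of the join fixes x at -s for all s in the square, that is on the reflected square
    with corner 1 - n. It therefore contains points of at most one pattern there, and choosing an
    element for each pattern is injective. *)
Lemma patterns_le_subcover n (s : seq (set full_shift)) :
  (forall A, A \in s -> iterated_join translate coord_cover n A) ->
  X `<=` \bigcup_(A in [set` s]) A ->
  (#|` patterns V (boxset (1 - n%:Z, 1 - n%:Z)%R n)| <= size s)%N.
Proof.
set E := boxset _ _ => sU Xs.
have /choice[h hP] (W : {fset pt}) : exists A, W \in patterns V E ->
    A \in s /\ exists t, W = patt V t E /\ A (shift_point V t).
  have [/patternsP[t tW]|] := boolP (W \in patterns V E); last by exists setT.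
  have [A As Ax] := Xs _ (@shift_space_point V t).
  by exists A => _; split=> //; exists t.
rewrite -(size_map h); apply: uniq_leq_size.
  rewrite map_inj_in_uniq ?fset_uniq // => W W' Wp Wp' E'.
  have [As [t [tW hx]]] := hP W Wp; have [_ [t' [tW' hx']]] := hP W' Wp'.
  have {}hx' : h W (shift_point V t') by rewrite E'.
  have [phi phiU hphi] := sU _ As; rewrite -hphi in hx hx'.
  rewrite tW tW'; apply/patt_eqP => m; rewrite mem_boxset => /and4P[m1 m2 m3 m4] /=.
  have sq : square n (- m.1, - m.2).
    by rewrite /= in m1 m2 m3 m4; rewrite /square /=; split; lia.
  have [b _ phiE] := phiU (- m.1, - m.2).
  have := hx _ sq; have := hx' _ sq; rewrite /= -phiE /= /translate.
  have -> : ((0, 0) - (- m.1, - m.2) : pt) = m.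
    by case: (m) => a c; congr pair; rewrite /= opprK add0r.
  by move=> -> ->.
by move=> _ /mapP[W Wp ->]; have [] := hP W Wp.
Qed.

Lemma coord_cover_entropy_ge : ((ln 2 * D)%:E <= cover_entropy R translate X coord_cover)%E.
Proof.
have l2 := ln2_gt0 R; apply/lee_subgt0Pr => e e0.
have [n0 hn0] := cnt_boxset_ge D_gt0 V_approx (divr_gt0 e0 l2).
apply: (@limn_esup_ge_near _ _ _ n0.+1) => n n0n.
have n_gt0 : (0 < n)%N by exact: leq_ltn_trans n0n.
have n2 : 0 < n%:R ^+ 2 :> R by rewrite exprn_gt0 // ltr0n.
rewrite ler_pdivlMr //.
set E := boxset (1 - n%:Z, 1 - n%:Z) n.
have hE : (D - e / ln 2) * n%:R ^+ 2 <= (cnt V E)%:R.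
  by apply: hn0; rewrite ?(ltnW n0n) //=; lia.
have hp : (#|` patterns V E|)%:R <= subcover_number R X (iterated_join translate coord_cover n).
  apply: lb_le_inf.
    (* The infimum is over a nonempty set, since compactness supplies a finite subcover. *)
    have [w hw] := iterated_join_subcover open_coord_cover; have [s [sU Xs _]] := hw n.
    by exists (size s)%:R, s.
  by move=> _ [s [sU Xs] <-]; rewrite ler_nat; exact: patterns_le_subcover.
apply: le_trans (ln_le_of_le _ hp); last first.
  by apply: le_trans hp; rewrite ler1n patterns_gt0.
apply: le_trans (ln_patterns_ge R E V_hered).
rewrite (_ : ln 2 * D - e = ln 2 * (D - e / ln 2)); last by field; rewrite gt_eqF.
by rewrite -mulrA ler_pM2l.
Qed.

Lemma topological_entropy_of_approx :
  topological_entropy R translate X = (ln 2 * D)%:E.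
Proof.
apply/eqP; rewrite eq_le; apply/andP; split.
  by apply: ge_ereal_sup => _ [U oU <-]; exact: cover_entropy_le.
apply: le_trans coord_cover_entropy_ge _; apply: ereal_sup_ubound.
by exists coord_cover => //; exact: open_coord_cover.
Qed.

End ShiftEntropy.

Unset Implicit Arguments.

Theorem theorem5p1 (R : realType) (d : int) (k : nat)
    (d_neq0 : d != 0) (d_neq1 : d != 1) (d_sqfree : squarefree d)
    (k_ge2 : (2 <= k)%N) :
  let V := kfree_set d k in
  let zetaK := dedekind_zeta (ringint d) (k%:R : R) in
  exists D h : R,
    [/\ tied_density V D,
        patch_counting_entropy V h,
        topological_entropy R translate (shift_space V) = h%:E,
        h = ln 2 * D &
        zetaK \is a fin_num /\ h = ln 2 / fine zetaK].
Proof.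
move=> V zetaK; pose z := zetaR d R k.
have z_gt0 : 0 < z by exact: zetaR_gt0.
have D_gt0 : 0 < z^-1 by rewrite invr_gt0.
have zetaE : zetaK = z%:E by exact: dedekind_zetaE.
have approx := @kfree_approx d d_neq1 d_sqfree R k k_ge2.
have hered := @kfree_translate d d_neq1 d_sqfree R k k_ge2.
exists z^-1, (ln 2 * z^-1); split=> //.
- exact: tied_density_of_approx D_gt0 approx.
- exact: patch_entropy_of_approx D_gt0 approx hered.
- exact: topological_entropy_of_approx D_gt0 approx hered.
- by rewrite zetaE.
Qed.
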